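(* Let $H$ be a finite-dimensional Hopf algebra over a field $k$, let $B$ be a right $H$-module algebra, let $A=H\# B$ be the smash product, and let $D(B,H)$ be the localization of $A_H\text{-}\underline{\mathrm{mod}}$ with respect to quasi-isomorphisms. Then $D(B,H)$ is a triangulated category. Tensoring with an $H$-module is an exact functor in $D(B,H)$, and the Grothendieck group of $D(B,H)$ is a module over the ring $K(H\text{-}\underline{\mathrm{mod}})$.
   Context: All unadorned tensor products are over $k$. A left integral $\Lambda\in H$ is a nonzero element with $h\Lambda=\epsilon(h)\Lambda$ for all $h\in H$ ($\epsilon$ the counit); it exists and is unique up to a nonzero scalar; fix one. A left $H$-comodule algebra is an associative unital $k$-algebra $A$ with a $k$-algebra homomorphism $\Delta_A:A\to H\otimes A$ making $A$ a left $H$-comodule. For an $H$-module $V$ and a left $A$-module $M$, $V\otimes M$ is an $A$-module via $\Delta_A$. A morphism of $A$-modules is null-homotopic if it factors through an $A$-module of the form $H\otimes N$ with $N$ an $A$-module. $A_H\text{-}\underline{\mathrm{mod}}$ is the quotient of the category of left $A$-modules by the ideal of null-homotopic morphisms. For $A=H$, $\Delta_A=\Delta$, it is the stable category $H\text{-}\underline{\mathrm{mod}}$ ($H$-modules modulo morphisms factoring through projective (= injective) modules). $A_H\text{-}\underline{\mathrm{mod}}$ is triangulated with shift functor $T(M)=(H/k\Lambda)\otimes M$ and distinguished triangles the sextuples isomorphic in $A_H\text{-}\underline{\mathrm{mod}}$ to the following standard ones: for an $A$-module map $u:X\to Y$, let $C_u$ be the pushout of $x=\Lambda\otimes\mathrm{Id}:X\to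 H\otimes X$ and $u$, with structure maps $\overline{u}:H\otimes X\to C_u$, $v:Y\to C_u$, and let $w:C_u\to TX$ be the map with $wv=0$ and $w\overline{u}$ equal to the quotient map $H\otimes X\to TX$; the standard triangle is $X\xrightarrow{u}Y\xrightarrow{v}C_u\xrightarrow{w}TX$. A right $H$-module algebra is a $k$-algebra $B$ that is a right $H$-module whose multiplication and unit maps are $H$-module maps. The smash product $A=H\# B$ is $H\otimes B$ with multiplication $(h\otimes b)(l\otimes c)=\sum hl_{(1)}\otimes(b\cdot l_{(2)})c$ and left $H$-comodule structure $\Delta_A(h\otimes b)=\Delta(h)\otimes b$; it is a left $H$-comodule algebra containing $H$ as the subalgebra $H\otimes 1$. Restriction from $A$-modules to $H$-modules descends to an exact functor $A_H\text{-}\underline{\mathrm{mod}}\to H\text{-}\underline{\mathrm{mod}}$; a morphism of $A_H\text{-}\underline{\mathrm{mod}}$ is a quasi-isomorphism if this functor sends it to an isomorphism. $D(B,H)$ has the same objects as $A_H\text{-}\underline{\mathrm{mod}}$, and its morphisms from $M$ to $N$ are equivalence classes of diagrams $M\xleftarrow{s}M'\xrightarrow{f}N$ with $s$ a quasi-isomorphism. Its shift functor is induced by $T$ and its distinguished triangles are the sextuples isomorphic in $D(B,H)$ to images of distinguished triangles of $A_H\text{-}\underline{\mathrm{mod}}$. An additive functor between triangulated categories is exact if it takes distinguished triangles to distinguished triangles. The Grothendieck group $K(\mathcal{C})$ of a triangulated category is the abelian group with generators $[X]$ over objects $X$ and relations $[Y]=[X]+[Z]$ for each distinguished triangle $X\to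 Y\to Z\to TX$. When Grothendieck groups are considered, $H\text{-}\underline{\mathrm{mod}}$ denotes the stable category of finite-dimensional $H$-modules (its Grothendieck group is a ring with $[V][W]=[V\otimes W]$), and the objects of $A_H\text{-}\underline{\mathrm{mod}}$ (hence of $D(B,H)$) are restricted to all finite-dimensional $A$-modules, or all finitely generated $A$-modules if $A$ is Noetherian, or more generally any (essentially small) class of $A$-modules closed under finite direct sums, subquotients, and tensoring with $H$. The module structure is induced by $[V]\cdot[M]=[V\otimes M]$. *)

(* Defs.v *)
From HB Require Import structures.
From mathcomp Require Import all_boot all_algebra.
From mathcomp Require Import boolp.

Set Implicit Arguments.
Unset Strict Implicit.
Unset Printing Implicit Defensive.

Import GRing.Theory.
Local Open Scope ring_scope.
Local Open Scope quotient_scope.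

(* Restriction of scalars along phi.                                          *)
Definition restr (R S : pzRingType) (phi : {rmorphism R -> S})
  (M : lmodType S) : Type := M.

Section Restriction.
Variables (R S : pzRingType) (phi : {rmorphism R -> S}).

Section Module.
Variable M : lmodType S.
Local Notation restrM := (restr phi M).
HB.instance Definition _ := GRing.Zmodule.copy restrM M.

Definition restr_scale (c : R) (x : restrM) : restrM := phi c *: (x : M).

Fact restr_scalerA a b v :
  restr_scale a (restr_scale b v) = restr_scale (a * b) v.
Proof. by rewrite /restr_scale scalerA rmorphM. Qed.
Fact restr_scale1r : left_id 1 restr_scale.
Proof. by move=> v; rewrite /restr_scale rmorph1 scale1r. Qed.
Fact restr_scalerDr : right_distributive restr_scale +%R.
Proof. by move=> a u v; rewrite /restr_scale scalerDr. Qed.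
Fact restr_scalerDl v : {morph restr_scale^~ v : a b / a + b}.
Proof. by move=> a b; rewrite /restr_scale rmorphD scalerDl. Qed.

HB.instance Definition _ := GRing.Zmodule_isLmodule.Build R restrM
  restr_scalerA restr_scale1r restr_scalerDr restr_scalerDl.
End Module.

Section Map.
Variables (M N : lmodType S) (f : {linear M -> N}).
Definition restr_map (x : restr phi M) : restr phi N := f x.
Fact restr_map_is_linear : linear restr_map.
Proof. by move=> a u v; rewrite /restr_map linearP. Qed.
HB.instance Definition _ :=
  GRing.isLinear.Build R (restr phi M) (restr phi N) *:%R restr_map
    restr_map_is_linear.
End Map.
End Restriction.

(* A unital associative k-algebra, given as a ring with a central ring        *)
(* morphism from k. Unlike algType, the zero algebra is not excluded.         *)
Record kalg (k : fieldType) := KAlg {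
  kring :> pzRingType;
  kunit : {rmorphism k -> kring};
  kcentral : forall c x, kunit c * x = x * kunit c }.

(* The k-vector space underlying a module over a k-algebra A; that of A       *)
(* itself is ksp A^o.                                                         *)
Notation ksp := (restr (kunit _)).

Section Tensor.
Variables (k : fieldType) (U V : lmodType k).

Definition bilin (W : lmodType k) (f : U -> V -> W) :=
  (forall v, linear (f^~ v)) /\ (forall u, linear (f u)).

(* U (x) V is the set of formal sums of pairs (u, v), two of which are        *)
(* identified when no bilinear map tells them apart.                          *)
Definition tsum (W : lmodType k) (f : U -> V -> W) (s : seq (U * V)) : W :=
  \sum_(p <- s) f p.1 p.2.

Definition teq (s t : seq (U * V)) : bool :=
  `[< forall (W : lmodType k) (f : U -> V -> W), bilin f -> tsum f s = tsum f t >].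

Fact teq_equiv : equiv_class_of teq.
Proof.
split=> [s|s t|t s r].
- exact/asboolP.
- by apply/asboolP/asboolP=> e W f /e.
- by move=> /asboolP e1 /asboolP e2; apply/asboolP=> W f bf; rewrite e1 // e2.
Qed.
Canonical teq_rel := EquivRelPack teq_equiv.

Definition tensor : Type := {eq_quot teq}.
HB.instance Definition _ := Choice.copy tensor {eq_quot teq}.

Definition tcls (s : seq (U * V)) : tensor := \pi_{eq_quot teq} s.
Definition trep (t : tensor) : seq (U * V) := repr (t : {eq_quot teq}).

Lemma trepK t : tcls (trep t) = t. Proof. exact: reprK. Qed.

Lemma tclsP s t : tcls s = tcls t <->
  (forall (W : lmodType k) (f : U -> V -> W), bilin f -> tsum f s = tsum f t).
Proof.
split=> [/eqmodP/asboolP //|e].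
by apply/eqmodP/asboolP.
Qed.

Lemma trep_cls (W : lmodType k) (f : U -> V -> W) s :
  bilin f -> tsum f (trep (tcls s)) = tsum f s.
Proof. by move=> bf; apply: (iffLR (tclsP _ _)) => //; rewrite trepK. Qed.

Lemma tensorP s t :
  (forall (W : lmodType k) (f : U -> V -> W), bilin f ->
    tsum f (trep s) = tsum f (trep t)) -> s = t.
Proof. by move=> e; rewrite -(trepK s) -(trepK t); apply/tclsP. Qed.

Definition tzero : tensor := tcls [::].
Definition tadd (s t : tensor) : tensor := tcls (trep s ++ trep t).
Definition topp (t : tensor) : tensor := tcls [seq (- p.1, p.2) | p <- trep t].
Definition tscale (c : k) (t : tensor) : tensor :=
  tcls [seq (c *: p.1, p.2) | p <- trep t].

Section Eval.
Variables (W : lmodType k) (f : U -> V -> W).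
Hypothesis bf : bilin f.

Lemma bilinDl u u' v : f (u + u') v = f u v + f u' v.
Proof. by have /= := bf.1 v 1 u u'; rewrite !scale1r. Qed.
Lemma bilinDr u v v' : f u (v + v') = f u v + f u v'.
Proof. by have /= := bf.2 u 1 v v'; rewrite !scale1r. Qed.
Lemma bilin0l v : f 0 v = 0.
Proof. by apply: (@addrI _ (f 0 v)); rewrite -bilinDl !addr0. Qed.
Lemma bilin0r u : f u 0 = 0.
Proof. by apply: (@addrI _ (f u 0)); rewrite -bilinDr !addr0. Qed.
Lemma bilinZl c u v : f (c *: u) v = c *: f u v.
Proof. by have /= := bf.1 v c u 0; rewrite bilin0l !addr0. Qed.
Lemma bilinZr c u v : f u (c *: v) = c *: f u v.
Proof. by have /= := bf.2 u c v 0; rewrite bilin0r !addr0. Qed.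

Lemma tsum_zero : tsum f (trep tzero) = 0.
Proof. by rewrite trep_cls // /tsum big_nil. Qed.
Lemma tsum_add s t :
  tsum f (trep (tadd s t)) = tsum f (trep s) + tsum f (trep t).
Proof. by rewrite trep_cls // /tsum big_cat. Qed.
Lemma tsum_scale c t : tsum f (trep (tscale c t)) = c *: tsum f (trep t).
Proof.
rewrite trep_cls // /tsum big_map scaler_sumr.
by apply: eq_bigr => p _; rewrite bilinZl.
Qed.
Lemma tsum_opp t : tsum f (trep (topp t)) = - tsum f (trep t).
Proof.
rewrite trep_cls // /tsum big_map -scaleN1r scaler_sumr.
by apply: eq_bigr => p _; rewrite -bilinZl scaleN1r.
Qed.
End Eval.

Let tsumE := (tsum_zero, tsum_add, tsum_scale, tsum_opp).

Fact taddA : associative tadd.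
Proof. by move=> s t r; apply: tensorP => W f bf; rewrite !tsumE ?addrA. Qed.
Fact taddC : commutative tadd.
Proof. by move=> s t; apply: tensorP => W f bf; rewrite !tsumE // addrC. Qed.
Fact tadd0 : left_id tzero tadd.
Proof. by move=> t; apply: tensorP => W f bf; rewrite !tsumE // add0r. Qed.
Fact taddN : left_inverse tzero topp tadd.
Proof. by move=> t; apply: tensorP => W f bf; rewrite !tsumE // addNr. Qed.
HB.instance Definition _ :=
  GRing.isZmodule.Build tensor taddA taddC tadd0 taddN.

Fact tscalerA a b v : tscale a (tscale b v) = tscale (a * b) v.
Proof. by apply: tensorP => W f bf; rewrite !tsumE // scalerA. Qed.
Fact tscale1r : left_id 1 tscale.
Proof. by move=> v; apply: tensorP => W f bf; rewrite !tsumE // scale1r. Qed.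
Fact tscalerDr : right_distributive tscale +%R.
Proof.
by move=> a u v; apply: tensorP => W f bf; rewrite !tsumE // scalerDr.
Qed.
Fact tscalerDl v : {morph tscale^~ v : a b / a + b}.
Proof.
by move=> a b; apply: tensorP => W f bf; rewrite !tsumE // scalerDl.
Qed.
HB.instance Definition _ := GRing.Zmodule_isLmodule.Build k tensor
  tscalerA tscale1r tscalerDr tscalerDl.

Definition pure (u : U) (v : V) : tensor := tcls [:: (u, v)].

(* The linear map out of the tensor product defined by a bilinear map f.      *)
Definition tlift (W : lmodType k) (f : U -> V -> W) (t : tensor) : W :=
  tsum f (trep t).

Section Lift.
Variables (W : lmodType k) (f : U -> V -> W).
Hypothesis bf : bilin f.

Lemma tlift_pure u v : tlift f (pure u v) = f u v.
Proof. by rewrite /tlift trep_cls // /tsum big_seq1. Qed.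
Lemma tliftD s t : tlift f (s + t) = tlift f s + tlift f t.
Proof. exact: tsum_add. Qed.
Lemma tliftZ c t : tlift f (c *: t) = c *: tlift f t.
Proof. exact: tsum_scale. Qed.
Lemma tlift_is_linear : linear (tlift f).
Proof. by move=> c s t; rewrite tliftD tliftZ. Qed.
End Lift.

Lemma pure_bilin : bilin pure.
Proof.
split=> [v a u u'|u a v v']; apply: tensorP => W f bf.
- by rewrite [RHS]tsum_add // [in RHS]tsum_scale // !trep_cls // /tsum !big_seq1; exact: bf.1.
- by rewrite [RHS]tsum_add // [in RHS]tsum_scale // !trep_cls // /tsum !big_seq1; exact: bf.2.
Qed.

Lemma tensor_sum (t : tensor) : t = \sum_(p <- trep t) pure p.1 p.2.
Proof.
apply: tensorP => W f bf.
have -> : tsum f (trep (\sum_(p <- trep t) pure p.1 p.2)) =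
    \sum_(p <- trep t) tsum f (trep (pure p.1 p.2)).
  elim: (trep t) => [|p s IH]; first by rewrite !big_nil; exact: tsum_zero.
  by rewrite !big_cons [LHS]tsum_add // IH.
by apply: eq_bigr => p _; rewrite trep_cls // /tsum big_seq1.
Qed.

Lemma tensor_ind (P : tensor -> Prop) :
  (forall u v, P (pure u v)) -> (forall s t, P s -> P t -> P (s + t)) ->
  forall t, P t.
Proof.
move=> Pp PD t; rewrite (tensor_sum t).
elim: (trep t) => [|p s IH]; last by rewrite big_cons; apply: PD.
by rewrite big_nil -(bilin0l pure_bilin 0).
Qed.

End Tensor.

Notation "u \ot v" := (pure u v) (at level 40, left associativity).
Notation uvs A := (restr (kunit A) (GRing.regular (kring A))).

Section LinearLemmas.
Variable k : fieldType.

Lemma linear_pair (U W : lmodType k) (f : U -> W) :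
  (forall x y, f (x + y) = f x + f y) -> (forall c x, f (c *: x) = c *: f x) ->
  linear f.
Proof. by move=> fD fZ c x y; rewrite fD fZ. Qed.

Lemma linfD (U W : lmodType k) (f : U -> W) : linear f ->
  forall x y, f (x + y) = f x + f y.
Proof. by move=> lf x y; have := lf 1 x y; rewrite !scale1r. Qed.

Lemma linf0 (U W : lmodType k) (f : U -> W) : linear f -> f 0 = 0.
Proof.
by move=> lf; apply: (@addrI _ (f 0)); rewrite -(linfD lf) !addr0.
Qed.

Lemma linfZ (U W : lmodType k) (f : U -> W) : linear f ->
  forall c x, f (c *: x) = c *: f x.
Proof. by move=> lf c x; have := lf c x 0; rewrite (linf0 lf) !addr0. Qed.

Lemma linf_sum (U W : lmodType k) (f : U -> W) : linear f ->
  forall I (s : seq I) F, f (\sum_(i <- s) F i) = \sum_(i <- s) f (F i).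
Proof.
move=> lf I s F; elim: s => [|i s IH]; first by rewrite !big_nil linf0.
by rewrite !big_cons linfD // IH.
Qed.

Lemma linear_compose (U V W : lmodType k) (g : V -> W) (f : U -> V) :
  linear g -> linear f -> linear (fun x => g (f x)).
Proof. by move=> lg lf c x y; rewrite lf lg. Qed.

Variables U V : lmodType k.

Lemma tlift_eq (W : lmodType k) (f g : U -> V -> W) :
  (forall u v, f u v = g u v) -> forall t, tlift f t = tlift g t.
Proof. by move=> e t; apply: eq_bigr => p _; rewrite e. Qed.

Lemma linear_tlift (W W' : lmodType k) (L : W -> W') (f : U -> V -> W) t :
  linear L -> L (tlift f t) = tlift (fun u v => L (f u v)) t.
Proof. by move=> lL; rewrite /tlift /tsum linf_sum. Qed.

Lemma tlift_linear (X W : lmodType k) (g : X -> U -> V -> W) t :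
  (forall u v, linear (fun x => g x u v)) -> linear (fun x => tlift (g x) t).
Proof.
move=> lg c x y; rewrite /tlift /tsum scaler_sumr -big_split /=.
by apply: eq_bigr => p _; rewrite lg.
Qed.

Lemma tlift_exchange (U' V' W : lmodType k) (f : U -> V -> U' -> V' -> W) t s :
  tlift (fun u v => tlift (f u v) s) t =
  tlift (fun u' v' => tlift (fun u v => f u v u' v') t) s.
Proof. by rewrite /tlift /tsum exchange_big. Qed.

Lemma pure_linl (v : V) : linear (fun u : U => u \ot v).
Proof. exact: (@pure_bilin k U V).1. Qed.
Lemma pure_linr (u : U) : linear (fun v : V => u \ot v).
Proof. exact: (@pure_bilin k U V).2. Qed.

End LinearLemmas.

Section AlgebraLinear.
Variables (k : fieldType) (A : kalg k).

Lemma act_bilin (M : lmodType A) :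
  @bilin k (uvs A) (ksp M) (ksp M) (fun a m => (a : A) *: (m : M)).
Proof.
split=> [m c x y|a c x y].
  by rewrite scalerDl -scalerA.
by rewrite scalerDr !scalerA -kcentral -scalerA.
Qed.

Lemma mul_bilin :
  @bilin k (uvs A) (uvs A) (uvs A) (fun a b => (a : A) * (b : A)).
Proof. exact: (act_bilin A^o). Qed.

Lemma act_linl (M : lmodType A) m :
  @linear_for k (uvs A) (ksp M) *:%R (fun a => (a : A) *: (m : M)).
Proof. exact: (act_bilin M).1. Qed.
Lemma act_linr (M : lmodType A) a :
  @linear_for k (ksp M) (ksp M) *:%R (fun m => (a : A) *: (m : M)).
Proof. exact: (act_bilin M).2. Qed.
Lemma mul_linl b :
  @linear_for k (uvs A) (uvs A) *:%R (fun a => (a : A) * b).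
Proof. exact: mul_bilin.1. Qed.
Lemma mul_linr a :
  @linear_for k (uvs A) (uvs A) *:%R (fun b => a * (b : A)).
Proof. exact: mul_bilin.2. Qed.
End AlgebraLinear.

Definition uone (k : fieldType) (A : kalg k) : uvs A := (1 : A).

(* The product (a (x) b) (a' (x) b') = a a' (x) b b' of A (x) B.               *)
Definition tmul (k : fieldType) (A B : kalg k) (s t : tensor (uvs A) (uvs B)) :
    tensor (uvs A) (uvs B) :=
  tlift (fun (a : uvs A) (b : uvs B) => tlift (fun (a' : uvs A) (b' : uvs B) =>
    ((a : A) * a' : uvs A) \ot ((b : B) * b' : uvs B)) t) s.

Section TensorAlgebra.
Variables (k : fieldType) (A B : kalg k).

Fact tmul_pure (h h' : uvs A) (a a' : uvs B) :
  tmul (h \ot a) (h' \ot a') =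
  ((h : A) * h' : uvs A) \ot ((a : B) * a' : uvs B).
Proof.
rewrite /tmul !tlift_pure //.
  split=> [b|b] /=.
    exact: linear_compose (pure_linl _) (mul_linr _).
  exact: linear_compose (pure_linr _) (mul_linr _).
split=> [b|b] /=; apply: tlift_linear => c d.
  exact: linear_compose (pure_linl _) (mul_linl _).
exact: linear_compose (pure_linr _) (mul_linl _).
Qed.

Fact tmul_linl (t : tensor (uvs A) (uvs B)) : linear ((@tmul k A B)^~ t).
Proof.
apply: tlift_is_linear.
split=> [b|b] /=; apply: tlift_linear => c d.
  exact: linear_compose (pure_linl _) (mul_linl _).
exact: linear_compose (pure_linr _) (mul_linl _).
Qed.

Fact tmulDl (t : tensor (uvs A) (uvs B)) : {morph (@tmul k A B)^~ t : x y / x + y}.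
Proof.
move=> x y; rewrite /tmul tliftD //.
split=> [b|b] /=; apply: tlift_linear => c d.
  exact: linear_compose (pure_linl _) (mul_linl _).
exact: linear_compose (pure_linr _) (mul_linl _).
Qed.

Fact tmul_linr (s : tensor (uvs A) (uvs B)) : linear (@tmul k A B s).
Proof.
elim/tensor_ind: s => [a b|s s' IH IH'] c x y; last first.
  by rewrite !tmulDl IH IH' scalerDr addrACA.
have E z : tmul (a \ot b) z =
    tlift (fun (a' : uvs A) (b' : uvs B) =>
      ((a : A) * a' : uvs A) \ot ((b : B) * b' : uvs B)) z.
  rewrite /tmul tlift_pure //.
  split=> [d|d] /=; apply: tlift_linear => p q.
    exact: linear_compose (pure_linl _) (mul_linl _).
  exact: linear_compose (pure_linr _) (mul_linl _).
rewrite !E tlift_is_linear //; split=> [d|d] /=.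
  exact: linear_compose (pure_linl _) (mul_linr _).
exact: linear_compose (pure_linr _) (mul_linr _).
Qed.

Fact tmulDr (t : tensor (uvs A) (uvs B)) : {morph (@tmul k A B) t : x y / x + y}.
Proof. exact: linfD (tmul_linr t). Qed.
End TensorAlgebra.

Definition findim (k : fieldType) (V : lmodType k) : Prop :=
  exists (I : finType) (e : I -> V),
    forall v, exists c : I -> k, v = \sum_i c i *: e i.

(* Sums over Sweedler components, sum h_(1) (x) h_(2) = Delta h, are written   *)
(* tlift (fun h1 h2 => ..) (Delta h).                                         *)
Record fdHopf (k : fieldType) := FdHopf {
  hp_alg :> kalg k;
  hp_findim : findim (uvs hp_alg);
  Delta : {linear uvs hp_alg -> tensor (uvs hp_alg) (uvs hp_alg)};
  eps : {rmorphism hp_alg -> k};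
  antipode : {linear uvs hp_alg -> uvs hp_alg};
  Delta1 : Delta (1 : hp_alg) = uone hp_alg \ot uone hp_alg;
  DeltaM : forall h l : hp_alg, Delta (h * l) = tmul (Delta h) (Delta l);
  eps_kunit : forall c, eps (kunit hp_alg c) = c;
  coassoc : forall h : uvs hp_alg,
    tlift (fun h1 h2 : uvs hp_alg =>
      tlift (fun h11 h12 : uvs hp_alg => h11 \ot (h12 \ot h2)) (Delta h1))
      (Delta h) =
    tlift (fun h1 h2 : uvs hp_alg => h1 \ot Delta h2) (Delta h);
  counitl : forall h : uvs hp_alg,
    tlift (fun h1 h2 : uvs hp_alg => eps h1 *: h2) (Delta h) = h;
  counitr : forall h : uvs hp_alg,
    tlift (fun h1 h2 : uvs hp_alg => eps h2 *: h1) (Delta h) = h;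
  antipodel : forall h : uvs hp_alg,
    tlift (fun h1 h2 : uvs hp_alg =>
      (antipode h1 : hp_alg) * (h2 : hp_alg) : uvs hp_alg) (Delta h) = kunit hp_alg (eps h);
  antipoder : forall h : uvs hp_alg,
    tlift (fun h1 h2 : uvs hp_alg =>
      (h1 : hp_alg) * (antipode h2 : hp_alg) : uvs hp_alg) (Delta h) = kunit hp_alg (eps h) }.

Record lintegral (k : fieldType) (H : fdHopf k) := LIntegral {
  intg : H;
  intg_neq0 : intg <> 0;
  intgP : forall h : H, h * intg = kunit H (eps H h) * intg }.

Record comodAlg (k : fieldType) (H : fdHopf k) := ComodAlg {
  cm_alg :> kalg k;
  coact : {linear uvs cm_alg -> tensor (uvs H) (uvs cm_alg)};
  coact1 : coact (1 : cm_alg) = uone H \ot uone cm_alg;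
  coactM : forall a b : cm_alg, coact (a * b) = tmul (coact a) (coact b);
  cm_coassoc : forall a : uvs cm_alg,
    tlift (fun (h : uvs H) (b : uvs cm_alg) =>
      tlift (fun h1 h2 : uvs H => h1 \ot (h2 \ot b)) (Delta H h)) (coact a) =
    tlift (fun (h : uvs H) (b : uvs cm_alg) => h \ot coact b) (coact a);
  cm_counit : forall a : uvs cm_alg,
    tlift (fun (h : uvs H) (b : uvs cm_alg) => eps H h *: b) (coact a) = a }.

Definition hopf_comod (k : fieldType) (H : fdHopf k) : comodAlg H :=
  ComodAlg (@Delta1 k H) (@DeltaM k H) (@coassoc k H) (@counitl k H).
Canonical hopf_comod.

(* For an H-module V and an A-module M, V (x) M is an A-module through the    *)
(* coaction: a (v (x) m) = sum a_(-1) v (x) a_(0) m.                          *)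
Section TensorModule.
Variables (k : fieldType) (H : fdHopf k) (A : comodAlg H).
Variables (V : lmodType H) (M : lmodType A).

Definition hten : Type := tensor (ksp V) (ksp M).
HB.instance Definition _ := GRing.Zmodule.copy hten (tensor (ksp V) (ksp M)).

Definition pact (h : uvs H) (a : uvs A) (v : ksp V) (m : ksp M) : hten :=
  ((h : H) *: (v : V) : ksp V) \ot ((a : A) *: (m : M) : ksp M).

Definition hscale2 (t : tensor (uvs H) (uvs A)) (x : hten) : hten :=
  tlift (fun v m => tlift (fun h a => pact h a v m) t) x.

Definition hscale (a : A) (x : hten) : hten := hscale2 (coact A a) x.

Fact pact_bilin v m : @bilin k _ _ (tensor _ _) (fun h a => pact h a v m).
Proof.
split=> [a|h] /=.
  exact: linear_compose (pure_linl _) (act_linl _).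
exact: linear_compose (pure_linr _) (act_linl _).
Qed.

Fact pact_bilin2 t :
  @bilin k _ _ (tensor _ _) (fun v m => tlift (fun h a => pact h a v m) t).
Proof.
split=> [m|v] /=; apply: tlift_linear => h a.
  exact: linear_compose (pure_linl _) (act_linr _).
exact: linear_compose (pure_linr _) (act_linr _).
Qed.

Fact hscale2_pure h a v m : hscale2 (h \ot a) (v \ot m) = pact h a v m.
Proof. by rewrite /hscale2 tlift_pure ?tlift_pure //; [exact: pact_bilin|exact: pact_bilin2]. Qed.

Fact hscale2Dr t : {morph hscale2 t : x y / x + y}.
Proof. by move=> x y; rewrite /hscale2 tliftD //; exact: pact_bilin2. Qed.

Fact hscale2Dl x : {morph hscale2^~ x : s t / s + t}.
Proof.
move=> s t; elim/tensor_ind: x => [v m|x y IHx IHy].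
  by rewrite /hscale2 !tlift_pure ?tliftD //;
    (exact: pact_bilin2 || exact: pact_bilin).
by rewrite !hscale2Dr IHx IHy addrACA.
Qed.

Fact hscale2M s t x : hscale2 (tmul s t) x = hscale2 s (hscale2 t x).
Proof.
elim/tensor_ind: x => [v m|x y IHx IHy]; last by rewrite !hscale2Dr IHx IHy.
elim/tensor_ind: s => [h a|s s' IHs IHs']; last first.
  by rewrite tmulDl !hscale2Dl IHs IHs'.
elim/tensor_ind: t => [h' a'|t t' IHt IHt']; last first.
  by rewrite tmulDr !hscale2Dl hscale2Dr IHt IHt'.
by rewrite tmul_pure !hscale2_pure /pact !scalerA.
Qed.

Fact hscalerA a b x : hscale a (hscale b x) = hscale (a * b) x.
Proof. by rewrite /hscale -hscale2M coactM. Qed.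
Fact hscale1r : left_id 1 hscale.
Proof.
move=> x; rewrite /hscale coact1.
elim/tensor_ind: x => [v m|x y IHx IHy]; last by rewrite hscale2Dr IHx IHy.
by rewrite hscale2_pure /pact /uone !scale1r.
Qed.
Fact hscalerDr : right_distributive hscale +%R.
Proof. by move=> a x y; exact: hscale2Dr. Qed.
Fact hscalerDl x : {morph hscale^~ x : a b / a + b}.
Proof.
by move=> a b; rewrite /hscale -hscale2Dl -(raddfD (coact A)).
Qed.
HB.instance Definition _ := GRing.Zmodule_isLmodule.Build A hten
  hscalerA hscale1r hscalerDr hscalerDl.

Definition hpure (v : V) (m : M) : hten := (v : ksp V) \ot (m : ksp M).

End TensorModule.

Section LinearClosure.
Variables (k : fieldType) (X : lmodType k).

Lemma lin_id : @linear_for k X X *:%R (fun x => x).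
Proof. by move=> c x y. Qed.

Lemma lin_scale (W : lmodType k) (c : k) (f : X -> W) :
  linear f -> linear (fun x => c *: f x).
Proof. by move=> lf a x y; rewrite lf scalerDr !scalerA mulrC. Qed.

Lemma lin_scalel (K W : lmodType k) (e : K -> k) (f : X -> K) (w : W) :
  (forall c x y, e (c *: x + y) = c * e x + e y) ->
  linear f -> linear (fun x => e (f x) *: w).
Proof. by move=> le lf a x y; rewrite lf le scalerDl scalerA. Qed.

Lemma lin_purel (U V : lmodType k) (f : X -> U) (v : V) :
  linear f -> linear (fun x => f x \ot v).
Proof. exact: linear_compose (pure_linl v). Qed.
Lemma lin_purer (U V : lmodType k) (u : U) (f : X -> V) :
  linear f -> linear (fun x => u \ot f x).
Proof. exact: linear_compose (pure_linr u). Qed.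

Lemma lin_map (U W : lmodType k) (g : {linear U -> W}) (f : X -> U) :
  linear f -> linear (fun x => g (f x)).
Proof. by apply: linear_compose => c x y; rewrite linearP. Qed.

Lemma lin_mull (A : kalg k) (f : X -> uvs A) (b : A) :
  linear f -> @linear_for k X (uvs A) *:%R (fun x => (f x : A) * b).
Proof. exact: linear_compose (mul_linl b). Qed.
Lemma lin_mulr (A : kalg k) (a : A) (f : X -> uvs A) :
  linear f -> @linear_for k X (uvs A) *:%R (fun x => a * (f x : A)).
Proof. exact: linear_compose (mul_linr a). Qed.

Lemma lin_actl (A : kalg k) (M : lmodType A) (f : X -> uvs A) (m : M) :
  linear f -> @linear_for k X (ksp M) *:%R (fun x => (f x : A) *: m).
Proof. exact: linear_compose (act_linl m). Qed.
Lemma lin_actr (A : kalg k) (M : lmodType A) (a : A) (f : X -> ksp M) :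
  linear f -> @linear_for k X (ksp M) *:%R (fun x => a *: (f x : M)).
Proof. exact: linear_compose (@act_linr _ _ M a). Qed.

Lemma lin_tlift (U V W : lmodType k) (g : U -> V -> W) (f : X -> tensor U V) :
  bilin g -> linear f -> linear (fun x => tlift g (f x)).
Proof. by move=> bg; apply: linear_compose; apply: tlift_is_linear. Qed.
End LinearClosure.

Ltac lin := repeat first
  [ exact: lin_id | assumption
  | apply: lin_purel | apply: lin_purer | apply: lin_mull | apply: lin_mulr
  | apply: lin_actl | apply: lin_actr | apply: lin_map | apply: lin_scale
  | (apply: tlift_linear => ? ?) | (apply: lin_tlift; [split=> ? /=|])
  | (split=> ? /=) ].

Section TensorMaps.
Variables (k : fieldType) (H : fdHopf k) (A : comodAlg H) (V : lmodType H).

Definition hmap (M N : lmodType A) (f : {linear M -> N}) (x : hten V M) :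
    hten V N :=
  tlift (fun (v : ksp V) (m : ksp M) => hpure v (f m) : tensor (ksp V) (ksp N)) x.

Section Map.
Variables (M N : lmodType A) (f : {linear M -> N}).

Fact hmap_bilin :
  @bilin k (ksp V) (ksp M) (tensor (ksp V) (ksp N)) (fun v m => hpure v (f m)).
Proof.
split=> [m|v]; first by rewrite /hpure; lin.
by apply: lin_purer; exact: (@restr_map_is_linear _ _ (kunit A) M N f).
Qed.

Fact hmap_pure v m : hmap f (hpure v m) = hpure v (f m).
Proof. by rewrite /hmap tlift_pure //; exact: hmap_bilin. Qed.

Fact hmapD : {morph hmap f : x y / x + y}.
Proof. by move=> x y; rewrite /hmap tliftD //; exact: hmap_bilin. Qed.

Fact hmap_hscale2 t x : hmap f (hscale2 t x) = hscale2 t (hmap f x).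
Proof.
elim/tensor_ind: x => [v m|x y IHx IHy]; last first.
  by rewrite hscale2Dr !hmapD hscale2Dr IHx IHy.
elim/tensor_ind: t => [h a|t t' IHt IHt']; last first.
  by rewrite !hscale2Dl hmapD IHt IHt'.
rewrite hscale2_pure /pact -!/(hpure _ _) !hmap_pure.
by rewrite /hpure hscale2_pure /pact linearZ.
Qed.

Fact hmap_is_linear : linear (hmap f).
Proof. by move=> a x y; rewrite hmapD [in LHS]hmap_hscale2. Qed.
HB.instance Definition _ :=
  GRing.isLinear.Build A (hten V M) (hten V N) *:%R (hmap f) hmap_is_linear.
End Map.
End TensorMaps.
Arguments hmap {k H A} V {M N} f x.

(* The H-module H / k Lambda.                                                 *)
Section IntegralQuotient.
Variables (k : fieldType) (H : fdHopf k) (L : lintegral H).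

Definition modL (h l : H^o) : bool :=
  `[< exists c : k, h - l = kunit H c * intg L >].

Fact modL_equiv : equiv_class_of modL.
Proof.
split=> [h|h l|h l m].
- by apply/asboolP; exists 0; rewrite subrr rmorph0 mul0r.
- by apply/asboolP/asboolP=> -[c e]; exists (- c);
    rewrite rmorphN mulNr -e opprB.
- move=> /asboolP[c e] /asboolP[d e']; apply/asboolP; exists (d + c).
  by rewrite rmorphD mulrDl -e -e' addrC [RHS]addrC addrA subrK addrC.
Qed.
Canonical modL_rel := EquivRelPack modL_equiv.

Definition HmodL : Type := {eq_quot modL}.
HB.instance Definition _ := Choice.copy HmodL {eq_quot modL}.

Definition Lclass (h : H^o) : HmodL := \pi_{eq_quot modL} h.
Definition Lrepr (x : HmodL) : H^o := repr (x : {eq_quot modL}).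

Lemma LreprK x : Lclass (Lrepr x) = x. Proof. exact: reprK. Qed.
Lemma LclassP h l :
  Lclass h = Lclass l <-> exists c : k, h - l = kunit H c * intg L.
Proof. by split=> [/eqmodP/asboolP //|e]; apply/eqmodP/asboolP. Qed.

Definition Lzero : HmodL := Lclass 0.
Definition Ladd (x y : HmodL) : HmodL := Lclass (Lrepr x + Lrepr y).
Definition Lopp (x : HmodL) : HmodL := Lclass (- Lrepr x).
Definition Lscale (h : H) (x : HmodL) : HmodL := Lclass (h *: Lrepr x).

Fact LaddE h l : Ladd (Lclass h) (Lclass l) = Lclass (h + l).
Proof.
have [c e] := iffLR (LclassP _ _) (LreprK (Lclass h)).
have [d e'] := iffLR (LclassP _ _) (LreprK (Lclass l)).
apply/LclassP; exists (c + d).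
by rewrite rmorphD mulrDl -e -e' opprD addrACA.
Qed.
Fact LoppE h : Lopp (Lclass h) = Lclass (- h).
Proof.
have [c e] := iffLR (LclassP _ _) (LreprK (Lclass h)).
by apply/LclassP; exists (- c); rewrite rmorphN mulNr -e opprB opprK addrC.
Qed.
Fact LscaleE h l : Lscale h (Lclass l) = Lclass (h *: l).
Proof.
have [c e] := iffLR (LclassP _ _) (LreprK (Lclass l)).
apply/LclassP; exists (c * eps H h).
have E : h * (kunit H c * intg L) = kunit H (c * eps H h) * intg L.
  by rewrite mulrA -kcentral -mulrA intgP mulrA -rmorphM.
by rewrite -scalerBr e; exact: E.
Qed.

Fact LclassE (P : HmodL -> Prop) : (forall h, P (Lclass h)) -> forall x, P x.
Proof. by move=> Ph x; rewrite -(LreprK x). Qed.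

Fact LaddA : associative Ladd.
Proof.
move=> x y z; elim/LclassE: x => x; elim/LclassE: y => y; elim/LclassE: z => z.
by rewrite !LaddE addrA.
Qed.
Fact LaddC : commutative Ladd.
Proof.
by move=> x y; elim/LclassE: x => x; elim/LclassE: y => y; rewrite !LaddE addrC.
Qed.
Fact Ladd0 : left_id Lzero Ladd.
Proof. by move=> x; elim/LclassE: x => x; rewrite LaddE add0r. Qed.
Fact LaddN : left_inverse Lzero Lopp Ladd.
Proof. by move=> x; elim/LclassE: x => x; rewrite LoppE LaddE addNr. Qed.
HB.instance Definition _ := GRing.isZmodule.Build HmodL LaddA LaddC Ladd0 LaddN.

Lemma LclassD : {morph Lclass : h l / h + l}.
Proof. by move=> h l; rewrite -LaddE. Qed.

Fact LscalerA a b x : Lscale a (Lscale b x) = Lscale (a * b) x.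
Proof. by elim/LclassE: x => x; rewrite !LscaleE scalerA. Qed.
Fact Lscale1r : left_id 1 Lscale.
Proof. by move=> x; elim/LclassE: x => x; rewrite LscaleE scale1r. Qed.
Fact LscalerDr : right_distributive Lscale +%R.
Proof.
move=> a x y; elim/LclassE: x => x; elim/LclassE: y => y.
by rewrite -LclassD !LscaleE scalerDr LclassD.
Qed.
Fact LscalerDl x : {morph Lscale^~ x : a b / a + b}.
Proof.
move=> a b; elim/LclassE: x => x.
by rewrite !LscaleE scalerDl LclassD.
Qed.
HB.instance Definition _ := GRing.Zmodule_isLmodule.Build H HmodL
  LscalerA Lscale1r LscalerDr LscalerDl.
End IntegralQuotient.

(* Right H-module algebras: ract b h is b . h.                                *)
Record modAlg (k : fieldType) (H : fdHopf k) := ModAlg {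
  ma_alg :> kalg k;
  ract : ma_alg -> H -> ma_alg;
  ract_bilin : @bilin k (uvs ma_alg) (uvs H) (uvs ma_alg) ract;
  ract1 : forall b, ract b 1 = b;
  ractM : forall b h l, ract b (h * l) = ract (ract b h) l;
  ract_one : forall h, ract 1 h = kunit ma_alg (eps H h);
  ract_mul : forall b c h, ract (b * c) h =
    tlift (fun h1 h2 : uvs H => ract b h1 * ract c h2 : uvs ma_alg)
      (Delta H h) }.

Section Smash.
Variables (k : fieldType) (H : fdHopf k) (B : modAlg H).

Definition smash : Type := tensor (uvs H) (uvs B).
HB.instance Definition _ := GRing.Zmodule.copy smash (tensor (uvs H) (uvs B)).

Definition spure (h : H) (b : B) : smash := (h : uvs H) \ot (b : uvs B).

(* (h # b) (l # c) = sum h l_(1) # (b . l_(2)) c                              *)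
Definition smul2 (h : H) (b : B) (l : H) (c : B) : smash :=
  tlift (fun l1 l2 : uvs H => spure (h * l1) (ract b l2 * c) : tensor _ _)
    (Delta H l).

Definition smul (x y : smash) : smash :=
  tlift (fun (h : uvs H) (b : uvs B) =>
    tlift (fun (l : uvs H) (c : uvs B) => smul2 h b l c : tensor _ _) y) x.

Fact lin_ractl (X : lmodType k) (f : X -> uvs B) (h : H) :
  linear f -> @linear_for k X (uvs B) *:%R (fun x => ract (f x : B) h).
Proof. exact: (@linear_compose _ _ (uvs B) (uvs B) _ _ ((@ract_bilin _ _ B).1 h)). Qed.
Fact lin_ractr (X : lmodType k) (b : B) (f : X -> uvs H) :
  linear f -> @linear_for k X (uvs B) *:%R (fun x => ract b (f x : H)).
Proof. exact: (@linear_compose _ _ (uvs H) (uvs B) _ _ ((@ract_bilin _ _ B).2 b)). Qed.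

Ltac lins := rewrite /smul2 /spure; repeat first
  [ progress lin | apply: lin_ractl | apply: lin_ractr ].

Fact smul_bilin1 y : @bilin k (uvs H) (uvs B) (tensor (uvs H) (uvs B)) 
  (fun h b => tlift (fun (l : uvs H) (c : uvs B) => smul2 h b l c : tensor _ _) y).
Proof. by lins. Qed.
Fact smul_bilin2 h b : @bilin k (uvs H) (uvs B) (tensor (uvs H) (uvs B)) 
  (fun l c => smul2 h b l c).
Proof. by lins. Qed.

Fact smul_pure h b l c : smul (spure h b) (spure l c) = smul2 h b l c.
Proof.
by rewrite /smul tlift_pure ?tlift_pure //;
  [exact: smul_bilin2|exact: smul_bilin1].
Qed.
Fact smulDl : left_distributive smul +%R.
Proof. by move=> x y z; rewrite /smul tliftD //; exact: smul_bilin1. Qed.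
Fact smul_purel h b y : smul (spure h b) y =
  tlift (fun (l : uvs H) (c : uvs B) => smul2 h b l c : tensor _ _) y.
Proof. by rewrite /smul tlift_pure //; exact: smul_bilin1. Qed.
Fact smulDr : right_distributive smul +%R.
Proof.
move=> x y z; elim/tensor_ind: x => [h b|x x' IH IH']; last first.
  by rewrite !smulDl IH IH' addrACA.
by rewrite !smul_purel tliftD //; exact: smul_bilin2.
Qed.

Fact smul_linr h b :
  @linear_for k (tensor (uvs H) (uvs B)) (tensor (uvs H) (uvs B)) *:%R
    (smul (spure h b)).
Proof.
have -> : smul (spure h b) = tlift (fun (l : uvs H) (c : uvs B) =>
   smul2 h b l c : tensor _ _) by apply: funext => y; exact: smul_purel.
exact: tlift_is_linear (smul_bilin2 h b).
Qed.
Fact smul_linl y :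
  @linear_for k (tensor (uvs H) (uvs B)) (tensor (uvs H) (uvs B)) *:%R
    (smul^~ y).
Proof. exact: tlift_is_linear (smul_bilin1 y). Qed.

Lemma coassocE (W : lmodType k) (G : uvs H -> uvs H -> uvs H -> W) (h : uvs H) :
  (forall x, bilin (G x)) -> (forall y z, linear (fun x => G x y z)) ->
  tlift (fun h1 h2 => tlift (fun x y => G x y h2) (Delta H h1)) (Delta H h) =
  tlift (fun h1 h2 => tlift (fun y z => G h1 y z) (Delta H h2)) (Delta H h).
Proof.
move=> bG lG.
have bG' : bilin (fun x t => tlift (G x) t).
  split=> [t|x]; first exact: tlift_linear.
  exact: tlift_is_linear.
have lL := tlift_is_linear bG'.
have := congr1 (tlift (fun x t => tlift (G x) t)) (coassoc h).
rewrite !(linear_tlift _ _ lL) => E.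
transitivity (tlift (fun h1 h2 : uvs H => tlift (fun x t => tlift (G x) t)
  (tlift (fun h11 h12 : uvs H => h11 \ot (h12 \ot h2)) (Delta H h1)))
  (Delta H h)).
  apply: tlift_eq => u v; rewrite (linear_tlift _ _ lL).
  by apply: tlift_eq => x y; rewrite !tlift_pure.
by rewrite E; apply: tlift_eq => u v; rewrite tlift_pure.
Qed.

Lemma tlift_tmul (A A' : kalg k) (W : lmodType k) (F : uvs A -> uvs A' -> W) s t :
  bilin F -> tlift F (tmul s t) =
  tlift (fun (a : uvs A) (b : uvs A') => tlift (fun (a' : uvs A) (b' : uvs A') =>
    F ((a : A) * a') ((b : A') * b')) t) s.
Proof.
move=> bF; rewrite /tmul (linear_tlift _ _ (tlift_is_linear bF)).
apply: tlift_eq => a b; rewrite (linear_tlift _ _ (tlift_is_linear bF)).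
by apply: tlift_eq => a' b'; rewrite tlift_pure.
Qed.

Fact smulA : associative smul.
Proof.
move=> x y z.
elim/tensor_ind: x => [h b|x x' IH IH']; last by rewrite !smulDl IH IH'.
elim/tensor_ind: y => [l c|y y' IH IH'];
  last by rewrite smulDl !smulDr smulDl IH IH'.
elim/tensor_ind: z => [m d|z z' IH IH']; last by rewrite !smulDr IH IH'.
rewrite -!/(spure _ _) !smul_pure /smul2.
rewrite (linear_tlift _ _ (smul_linr h b)) (linear_tlift _ _ (smul_linl _)).
have -> : tlift (fun u v : uvs H => smul (spure h b)
     (spure (l * u) (ract c v * d)) : tensor _ _) (Delta H m) =
   tlift (fun m1 m2 : uvs H => tlift (fun l1 l2 : uvs H =>
     tlift (fun m11 m12 : uvs H =>
       spure (h * ((l1 : H) * m11)) (ract b ((l2 : H) * m12) * (ract c m2 * d))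
         : tensor _ _) (Delta H m1)) (Delta H l)) (Delta H m).
  apply: tlift_eq => u v; rewrite smul_pure /smul2 DeltaM tlift_tmul //.
  by lins.
under [RHS]tlift_eq => l1 l2 do rewrite smul_pure /smul2.
etransitivity; first exact: tlift_exchange.
apply: tlift_eq => l1 l2.
rewrite (@coassocE _ (fun x y z : uvs H =>
  spure (h * ((l1 : H) * x)) (ract b ((l2 : H) * y) * (ract c z * d))
    : tensor (uvs H) (uvs B))); [|by move=> x; lins|by move=> y z; lins].
apply: tlift_eq => m1 m2; rewrite ract_mul.
rewrite (linear_tlift (L := fun e : uvs B =>
  spure (h * l1 * m1) ((e : B) * d) : tensor (uvs H) (uvs B))); last by lins.
by apply: tlift_eq => m21 m22; rewrite -ractM !mulrA.
Qed.

Definition sone : smash := spure 1 1.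

Fact smul1 : left_id sone smul.
Proof.
move=> x; elim/tensor_ind: x => [l c|x x' IH IH']; last by rewrite smulDr IH IH'.
rewrite -!/(spure _ _) smul_pure /smul2.
transitivity (tlift (fun l1 l2 : uvs H => (eps H l2 *: l1) \ot c) (Delta H l)).
  apply: tlift_eq => l1 l2; rewrite mul1r ract_one.
  rewrite (bilinZl (@pure_bilin _ (uvs H) (uvs B))).
  exact: (bilinZr (@pure_bilin _ (uvs H) (uvs B)) (eps H l2) l1 c).
by rewrite /spure -[in RHS](counitr l) (linear_tlift _ _ (pure_linl c)).
Qed.
Fact smulr1 : right_id sone smul.
Proof.
move=> x; elim/tensor_ind: x => [h b|x x' IH IH']; last by rewrite smulDl IH IH'.
rewrite -!/(spure _ _) smul_pure /smul2 Delta1 tlift_pure ?ract1 ?mulr1 //.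
by lins.
Qed.
HB.instance Definition _ := GRing.Zmodule_isPzRing.Build smash
  smulA smul1 smulr1 smulDl smulDr.

Fact smulZl c (x y : tensor (uvs H) (uvs B)) :
  smul (c *: x) y = c *: (smul x y : tensor _ _).
Proof. exact: (linfZ (smul_linl y)). Qed.
Fact smulZr c (x y : tensor (uvs H) (uvs B)) :
  smul x (c *: y) = c *: (smul x y : tensor _ _).
Proof.
elim/tensor_ind: x => [h b|x x' IH IH']; first exact: (linfZ (smul_linr h b)).
by rewrite !smulDl IH IH'; exact: (esym (scalerDr _ _ _)).
Qed.

Definition skunit (c : k) : smash := c *: (sone : tensor (uvs H) (uvs B)).

Fact skunitE c (x : smash) :
  (skunit c : smash) * x = c *: (x : tensor (uvs H) (uvs B)).
Proof. by rewrite [LHS]smulZl smul1. Qed.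
Fact skunit_zmod : zmod_morphism skunit.
Proof. by move=> a b; rewrite /skunit scalerBl. Qed.
Fact skunit_monoid : monoid_morphism skunit.
Proof.
split=> [|a b]; first exact: scale1r.
by rewrite skunitE /skunit scalerA.
Qed.
HB.instance Definition _ := GRing.isZmodMorphism.Build k smash skunit skunit_zmod.
HB.instance Definition _ := GRing.isMonoidMorphism.Build k smash skunit skunit_monoid.

Fact skunit_central c (x : smash) : skunit c * x = x * skunit c.
Proof. by rewrite skunitE [RHS]smulZr smulr1. Qed.

Definition smash_alg : kalg k := KAlg skunit_central.

Lemma smash_scaleE c (x : smash) :
  c *: (x : uvs smash_alg) = c *: (x : tensor (uvs H) (uvs B)).
Proof. exact: skunitE. Qed.

Definition smash_incl (h : H) : smash := spure h 1.

Fact smash_incl_zmod : zmod_morphism smash_incl.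
Proof.
move=> h l; have e := bilinDl (@pure_bilin _ (uvs H) (uvs B)).
apply: (addIr (smash_incl l)); rewrite subrK /smash_incl.
by rewrite -[LHS]e subrK.
Qed.
Fact smash_incl_monoid : monoid_morphism smash_incl.
Proof.
split=> // h l; rewrite /smash_incl [RHS]smul_pure /smul2.
transitivity (tlift (fun l1 l2 : uvs H =>
   ((h * (eps H l2 *: l1 : uvs H) : H) : uvs H) \ot uone B) (Delta H l)).
  rewrite -[in LHS](counitr l).
  rewrite (linear_tlift (L := fun e : uvs H => spure (h * e) 1 : tensor (uvs H) (uvs B))).
    by [].
  by lins.
apply: tlift_eq => l1 l2; rewrite ract_one mulr1.
rewrite (linfZ (@mul_linr _ H h)) (bilinZl (@pure_bilin _ (uvs H) (uvs B))).
rewrite -(bilinZr (@pure_bilin _ (uvs H) (uvs B))).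
by congr (_ \ot _); rewrite -[RHS]mulr1.
Qed.
HB.instance Definition _ :=
  GRing.isZmodMorphism.Build H smash smash_incl smash_incl_zmod.
HB.instance Definition _ :=
  GRing.isMonoidMorphism.Build H smash smash_incl smash_incl_monoid.

Fact lin_toS (X : lmodType k) (f : X -> tensor (uvs H) (uvs B)) :
  linear f -> @linear_for k X (uvs smash_alg) *:%R f.
Proof. by move=> lf c x y; rewrite lf [in RHS]smash_scaleE. Qed.
Fact lin_fromS (X : lmodType k) (f : tensor (uvs H) (uvs B) -> X) :
  linear f -> @linear_for k (uvs smash_alg) X *:%R f.
Proof. by move=> lf c x y; rewrite smash_scaleE lf. Qed.

Definition supure (h : uvs H) (b : uvs B) : uvs smash_alg := spure h b.
Fact lin_supurel (X : lmodType k) (f : X -> uvs H) b :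
  linear f -> linear (fun x => supure (f x) b).
Proof. by move=> lf; apply: lin_toS; rewrite /spure; lin. Qed.
Fact lin_supurer (X : lmodType k) h (f : X -> uvs B) :
  linear f -> linear (fun x => supure h (f x)).
Proof. by move=> lf; apply: lin_toS; rewrite /spure; lin. Qed.

Ltac linc := repeat first [progress lins | apply: lin_supurel | apply: lin_supurer].

(* Delta (x) id_B, followed by the associativity of the tensor product.       *)
Definition scoact (x : uvs smash_alg) : tensor (uvs H) (uvs smash_alg) :=
  tlift (fun (h : uvs H) (b : uvs B) =>
    tlift (fun h1 h2 : uvs H => h1 \ot supure h2 b) (Delta H h))
    (x : tensor (uvs H) (uvs B)).

Fact scoact_bilin : @bilin k (uvs H) (uvs B) _ (fun (h : uvs H) (b : uvs B) =>
    tlift (fun h1 h2 : uvs H => h1 \ot supure h2 b) (Delta H h)).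
Proof. by linc. Qed.

Fact scoact_is_linear : linear scoact.
Proof. by apply: lin_fromS; apply: tlift_is_linear; exact: scoact_bilin. Qed.
HB.instance Definition _ := GRing.isLinear.Build k (uvs smash_alg)
  (tensor (uvs H) (uvs smash_alg)) *:%R scoact scoact_is_linear.

Fact scoact_pure h b : scoact (supure h b) =
  tlift (fun h1 h2 : uvs H => h1 \ot supure h2 b) (Delta H h).
Proof. by rewrite /scoact tlift_pure //; exact: scoact_bilin. Qed.

Fact scoact1 : scoact (1 : smash_alg) = uone H \ot uone smash_alg.
Proof.
by rewrite [LHS]scoact_pure Delta1 tlift_pure //; linc.
Qed.

Fact scoactM (x y : smash_alg) : scoact (x * y) = tmul (scoact x) (scoact y).
Proof.
have D := raddfD scoact.
elim/tensor_ind: x => [h b|x x' IH IH']; last first.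
  apply: etrans (congr1 scoact (mulrDl (x : smash_alg) x' y)) _.
  apply: etrans (D _ _) _; apply: etrans (congr2 +%R IH IH') _.
  rewrite -[LHS]tmulDl.
  by congr tmul; exact: (esym (D _ _)).
elim/tensor_ind: y => [l c|y y' IH IH']; last first.
  apply: etrans (congr1 scoact (mulrDr (h \ot b : smash_alg) y y')) _.
  apply: etrans (D _ _) _; apply: etrans (congr2 +%R IH IH') _.
  rewrite -[LHS]tmulDr.
  by congr tmul; exact: (esym (D _ _)).
rewrite -!/(spure _ _) -!/(supure _ _) [supure h b * _]smul_pure !scoact_pure.
rewrite /smul2 [LHS](linear_tlift _ _ (tlift_is_linear scoact_bilin)).
transitivity (tlift (fun h1 h2 : uvs H => tlift (fun l1 l2 : uvs H =>
  tlift (fun l11 l12 : uvs H =>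
    ((h1 : H) * l11 : uvs H) \ot supure ((h2 : H) * l12) (ract b l2 * c))
    (Delta H l1)) (Delta H l)) (Delta H h)).
  rewrite [RHS]tlift_exchange; apply: tlift_eq => l1 l2.
  apply: etrans (scoact_pure _ _) _; rewrite DeltaM tlift_tmul //.
  by linc.
rewrite (linear_tlift (L := fun t => tmul t _)); last exact: tmul_linl.
apply: tlift_eq => h1 h2; rewrite [RHS](linear_tlift _ _ (tmul_linr _)).
rewrite (@coassocE _ (fun x y z : uvs H => ((h1 : H) * x : uvs H) \ot
   supure ((h2 : H) * y) (ract b z * c))); [|by move=> x; linc|by move=> y z; linc].
apply: tlift_eq => l1 l2; rewrite tmul_pure [supure _ _ * _]smul_pure /smul2.
rewrite (linear_tlift (L := fun e : tensor (uvs H) (uvs B) =>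
   ((h1 : H) * l1 : uvs H) \ot (e : uvs smash_alg))) //.
by apply: lin_purer; apply: lin_toS; linc.
Qed.

Fact scoact_coassoc (x : uvs smash_alg) :
  tlift (fun (h : uvs H) (b : uvs smash_alg) =>
    tlift (fun h1 h2 : uvs H => h1 \ot (h2 \ot b)) (Delta H h)) (scoact x) =
  tlift (fun (h : uvs H) (b : uvs smash_alg) => h \ot scoact b) (scoact x).
Proof.
have D := raddfD scoact.
elim/tensor_ind: x => [h b|x x' IH IH']; last first.
  rewrite [scoact _]D !tliftD ?IH ?IH' //; linc.
rewrite -!/(spure _ _) -!/(supure _ _) !scoact_pure.
rewrite [LHS]linear_tlift; last by apply: tlift_is_linear; linc.
rewrite [RHS]linear_tlift; last by apply: tlift_is_linear; linc.
transitivity (tlift (fun h1 h2 : uvs H => tlift (fun x y : uvs H =>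
    x \ot (y \ot supure h2 b)) (Delta H h1)) (Delta H h)).
  by apply: tlift_eq => h1 h2; rewrite tlift_pure //; linc.
rewrite (@coassocE _ (fun x y z : uvs H => x \ot (y \ot supure z b)));
  [|by move=> z; linc|by move=> y z; linc].
apply: tlift_eq => h1 h2; rewrite tlift_pure; last by linc.
rewrite scoact_pure [RHS]linear_tlift //; linc.
Qed.

Fact scoact_counit (x : uvs smash_alg) :
  tlift (fun (h : uvs H) (b : uvs smash_alg) => eps H h *: b) (scoact x) = x.
Proof.
have lin_eps (X W : lmodType k) (f : X -> uvs H) (w : W) :
    linear f -> linear (fun x => eps H (f x) *: w).
  apply: lin_scalel => c y z.
  by rewrite rmorphD [c *: y]/(kunit H c * (y : H)) rmorphM eps_kunit.
have be : @bilin k (uvs H) (uvs smash_alg) (uvs smash_alg) (fun h b => eps H h *: b).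
  split=> [b|h]; first by apply: lin_eps; lin.
  by lin.
have D := raddfD scoact.
elim/tensor_ind: x => [h b|x x' IH IH']; last first.
  by rewrite [scoact _]D tliftD // IH IH'.
rewrite -!/(spure _ _) -!/(supure _ _) scoact_pure.
rewrite [LHS]linear_tlift; last exact: tlift_is_linear.
rewrite -[in RHS](counitl h) [RHS](linear_tlift (L := fun e => supure e b)).
  apply: tlift_eq => h1 h2; rewrite tlift_pure //.
  exact: (esym (linfZ (@lin_supurel _ _ b (@lin_id _ _)) _ _)).
by linc.
Qed.

Definition smash_comod : comodAlg H :=
  @ComodAlg k H smash_alg scoact scoact1 scoactM scoact_coassoc scoact_counit.
End Smash.
Canonical smash_comod.

Section TensorLeft.
Variables (k : fieldType) (H : fdHopf k) (A : comodAlg H) (M : lmodType A).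

Definition hmapl (V W : lmodType H) (f : {linear V -> W}) (x : hten V M) :
    hten W M :=
  tlift (fun (v : ksp V) (m : ksp M) => hpure (f v) m : tensor (ksp W) (ksp M)) x.

Section Map.
Variables (V W : lmodType H) (f : {linear V -> W}).

Fact hmapl_bilin :
  @bilin k (ksp V) (ksp M) (tensor (ksp W) (ksp M)) (fun v m => hpure (f v) m).
Proof.
split=> [m|v]; last by rewrite /hpure; lin.
by apply: lin_purel; exact: (@restr_map_is_linear _ _ (kunit H) V W f).
Qed.

Fact hmapl_pure v m : hmapl f (hpure v m) = hpure (f v) m.
Proof. by rewrite /hmapl tlift_pure //; exact: hmapl_bilin. Qed.

Fact hmaplD : {morph hmapl f : x y / x + y}.
Proof. by move=> x y; rewrite /hmapl tliftD //; exact: hmapl_bilin. Qed.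

Fact hmapl_hscale2 t x : hmapl f (hscale2 t x) = hscale2 t (hmapl f x).
Proof.
elim/tensor_ind: x => [v m|x y IHx IHy]; last first.
  by rewrite hscale2Dr !hmaplD hscale2Dr IHx IHy.
elim/tensor_ind: t => [h a|t t' IHt IHt']; last first.
  by rewrite !hscale2Dl hmaplD IHt IHt'.
rewrite hscale2_pure /pact -!/(hpure _ _) !hmapl_pure.
by rewrite /hpure hscale2_pure /pact linearZ.
Qed.

Fact hmapl_is_linear : linear (hmapl f).
Proof. by move=> a x y; rewrite hmaplD [in LHS]hmapl_hscale2. Qed.
HB.instance Definition _ :=
  GRing.isLinear.Build A (hten V M) (hten W M) *:%R (hmapl f) hmapl_is_linear.
End Map.
End TensorLeft.
Arguments hmapl {k H A} M {V W} f x.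

Section Shift.
Variables (k : fieldType) (H : fdHopf k) (L : lintegral H).

Fact Lclass_is_linear : linear (@Lclass k H L).
Proof. by move=> h x y; rewrite LclassD -LscaleE. Qed.
HB.instance Definition _ :=
  GRing.isLinear.Build H H^o (HmodL L) *:%R (@Lclass k H L) Lclass_is_linear.

Variables (A : comodAlg H) (M : lmodType A).

Definition Tmod : lmodType A := hten (HmodL L) M.

Definition Tquo : {linear hten H^o M -> Tmod} := hmapl M (@Lclass k H L).

Definition lamid (m : M) : hten H^o M := hpure (intg L : H^o) m.

Fact lamid_is_linear : linear lamid.
Proof.
move=> a x y; rewrite /lamid /hpure (bilinDr (@pure_bilin _ _ _)).
congr (_ + _); rewrite [RHS]/(hscale a _) /hscale /hscale2 tlift_pure; last first.
  exact: pact_bilin2.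
rewrite -[in LHS](cm_counit (a : uvs A)).
rewrite (linear_tlift (L := fun b : uvs A =>
  (intg L : ksp H^o) \ot ((b : A) *: x : ksp M))); last by lin.
apply: tlift_eq => h b; rewrite /pact.
rewrite (linfZ (@act_linl _ A M x)) (bilinZr (@pure_bilin _ _ _)).
rewrite -(bilinZl (@pure_bilin _ _ _)); congr (_ \ot _).
exact: (esym (intgP L h)).
Qed.
HB.instance Definition _ :=
  GRing.isLinear.Build A M (hten H^o M) *:%R lamid lamid_is_linear.
End Shift.

Section Classes.
Variables (k : fieldType) (H : fdHopf k) (A : comodAlg H).

Definition subquotient (N M : lmodType A) : Prop :=
  exists (S : lmodType A) (i : {linear S -> M}) (p : {linear S -> N}),
    injective i /\ forall y, exists x, p x = y.

(* A class of A-modules closed under finite direct sums, subquotients and     *)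
(* tensoring with H; it determines the objects of the categories below.       *)
Record modclass := ModClass {
  mc :> lmodType A -> Prop;
  mc_zero : forall M : lmodType A, (forall x : M, x = 0) -> mc M;
  mc_sum : forall M N : lmodType A, mc M -> mc N -> mc (M * N)%type;
  mc_subquotient : forall M N : lmodType A, mc M -> subquotient N M -> mc N;
  mc_tensor : forall M : lmodType A, mc M -> mc (hten H^o M) }.

Definition allmod : modclass.
Proof. by exists (fun=> True). Defined.

Variable P : modclass.

Fact mc_quotient (M N : lmodType A) (p : {linear M -> N}) :
  (forall y, exists x, p x = y) -> P M -> P N.
Proof.
move=> sp PM; apply: mc_subquotient PM _.
by exists M, idfun, p; split.
Qed.

Fact mc_shift (L : lintegral H) (M : lmodType A) : P M -> P (Tmod L M).
Proof.
move=> PM; apply: (mc_quotient (p := Tquo L M)) (mc_tensor PM) => y.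
elim/tensor_ind: y => [v m|x y [x' <-] [y' <-]]; last first.
  by exists (x' + y'); rewrite raddfD.
exists (hpure (Lrepr v) m); rewrite [LHS]hmapl_pure.
by congr (hpure _ _); exact: LreprK.
Qed.

Fact mc_findim (V : lmodType H) (M : lmodType A) :
  findim (ksp V) -> P M -> P (hten V M).
Proof.
move=> [I [e espan]] PM.
pose phi i (h : H^o) : V := (h : H) *: (e i : V).
have phi_lin i : linear (phi i).
  by move=> a x y; rewrite /phi scalerDl -scalerA.
pose phiL i : {linear H^o -> V} := HB.pack (phi i)
  (GRing.isLinear.Build H H^o V *:%R (phi i) (phi_lin i)).
have [Q [PQ [G sG]]] : exists Q : lmodType A, P Q /\
    exists G : {linear Q -> hten V M},
    forall i, i \in enum I -> forall x, exists q, G q = hmapl M (phiL i) x.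
  elim: (enum I) => [|i s [Q [PQ [G sG]]]].
    by exists M; split=> //; exists \0.
  exists (Q * hten H^o M)%type; split; first exact: mc_sum PQ (mc_tensor PM).
  exists ((G \o fst) \+ (hmapl M (phiL i) \o snd)) => j.
  rewrite inE => /orP[/eqP ->|js] x.
    by exists (0, x); rewrite /= raddf0 add0r.
  by have [q Gq] := sG j js x; exists (q, 0); rewrite /= raddf0 addr0.
apply: (mc_quotient (p := G)) PQ => y.
have rD x z : (exists q, G q = x) -> (exists q, G q = z) -> exists q, G q = x + z.
  by move=> [q <-] [q' <-]; exists (q + q'); rewrite raddfD.
elim/tensor_ind: y => [v m|x z]; last exact: rD.
have [c ->] := espan v.
have -> : (\sum_i c i *: e i) \ot m =
    \sum_i ((c i *: e i) \ot m : hten V M).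
  exact: (linf_sum (@pure_linl _ (ksp V) (ksp M) m)).
elim: (index_enum I) => [|i s IH].
  by exists 0; rewrite big_nil raddf0.
rewrite big_cons; apply: rD IH.
have := sG i (mem_enum _ _) (hpure (kunit H (c i) : H^o) m).
by rewrite hmapl_pure.
Qed.

End Classes.

Section FinDim.
Variable k : fieldType.

Fact findim_zero (V : lmodType k) : (forall x : V, x = 0) -> findim V.
Proof.
move=> V0; exists 'I_0, (fun=> 0) => v; exists (fun=> 0).
by rewrite big_ord0.
Qed.

Fact findim_quotient (V W : lmodType k) (f : V -> W) :
  linear f -> (forall y, exists x, f x = y) -> findim V -> findim W.
Proof.
move=> lf sf [I [e espan]]; exists I, (f \o e) => w.
have [v <-] := sf w; have [c ->] := espan v; exists c.
by rewrite linf_sum //; apply: eq_bigr => i _; rewrite linfZ.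
Qed.

Fact findim_sum (V W X : lmodType k) (f : V -> X) (g : W -> X) :
  linear f -> linear g -> (forall x, exists v w, x = f v + g w) ->
  findim V -> findim W -> findim X.
Proof.
move=> lf lg fg [I [e espan]] [J [e' espan']].
exists (I + J)%type,
  (fun s => match s with inl i => f (e i) | inr j => g (e' j) end) => x.
have [v [w ->]] := fg x; have [c ->] := espan v; have [d ->] := espan' w.
exists (fun s => match s with inl i => c i | inr j => d j end).
rewrite big_sumType /= (linf_sum lf) (linf_sum lg); congr (_ + _);
  by apply: eq_bigr => i _; rewrite linfZ.
Qed.

Fact findim_tensor (V W : lmodType k) :
  findim V -> findim W -> findim (tensor V W).
Proof.
move=> [I [e espan]] [J [e' espan']].
exists (I * J)%type, (fun p => e p.1 \ot e' p.2).
elim/tensor_ind => [v w|x y [c ->] [d ->]]; last first.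
  by exists (c \+ d); rewrite -big_split; apply: eq_bigr => p _; rewrite scalerDl.
have [c ->] := espan v; have [d ->] := espan' w.
exists (fun p => c p.1 * d p.2).
rewrite (linf_sum (pure_linl _)) -(pair_bigA _ (fun i j => (c i * d j) *: (e i \ot e' j))) /=.
apply: eq_bigr => i _; rewrite (linf_sum (pure_linr _)).
apply: eq_bigr => j _.
by rewrite (linfZ (pure_linr _)) (linfZ (pure_linl _)) scalerA mulrC.
Qed.

Fact findim_sub (V W : lmodType k) (f : V -> W) :
  linear f -> injective f -> findim W -> findim V.
Proof.
move=> lf injf [I [e espan]].
pose phi (x : 'rV[k]_#|I|) := \sum_(j < #|I|) x 0 j *: e (enum_val j).
have lphi : linear phi.
  move=> a x y; rewrite /phi scaler_sumr -big_split /=.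
  by apply: eq_bigr => j _; rewrite !mxE scalerDl scalerA.
have sphi w : exists x, phi x = w.
  have [c ->] := espan w; exists (\row_j c (enum_val j)).
  rewrite [RHS](reindex (@enum_val I I)) /=; last first.
    by apply: onW_bij; exact: enum_val_bij.
  by apply: eq_bigr => j _; rewrite mxE.
pose S (x : 'rV_#|I|) := exists v, phi x = f v.
pose Q r := `[< exists m (A : 'M[k]_(m, #|I|)),
  (forall i, S (row i A)) /\ \rank A = r >].
have Q0 : exists r, Q r.
  by exists 0%N; apply/asboolP; exists 0%N, 0; split; [case|rewrite mxrank0].
have Qle r : Q r -> (r <= #|I|)%N.
  by move=> /asboolP[m [A [_ <-]]]; rewrite rank_leq_col.
have [r /asboolP[m [A [SA rA]]] rmax] := ex_maxnP Q0 Qle.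
have SsubA x : S x -> (x <= A)%MS.
  move=> Sx; have AB : (A <= col_mx A x)%MS by rewrite -addsmxE addsmxSl.
  have xB : (x <= col_mx A x)%MS by rewrite -addsmxE addsmxSr.
  apply: submx_trans xB _; rewrite -(geq_leqif (mxrank_leqif_sup AB)) rA.
  apply: rmax; apply/asboolP; exists (m + 1)%N, (col_mx A x); split=> // i.
  case: (split_ordP i) => j ->; first by rewrite rowKu.
  by rewrite rowKd ord1 row_id.
have /choice[g gP] : forall i, exists v, phi (row i A) = f v by [].
exists 'I_m, g => v.
have [x xv] := sphi (f v).
have /submxP[u ux] : (x <= A)%MS by apply: SsubA; exists v.
exists (fun i => u 0 i); apply: injf; rewrite -xv ux linf_sum //.
rewrite mulmx_sum_row (linf_sum lphi); apply: eq_bigr => i _.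
by rewrite (linfZ lphi) (linfZ lf) gP.
Qed.
End FinDim.

Lemma hten_scaleE (k : fieldType) (H : fdHopf k) (A : comodAlg H)
    (V : lmodType H) (M : lmodType A) c (x : hten V M) :
  c *: (x : ksp (hten V M)) = c *: (x : tensor (ksp V) (ksp M)).
Proof.
elim/tensor_ind: x => [v m|x y IHx IHy]; last first.
  by rewrite [LHS]scalerDr [RHS]scalerDr -IHx -IHy.
transitivity (hscale2 (c *: (uone H \ot uone A)) (v \ot m)).
  have E : kunit A c = c *: uone A by rewrite [RHS]mulr1.
  rewrite -coact1 -(linfZ (f := coact A)) -?E // => a x y.
  by rewrite linearP.
rewrite -(bilinZl (@pure_bilin _ _ _)) hscale2_pure /pact /uone scale1r.
rewrite -(bilinZl (@pure_bilin _ _ _)); congr (_ \ot _).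
by rewrite -scalerA scale1r.
Qed.

Definition fdmod (k : fieldType) (H : fdHopf k) : modclass (hopf_comod H).
Proof.
exists (fun M : lmodType H => findim (ksp M)).
- by move=> M M0; exact: findim_zero.
- move=> M N; apply: (@findim_sum _ _ _ _ (fun x : ksp M => (x, 0) : ksp (M * N)%type)
    (fun x : ksp N => (0, x) : ksp (M * N)%type)).
  + by move=> a x y; congr (_, _); rewrite [RHS]addr0 [RHS]scaler0.
  + by move=> a x y; congr (_, _); rewrite [RHS]addr0 [RHS]scaler0.
  + by move=> [x y]; exists x, y; congr (_, _); rewrite ?addr0 ?add0r.
- move=> M N fM [S [i [p [inji surjp]]]].
  apply: (@findim_quotient _ (ksp S) (ksp N) p) => //.
    exact: (@restr_map_is_linear _ _ (kunit H) S N p).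
  apply: (@findim_sub _ (ksp S) (ksp M) i) => //.
  exact: (@restr_map_is_linear _ _ (kunit H) S M i).
- move=> M fM.
  apply: (@findim_quotient _ (tensor (ksp H^o) (ksp M)) (ksp (hten H^o M))
      (fun x => x)).
  + by move=> c x y; rewrite hten_scaleE.
  + by move=> y; exists y.
  + by apply: findim_tensor fM; exact: hp_findim.
Defined.

(* Categories with Hom-sets presented by setoids, and with the operations of  *)
(* a preadditive category. Only the data are recorded; the axioms are in      *)
(* [additive_category] below.                                                 *)
Record precat := PreCat {
  Ob :> Type;
  Hom : Ob -> Ob -> Type;
  eqh : forall X Y, Hom X Y -> Hom X Y -> Prop;
  idm : forall X, Hom X X;
  comp : forall X Y Z, Hom Y Z -> Hom X Y -> Hom X Z;
  zerom : forall X Y, Hom X Y;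
  addm : forall X Y, Hom X Y -> Hom X Y -> Hom X Y;
  oppm : forall X Y, Hom X Y -> Hom X Y }.
Arguments Hom {p} X Y.
Arguments eqh {p X Y} f g.
Arguments idm {p} X.
Arguments comp {p X Y Z} g f.
Arguments zerom {p X Y}.
Arguments addm {p X Y} f g.
Arguments oppm {p X Y} f.

Declare Scope hom_scope.
Local Open Scope hom_scope.
Notation "f === g" := (eqh f g) (at level 70, no associativity) : hom_scope.
Notation "g \oc f" := (comp g f) (at level 40, left associativity) : hom_scope.

Record additive_category (C : precat) : Prop := AdditiveCategory {
  ac_refl : forall (X Y : C) (f : Hom X Y), f === f;
  ac_sym : forall (X Y : C) (f g : Hom X Y), f === g -> g === f;
  ac_trans : forall (X Y : C) (f g h : Hom X Y), f === g -> g === h -> f === h;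
  ac_comp : forall (X Y Z : C) (g g' : Hom Y Z) (f f' : Hom X Y),
    g === g' -> f === f' -> g \oc f === g' \oc f';
  ac_add : forall (X Y : C) (f f' g g' : Hom X Y),
    f === f' -> g === g' -> addm f g === addm f' g';
  ac_opp : forall (X Y : C) (f f' : Hom X Y), f === f' -> oppm f === oppm f';
  ac_compA : forall (X Y Z T : C) (h : Hom Z T) (g : Hom Y Z) (f : Hom X Y),
    h \oc (g \oc f) === (h \oc g) \oc f;
  ac_idl : forall (X Y : C) (f : Hom X Y), idm Y \oc f === f;
  ac_idr : forall (X Y : C) (f : Hom X Y), f \oc idm X === f;
  ac_addA : forall (X Y : C) (f g h : Hom X Y),
    addm f (addm g h) === addm (addm f g) h;
  ac_addC : forall (X Y : C) (f g : Hom X Y), addm f g === addm g f;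
  ac_add0 : forall (X Y : C) (f : Hom X Y), addm zerom f === f;
  ac_addN : forall (X Y : C) (f : Hom X Y), addm (oppm f) f === zerom;
  ac_compDl : forall (X Y Z : C) (g g' : Hom Y Z) (f : Hom X Y),
    addm g g' \oc f === addm (g \oc f) (g' \oc f);
  ac_compDr : forall (X Y Z : C) (g : Hom Y Z) (f f' : Hom X Y),
    g \oc addm f f' === addm (g \oc f) (g \oc f');
  ac_zero : exists Z : C, forall X : C,
    (forall f : Hom X Z, f === zerom) /\ (forall f : Hom Z X, f === zerom);
  ac_biprod : forall X Y : C, exists (S : C)
    (i : Hom X S) (j : Hom Y S) (p : Hom S X) (q : Hom S Y),
    [/\ p \oc i === idm X, q \oc j === idm Y, p \oc j === zerom,
        q \oc i === zerom & addm (i \oc p) (j \oc q) === idm S] }.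

Definition is_iso (C : precat) (X Y : C) (f : Hom X Y) : Prop :=
  exists g : Hom Y X, g \oc f === idm X /\ f \oc g === idm Y.

Record prefunctor (C D : precat) := PreFunctor {
  fob :> C -> D;
  fmap : forall X Y : C, Hom X Y -> Hom (fob X) (fob Y) }.
Arguments fmap {C D} F {X Y} f : rename.

Record additive_functor (C D : precat) (F : prefunctor C D) : Prop :=
  AdditiveFunctor {
  af_eq : forall (X Y : C) (f g : Hom X Y), f === g -> fmap F f === fmap F g;
  af_id : forall X : C, fmap F (idm X) === idm (F X);
  af_comp : forall (X Y Z : C) (g : Hom Y Z) (f : Hom X Y),
    fmap F (g \oc f) === fmap F g \oc fmap F f;
  af_add : forall (X Y : C) (f g : Hom X Y),
    fmap F (addm f g) === addm (fmap F f) (fmap F g) }.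

Record pretri := PreTri {
  tcat :> precat;
  shift : prefunctor tcat tcat;
  dist : forall X Y Z : tcat,
    Hom X Y -> Hom Y Z -> Hom Z (shift X) -> Prop }.
Arguments dist {p X Y Z} u v w.

(* Isomorphism of sextuples.                                                  *)
Definition iso_tri (C : precat) (T : prefunctor C C)
    (X Y Z : C) (u : Hom X Y) (v : Hom Y Z) (w : Hom Z (T X))
    (X' Y' Z' : C) (u' : Hom X' Y') (v' : Hom Y' Z') (w' : Hom Z' (T X')) : Prop :=
  exists (a : Hom X X') (b : Hom Y Y') (c : Hom Z Z'),
    [/\ is_iso a, is_iso b & is_iso c] /\
    [/\ b \oc u === u' \oc a, c \oc v === v' \oc b & fmap T a \oc w === w' \oc c].

Record triangulated (C : pretri) : Prop := Triangulated {
  tr_additive : additive_category C;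
  tr_shift : additive_functor (shift C);
  tr_full : forall (X Y : C) (g : Hom (shift C X) (shift C Y)),
    exists f : Hom X Y, fmap (shift C) f === g;
  tr_faithful : forall (X Y : C) (f g : Hom X Y),
    fmap (shift C) f === fmap (shift C) g -> f === g;
  tr_esurj : forall Y : C, exists (X : C) (f : Hom (shift C X) Y), is_iso f;
  tr_iso : forall (X Y Z : C) (u : Hom X Y) (v : Hom Y Z) (w : Hom Z (shift C X))
      (X' Y' Z' : C) (u' : Hom X' Y') (v' : Hom Y' Z') (w' : Hom Z' (shift C X')),
    dist u v w -> iso_tri u v w u' v' w' -> dist u' v' w';
  tr_id : forall X Z : C, (forall f : Hom Z Z, f === zerom) ->
    dist (idm X) (zerom : Hom X Z) zerom;
  tr_cone : forall (X Y : C) (u : Hom X Y),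
    exists (Z : C) (v : Hom Y Z) (w : Hom Z (shift C X)), dist u v w;
  tr_rotate : forall (X Y Z : C) (u : Hom X Y) (v : Hom Y Z)
      (w : Hom Z (shift C X)),
    dist u v w <-> dist v w (oppm (fmap (shift C) u));
  tr_morph : forall (X Y Z : C) (u : Hom X Y) (v : Hom Y Z) (w : Hom Z (shift C X))
      (X' Y' Z' : C) (u' : Hom X' Y') (v' : Hom Y' Z') (w' : Hom Z' (shift C X'))
      (a : Hom X X') (b : Hom Y Y'),
    dist u v w -> dist u' v' w' -> b \oc u === u' \oc a ->
    exists c : Hom Z Z',
      c \oc v === v' \oc b /\ fmap (shift C) a \oc w === w' \oc c;
  tr_octahedron : forall (X Y Z X' Y' Z' : C) (u : Hom X Y) (v : Hom Y Z)
      (i : Hom Y Z') (i' : Hom Z' (shift C X))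
      (j : Hom Z X') (j' : Hom X' (shift C Y))
      (l : Hom Z Y') (l' : Hom Y' (shift C X)),
    dist u i i' -> dist v j j' -> dist (v \oc u) l l' ->
    exists (f : Hom Z' Y') (g : Hom Y' X'),
      [/\ dist f g (fmap (shift C) i \oc j'),
          f \oc i === l \oc v, l' \oc f === i',
          g \oc l === j & j' \oc g === fmap (shift C) u \oc l'] }.

(* An exact functor commutes with the shifts up to a natural isomorphism,     *)
(* through which it takes distinguished triangles to distinguished triangles. *)
Definition exact_functor (C D : pretri) (F : prefunctor C D) : Prop :=
  additive_functor F /\
  exists theta : forall X : C, Hom (F (shift C X)) (shift D (F X)),
    [/\ forall X, is_iso (theta X),
        forall (X Y : C) (f : Hom X Y),
          theta Y \oc fmap F (fmap (shift C) f) ===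
          fmap (shift D) (fmap F f) \oc theta X
      & forall (X Y Z : C) (u : Hom X Y) (v : Hom Y Z) (w : Hom Z (shift C X)),
          dist u v w -> dist (fmap F u) (fmap F v) (theta X \oc fmap F w)].

(* Localization of a triangulated category with respect to a class W of       *)
(* morphisms, by diagrams X <- apex -> Y.                                     *)
Section Fractions.
Variables (C : pretri) (W : forall X Y : C, Hom X Y -> Prop).

Record roof (X Y : C) := Roof {
  apex : C;
  rleft : Hom apex X;
  rleftW : W rleft;
  rright : Hom apex Y }.

Definition roof_eq (X Y : C) (r s : roof X Y) : Prop :=
  exists (Z : C) (a : Hom Z (apex r)) (b : Hom Z (apex s)),
    [/\ W (rleft r \oc a), rleft r \oc a === rleft s \oc b
      & rright r \oc a === rright s \oc b].

Definition roof_comp (X Y Z : C) (g : roof Y Z) (f : roof X Y) (r : roof X Z) :=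
  exists (V : C) (a : Hom V (apex f)) (b : Hom V (apex g))
      (Wa : W a) (Wfa : W (rleft f \oc a)),
    rright f \oc a === rleft g \oc b /\
    roof_eq r (Roof Wfa (rright g \oc b)).

Definition roof_add (X Y : C) (f g r : roof X Y) :=
  exists (V : C) (s : Hom V X) (Ws : W s) (f' g' : Hom V Y),
    [/\ roof_eq f (Roof Ws f'), roof_eq g (Roof Ws g')
      & roof_eq r (Roof Ws (addm f' g'))].

(* phi is the map on roofs induced by F: C -> C.                              *)
Definition roof_induced (F : prefunctor C C)
    (phi : forall X Y : C, roof X Y -> roof (F X) (F Y)) :=
  forall (X Y : C) (r : roof X Y), exists WF : W (fmap F (rleft r)),
    roof_eq (phi X Y r) (Roof WF (fmap F (rright r))).

(* A choice of representatives for the composition and the addition of        *)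
(* equivalence classes of roofs, and for the shift functor. The specifications *)
(* determine the resulting classes.                                           *)
Record fractions := FracOps {
  fr_comp : forall X Y Z : C, roof Y Z -> roof X Y -> roof X Z;
  fr_compP : forall X Y Z (g : roof Y Z) (f : roof X Y),
    roof_comp g f (fr_comp g f);
  fr_add : forall X Y : C, roof X Y -> roof X Y -> roof X Y;
  fr_addP : forall X Y (f g : roof X Y), roof_add f g (fr_add f g);
  fr_shift : forall X Y : C, roof X Y -> roof (shift C X) (shift C Y);
  fr_shiftP : roof_induced fr_shift }.

Variable Wid : forall X : C, W (idm X).

Definition roof_of (X Y : C) (f : Hom X Y) : roof X Y := Roof (Wid X) f.

Variable O : fractions.

Definition frac_cat : precat := {|
  Ob := C;
  Hom := roof;
  eqh := roof_eq;
  idm := fun X => roof_of (idm X);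
  comp := fr_comp O;
  zerom := fun X Y => roof_of zerom;
  addm := fr_add O;
  oppm := fun X Y r => Roof (rleftW r) (oppm (rright r)) |}.

Definition frac_shift : prefunctor frac_cat frac_cat :=
  @PreFunctor frac_cat frac_cat (shift C) (fr_shift O).

Definition frac_dist (X Y Z : frac_cat)
    (u : Hom X Y) (v : Hom Y Z) (w : Hom Z (frac_shift X)) : Prop :=
  exists (X' Y' Z' : C) (u' : Hom X' Y') (v' : Hom Y' Z')
      (w' : Hom Z' (shift C X')),
    dist u' v' w' /\
    @iso_tri frac_cat frac_shift _ _ _ (roof_of u') (roof_of v') (roof_of w')
      _ _ _ u v w.

Definition frac : pretri := PreTri frac_dist.

Definition frac_functor (F : prefunctor C C)
    (phi : forall X Y : C, roof X Y -> roof (F X) (F Y)) : prefunctor frac frac :=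
  @PreFunctor frac frac F phi.

End Fractions.

(* Rings and modules presented by setoids. The library structures do not fit  *)
(* the Grothendieck groups below: a type generated by modules lives in a      *)
(* larger universe than the carriers of lmodType.                             *)
Record setoid_ring (R : Type) (eqR : R -> R -> Prop) (zero : R)
    (add : R -> R -> R) (opp : R -> R) (one : R) (mul : R -> R -> R) : Prop :=
  SetoidRing {
  sr_refl : forall x, eqR x x;
  sr_sym : forall x y, eqR x y -> eqR y x;
  sr_trans : forall x y z, eqR x y -> eqR y z -> eqR x z;
  sr_addP : forall x x' y y', eqR x x' -> eqR y y' -> eqR (add x y) (add x' y');
  sr_oppP : forall x x', eqR x x' -> eqR (opp x) (opp x');
  sr_mulP : forall x x' y y', eqR x x' -> eqR y y' -> eqR (mul x y) (mul x' y');
  sr_addA : forall x y z, eqR (add x (add y z)) (add (add x y) z);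
  sr_addC : forall x y, eqR (add x y) (add y x);
  sr_add0 : forall x, eqR (add zero x) x;
  sr_addN : forall x, eqR (add (opp x) x) zero;
  sr_mulA : forall x y z, eqR (mul x (mul y z)) (mul (mul x y) z);
  sr_mul1 : forall x, eqR (mul one x) x;
  sr_mulr1 : forall x, eqR (mul x one) x;
  sr_mulDl : forall x y z, eqR (mul (add x y) z) (add (mul x z) (mul y z));
  sr_mulDr : forall x y z, eqR (mul x (add y z)) (add (mul x y) (mul x z)) }.

(* Left modules over a ring (R, eqR, addR, one, mul).                         *)
Record setoid_module (R : Type) (eqR : R -> R -> Prop)
    (addR : R -> R -> R) (one : R) (mul : R -> R -> R)
    (M : Type) (eqM : M -> M -> Prop) (zero : M) (add : M -> M -> M)
    (opp : M -> M) (act : R -> M -> M) : Prop := SetoidModule {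
  sm_refl : forall x, eqM x x;
  sm_sym : forall x y, eqM x y -> eqM y x;
  sm_trans : forall x y z, eqM x y -> eqM y z -> eqM x z;
  sm_addP : forall x x' y y', eqM x x' -> eqM y y' -> eqM (add x y) (add x' y');
  sm_oppP : forall x x', eqM x x' -> eqM (opp x) (opp x');
  sm_actP : forall a a' x x', eqR a a' -> eqM x x' -> eqM (act a x) (act a' x');
  sm_addA : forall x y z, eqM (add x (add y z)) (add (add x y) z);
  sm_addC : forall x y, eqM (add x y) (add y x);
  sm_add0 : forall x, eqM (add zero x) x;
  sm_addN : forall x, eqM (add (opp x) x) zero;
  sm_actA : forall a b x, eqM (act a (act b x)) (act (mul a b) x);
  sm_act1 : forall x, eqM (act one x) x;
  sm_actDl : forall a b x, eqM (act (addR a b) x) (add (act a x) (act b x));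
  sm_actDr : forall a x y, eqM (act a (add x y)) (add (act a x) (act a y)) }.

(* The Grothendieck group: the abelian group presented by the generators [X]  *)
(* and the relations [Y] = [X] + [Z].                                         *)
Inductive kterm (O : Type) : Type :=
  | kgen of O
  | kzero
  | kadd of kterm O & kterm O
  | kopp of kterm O.
Arguments kzero {O}.

Inductive keq (C : pretri) : kterm C -> kterm C -> Prop :=
  | keq_refl x : keq x x
  | keq_sym x y : keq x y -> keq y x
  | keq_trans x y z : keq x y -> keq y z -> keq x z
  | keq_add x x' y y' : keq x x' -> keq y y' -> keq (kadd x y) (kadd x' y')
  | keq_opp x x' : keq x x' -> keq (kopp x) (kopp x')
  | keq_addA x y z : keq (kadd x (kadd y z)) (kadd (kadd x y) z)
  | keq_addC x y : keq (kadd x y) (kadd y x)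
  | keq_add0 x : keq (kadd kzero x) x
  | keq_addN x : keq (kadd (kopp x) x) kzero
  | keq_dist (X Y Z : C) (u : Hom X Y) (v : Hom Y Z) (w : Hom Z (shift C X)) :
      dist u v w -> keq (kgen Y : kterm C) (kadd (kgen X) (kgen Z)).

(* Biadditive extension of an operation on generators.                        *)
Fixpoint kright (O O' : Type) (f : O -> O') (y : kterm O) : kterm O' :=
  match y with
  | kgen Y => kgen (f Y)
  | kzero => kzero
  | kadd y y' => kadd (kright f y) (kright f y')
  | kopp y => kopp (kright f y)
  end.

Fixpoint kbil (O O' O'' : Type) (f : O -> O' -> O'') (x : kterm O)
    (y : kterm O') : kterm O'' :=
  match x with
  | kgen X => kright (f X) y
  | kzero => kzero
  | kadd x x' => kadd (kbil f x y) (kbil f x' y)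
  | kopp x => kopp (kbil f x y)
  end.

Section StableCategory.
Variables (k : fieldType) (H : fdHopf k) (A : comodAlg H).

Definition null_homotopic (M N : lmodType A) (f : {linear M -> N}) : Prop :=
  exists (Q : lmodType A) (g : {linear M -> hten H^o Q})
    (h : {linear hten H^o Q -> N}), forall x, f x = h (g x).

Variable P : modclass A.

Record pmod := PMod { pmod_sort :> lmodType A; pmodP : P pmod_sort }.

(* Modules in P modulo null-homotopic morphisms; the module Q above is not    *)
(* required to lie in P.                                                      *)
Definition stabcat : precat := {|
  Ob := pmod;
  Hom := fun M N : pmod => {linear M -> N};
  eqh := fun M N f g => null_homotopic (f \- g);
  idm := fun M => idfun;
  comp := fun M N Q g f => g \o f;
  zerom := fun M N => \0;
  addm := fun M N f g => f \+ g;
  oppm := fun M N f => \- f |}.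

Definition htenF (V : lmodType H) (PV : forall M : lmodType A, P M -> P (hten V M)) :
    prefunctor stabcat stabcat :=
  @PreFunctor stabcat stabcat
    (fun M : pmod => PMod (PV M (pmodP M)))
    (fun (M N : pmod) (f : {linear M -> N}) => hmap V f).

Variable L : lintegral H.

Definition shiftF : prefunctor stabcat stabcat := htenF (mc_shift L).

Definition is_pushout (X S Y C : lmodType A) (i : {linear X -> S})
    (u : {linear X -> Y}) (ubar : {linear S -> C}) (v : {linear Y -> C}) : Prop :=
  (forall x, ubar (i x) = v (u x)) /\
  forall (N : lmodType A) (a : {linear S -> N}) (b : {linear Y -> N}),
    (forall x, a (i x) = b (u x)) ->
    exists c : {linear C -> N},
      [/\ forall s, c (ubar s) = a s, forall y, c (v y) = b y
        & forall c' : {linear C -> N}, (forall s, c' (ubar s) = a s) ->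
            (forall y, c' (v y) = b y) -> c' =1 c].

Definition std_tri (X Y C : lmodType A) (u : {linear X -> Y})
    (v : {linear Y -> C}) (w : {linear C -> Tmod L X}) : Prop :=
  exists ubar : {linear hten H^o X -> C},
    [/\ is_pushout (lamid L (M := X)) u ubar v, forall y, w (v y) = 0
      & forall s, w (ubar s) = Tquo L X s].

Definition stab_dist (X Y Z : stabcat)
    (u : Hom X Y) (v : Hom Y Z) (w : Hom Z (shiftF X)) : Prop :=
  exists (X' Y' C : pmod) (u' : {linear X' -> Y'}) (v' : {linear Y' -> C})
      (w' : {linear C -> Tmod L X'}),
    std_tri u' v' w' /\
    @iso_tri stabcat shiftF X' Y' C u' v' w' X Y Z u v w.

Definition stab : pretri := PreTri stab_dist.

End StableCategory.

Section Derived.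
Variables (k : fieldType) (H : fdHopf k) (B : modAlg H).
Variables (P : modclass (smash_comod B)) (L : lintegral H).

Definition resH (M : pmod P) : pmod (allmod (hopf_comod H)) :=
  PMod (P := allmod (hopf_comod H)) (pmod_sort := restr (smash_incl B) M) I.

Definition resH_map (M N : pmod P) (f : {linear M -> N}) :
  @Hom (stabcat (allmod (hopf_comod H))) (resH M) (resH N) :=
  @restr_map _ _ (smash_incl B) M N f.

Definition quasi_iso (M N : stab P L) (f : Hom M N) : Prop :=
  is_iso (resH_map f).

Fact quasi_iso_id (M : stab P L) : quasi_iso (idm M).
Proof.
exists (idfun : {linear resH M -> resH M}).
by split; exists (resH M), \0, \0 => x; exact: subrr.
Qed.

Definition DBH (O : fractions quasi_iso) : pretri := frac quasi_iso_id O.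

End Derived.

Section GrothendieckAction.
Variables (k : fieldType) (H : fdHopf k).

Definition tens_obj (A : comodAlg H) (P : modclass A) (V : pmod (fdmod H))
    (M : pmod P) : pmod P :=
  PMod (@mc_findim k H A P V M (pmodP V) (pmodP M)).

(* The trivial H-module k.                                                    *)
Definition trivmod : lmodType H := restr (eps H) k^o.

Fact trivmod_findim : fdmod H trivmod.
Proof.
exists unit, (fun=> 1 : k) => v; exists (fun=> v : k).
rewrite big_const card_unit /= addr0.
exact: (etrans (esym (eps_kunit H v)) (esym (mulr1 _))).
Qed.

Definition triv_obj : pmod (fdmod H) := PMod trivmod_findim.

End GrothendieckAction.

(* Main.v *)
From HB Require Import structures.
From mathcomp Require Import all_boot all_algebra.
From mathcomp Require Import boolp.
From Stdlib Require Import Setoid Morphisms.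
Require Import Defs.

(** The proof has two halves: the stable category of A-modules is triangulated,
    and the triangulated structure passes to a localization at the morphisms
    inverted by an exact functor.

    The first half rests on the integral Lam. Left multiplication by h on the
    first leg of Lam_1 (x) S(Lam_2) can be moved to right multiplication on the
    second ([integral_move]); this forces the existence of a form lam with
    lam(Lam) = 1 for which Lam_1 (x) S(Lam_2) is a dual basis
    ([frobenius_form]), and the bijectivity of the antipode ([antipode_bij]).
    Averaging with this form shows that the inclusion xi : M -> H (x) M,
    m |-> Lam (x) m, splits when M is H (x) Q or V (x) (H (x) Q)
    ([tensor_free_split]). Hence a map is null-homotopic if and only if it
    extends along xi ([null_homotopicP]), and the functors V (x) - respect
    null-homotopic maps. Modules then behave as in a Frobenius category whose
    admissible exact sequences X -> Y -> Z are those along which xi : X -> HX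
    extends to Y: these give distinguished triangles ([conflation_dist]), the
    shift is fully faithful because maps from H (x) Q lift against HY -> TY
    ([free_lift]), and every module is a suspension, namely of the kernel of
    HY -> Y ([syzygy_exists]). Standard cones rotate to admissible sequences,
    and the octahedral axiom, which may be checked up to isomorphism of the
    composable pair, is a statement about quotients of modules once the second
    map is made injective by adding HY to its target ([stab_triangulated]).

    The second half is abstract. Morphisms inverted by an exact functor satisfy
    the Ore conditions and the two-out-of-three and five lemmas
    ([inverted_verdier]). Each axiom for the category of fractions reduces to
    the same axiom in the original category, by replacing a diagram of
    fractions by an isomorphic diagram of morphisms ([frac_triangulated]); and
    an exact functor that preserves the inverted class stays exact on fractions
    ([frac_exact]).

    The functors V (x) -, - (x) M and restriction from A to H are right exact,
    commute with H (x) - up to a natural map compatible with xi, and send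
    H (x) Q to relatively injective modules; they are therefore exact on stable
    categories ([stab_functor_exact]). For restriction this yields
    triangulatedness of the derived category. As restriction commutes with
    V (x) -, the latter preserves quasi-isomorphisms and is exact on fractions.

    Finally a biadditive pairing on the free groups of objects that carries
    triangles to triangles in each variable descends to Grothendieck groups
    ([kbil_keq]); the associativity and unit isomorphisms of the tensor product
    give the ring and module axioms. *)

Set Implicit Arguments.
Unset Strict Implicit.
Unset Printing Implicit Defensive.
Import GRing.Theory.
Local Open Scope ring_scope.

(** * Linear algebra in finite dimension *)

Section LinearAlgebra.
Variable k : fieldType.

(** A spanning family of minimal size is free, so its coordinates are
    functions, hence linear. *)
Lemma findim_basis (V : lmodType k) : findim V ->
  exists (n : nat) (e : 'I_n -> V) (c : 'I_n -> {linear V -> k^o}),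
    (forall v, v = \sum_i c i v *: e i) /\ (forall i j, c i (e j) = (i == j)%:R).
Proof.
move=> [I [e0 span0]].
pose Q n := `[< exists e : 'I_n -> V, forall v, exists c : 'I_n -> k, v = \sum_i c i *: e i >].
have Q0 : exists n, Q n.
  exists #|I|; apply/asboolP; exists (fun i => e0 (enum_val i)) => v.
  have [c ->] := span0 v; exists (fun i => c (enum_val i)).
  rewrite (reindex (@enum_val I I)) //=.
  by apply: onW_bij; exact: enum_val_bij.
case: (ex_minnP Q0) => n /asboolP[e span] nmin.
have free (c : 'I_n -> k) : \sum_i c i *: e i = 0 -> forall i, c i = 0.
  move=> c0 i; apply/eqP/negPn/negP => ci.
  case: n e span nmin c c0 i ci => [|n] e span nmin c c0 i ci; first by case: i ci.
  suff /nmin : Q n by rewrite ltnn.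
  apply/asboolP; exists (fun j => e (lift i j)) => v.
  have [d ->] := span v.
  exists (fun j => d (lift i j) - d i * (c i)^-1 * c (lift i j)).
  have := congr1 (fun x => (d i * (c i)^-1) *: x) c0.
  rewrite scaler0 scaler_sumr (bigD1_ord i) //= => /(canRL (addrK _)).
  rewrite sub0r scalerA divfK // => E.
  rewrite (bigD1_ord i) //= E -sumrN -big_split /=.
  by apply: eq_bigr => j _; rewrite scalerBl scalerA addrC.
have /choice[c cP] : forall v, exists c : 'I_n -> k, v = \sum_i c i *: e i by [].
have clin i : @linear_for k V k^o *:%R (fun v => c v i).
  move=> a u v; apply/eqP; rewrite -subr_eq0; apply/eqP.
  apply: (free (fun j => c (a *: u + v) j - (a * c u j + c v j))).
  under eq_bigr => j _ do rewrite scalerBl scalerDl -scalerA.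
  by rewrite sumrB big_split /= -scaler_sumr -!cP subrr.
pose cl i : {linear V -> k^o} := HB.pack (fun v => c v i : k^o)
  (GRing.isLinear.Build k V k^o *:%R (fun v => c v i : k^o) (clin i)).
exists n, e, cl; split=> [v|i j]; first exact: cP.
apply/eqP; rewrite -subr_eq0; apply/eqP.
apply: (free (fun i => c (e j) i - (i == j)%:R)).
under eq_bigr => l _ do rewrite scalerBl.
rewrite sumrB -cP (bigD1 j) //= eqxx scale1r big1 ?addr0 ?subrr //.
by move=> l /negPf ->; rewrite scale0r.
Qed.

Lemma row_inj_unitmx n (M : 'M[k]_n) :
  (forall r : 'rV_n, r *m M = 0 -> r = 0) -> M \in unitmx.
Proof.
move=> inj; rewrite -row_free_unit -kermx_eq0; apply/eqP/row_matrixP => i.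
by rewrite row0; apply: inj; rewrite -row_mul mulmx_ker row0.
Qed.

Definition lincomb (V : lmodType k) n (c : 'I_n -> {linear V -> k^o}) (r : 'I_n -> k) (v : V) : k^o :=
  \sum_i r i * c i v.
Fact lincomb_is_linear (V : lmodType k) n (c : 'I_n -> {linear V -> k^o}) (r : 'I_n -> k) :
  linear (lincomb c r).
Proof.
move=> a u v; rewrite /lincomb scaler_sumr -big_split /=; apply: eq_bigr => i _.
by rewrite linearP mulrDr !scalerAr.
Qed.
HB.instance Definition _ V n c r := GRing.isLinear.Build k V k^o *:%R (@lincomb V n c r) (@lincomb_is_linear V n c r).

(** The coordinate matrix of the vectors b i has no left kernel, hence is
    invertible. *)
Lemma free_span (V : lmodType k) n (e : 'I_n -> V) (c : 'I_n -> {linear V -> k^o})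
    (b : 'I_n -> V) :
  (forall v, v = \sum_i c i v *: e i) ->
  (forall r : 'I_n -> k, \sum_i r i *: b i = 0 -> forall i, r i = 0) ->
  forall v, exists r : 'I_n -> k, v = \sum_i r i *: b i.
Proof.
move=> cE bfree v; pose M := \matrix_(i, j) (c j (b i) : k).
have Mu : M \in unitmx.
  apply: row_inj_unitmx => r rM; apply/rowP => i; rewrite mxE.
  apply: bfree i; rewrite [LHS]cE big1 // => j _.
  suff -> : c j (\sum_i r 0 i *: b i) = 0 by rewrite scale0r.
  have /rowP/(_ j) := rM; rewrite !mxE => <-; rewrite linear_sum.
  by apply: eq_bigr => l _; rewrite linearZ /= !mxE.
pose w := \row_j (c j v : k).
exists (fun i => (w *m invmx M) 0 i).
rewrite [LHS]cE [RHS]cE; apply: eq_bigr => j _; congr (_ *: _).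
have /rowP/(_ j) : w = w *m invmx M *m M by rewrite mulmxKV.
rewrite [LHS]mxE => ->; rewrite mxE linear_sum; apply: eq_bigr => i _.
by rewrite linearZ /= !mxE.
Qed.

(** The matrix of f in a basis has no left kernel. The criterion suits the
    antipode, since a pairing with an integral detects functionals composed
    with it. *)
Lemma transpose_inj_bij (V : lmodType k) (f : {linear V -> V}) : findim V ->
  (forall phi : {linear V -> k^o}, (forall v, phi (f v) = 0) -> forall v, phi v = 0) ->
  exists g : {linear V -> V}, cancel f g /\ cancel g f.
Proof.
move=> /findim_basis[n [e [c [cE cd]]]] inj.
pose M := \matrix_(i, j) (c i (f (e j)) : k).
have Mu : M \in unitmx.
  apply: row_inj_unitmx => r rM; apply/rowP => i; rewrite mxE.
  have := inj (lincomb c (r 0)) _ (e i); rewrite /= /lincomb.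
  rewrite (bigD1 i) //= cd eqxx mulr1 big1 ?addr0; last first.
    by move=> j /negPf ji; rewrite cd ji mulr0.
  apply=> v; rewrite [v]cE.
  under eq_bigr => j _ do rewrite !linear_sum mulr_sumr.
  rewrite exchange_big big1 //= => j _.
  transitivity (c j v * (\sum_l r 0 l * M l j)).
    rewrite mulr_sumr; apply: eq_bigr => l _.
    by rewrite !mxE !linearZ /= mulrCA.
  by have /rowP/(_ j) := rM; rewrite !mxE => ->; rewrite mulr0.
pose phi i : {linear V -> k^o} := lincomb c (fun j => invmx M i j).
have phif i j : phi i (f (e j)) = (i == j)%:R.
  have /matrixP/(_ i j) := mulVmx Mu; rewrite !mxE => <-.
  by apply: eq_bigr => l _; rewrite mxE.
pose g v := \sum_i phi i v *: e i.
have lg : linear g.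
  move=> a u v; rewrite /g scaler_sumr -big_split; apply: eq_bigr => i _.
  by rewrite linearP scalerDl scalerA.
pose gl : {linear V -> V} := HB.pack g (GRing.isLinear.Build k V V *:%R g lg).
have fK : cancel f gl.
  move=> v; rewrite [v in LHS]cE linear_sum linear_sum [RHS]cE.
  apply: eq_bigr => j _; rewrite !linearZ /=; congr (_ *: _).
  rewrite /g (bigD1 j) //= phif eqxx scale1r big1 ?addr0 // => i /negPf ij.
  by rewrite phif ij scale0r.
exists gl; split=> // v; apply/eqP; rewrite -subr_eq0; apply/eqP.
rewrite [LHS]cE big1 // => i _.
have := inj ((c i \o f \o gl) \- c i) _ v; rewrite linearB /= => ->; first by rewrite scale0r.
by move=> u; have := fK u; rewrite /= => ->; rewrite subrr.
Qed.
End LinearAlgebra.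

(** * Sweedler calculus and the Frobenius form of an integral *)

(** Sweedler sums: [sw x y <- h, F x y] is the sum of F(h_1, h_2). *)
Local Notation "'sw' x y '<-' h , F" := (tlift (fun x y : uvs _ => F) (Delta _ h))
  (at level 200, x name, y name, h at level 99, F at level 200).

Section CounitLinear.
Variables (k : fieldType) (H : fdHopf k).

Lemma lin_eps (X W : lmodType k) (f : X -> uvs H) (w : W) :
  linear f -> linear (fun x => eps H (f x) *: w).
Proof.
apply: lin_scalel => c x y.
by rewrite rmorphD [c *: x]/(kunit H c * (x : H)) rmorphM eps_kunit.
Qed.

Lemma epsZ (c : k) (h : uvs H) : eps H (c *: h) = c * eps H h.
Proof. by rewrite [c *: h]/(kunit H c * (h : H)) rmorphM eps_kunit. Qed.

End CounitLinear.

Ltac slin := repeat first [ progress lin | apply: lin_eps ].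

Section Sweedler.
Variables (k : fieldType) (H : fdHopf k).
Notation S := (antipode H).
Notation D := (Delta H).
Notation hmul x y := ((x : H) * (y : H) : uvs H).

Lemma swE (W : lmodType k) (F G : uvs H -> uvs H -> W) h :
  (forall x y, F x y = G x y) -> (sw x y <- h, F x y) = (sw x y <- h, G x y).
Proof. by move=> e; exact: tlift_eq. Qed.

Lemma counitlE (W : lmodType k) (G : uvs H -> W) (h : uvs H) :
  linear G -> (sw x y <- h, eps H x *: G y) = G h.
Proof.
move=> lG; rewrite -[in RHS](counitl h) linear_tlift //.
by apply: tlift_eq => x y; rewrite (linfZ lG).
Qed.

Lemma counitrE (W : lmodType k) (G : uvs H -> W) (h : uvs H) :
  linear G -> (sw x y <- h, eps H y *: G x) = G h.
Proof.
move=> lG; rewrite -[in RHS](counitr h) linear_tlift //.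
by apply: tlift_eq => x y; rewrite (linfZ lG).
Qed.

Lemma kunit_scale (c : k) : kunit H c = c *: uone H :> uvs H.
Proof. by rewrite [RHS]mulr1. Qed.

Lemma antipodelE (W : lmodType k) (G : uvs H -> W) (h : uvs H) :
  linear G -> (sw x y <- h, G (hmul (S x) y)) = eps H h *: G (uone H).
Proof.
move=> lG; rewrite -(linear_tlift _ _ lG) antipodel.
by rewrite -(linfZ lG) -kunit_scale.
Qed.

Lemma antipoderE (W : lmodType k) (G : uvs H -> W) (h : uvs H) :
  linear G -> (sw x y <- h, G (hmul x (S y))) = eps H h *: G (uone H).
Proof.
move=> lG; rewrite -(linear_tlift _ _ lG) antipoder.
by rewrite -(linfZ lG) -kunit_scale.
Qed.

Lemma coprodM (W : lmodType k) (G : uvs H -> uvs H -> W) (h l : uvs H) :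
  bilin G -> (sw x y <- hmul h l, G x y) =
  (sw h1 h2 <- h, sw l1 l2 <- l, G (hmul h1 l1) (hmul h2 l2)).
Proof. by move=> bG; rewrite DeltaM tlift_tmul. Qed.

(** Inserting a_2 S(a_3) makes the left side S(h_1 a_1) (h_2 a_2) S(a_3),
    where the antipode axiom applies to the product h a. So an antipode of a
    product can be cancelled before S is known to be anti-multiplicative. *)
Lemma antipode_cancel (h a : uvs H) :
  (sw x y <- h, hmul (S (hmul x a)) y) = eps H h *: S a.
Proof.
transitivity (sw a1 a2 <- a, sw x y <- hmul h a1, hmul (hmul (S x) y) (S a2)).
  transitivity (sw a1 a2 <- a, sw x y <- a2, sw h1 h2 <- h,
      hmul (S (hmul h1 a1)) (hmul h2 (hmul x (S y)))).
    transitivity (sw a1 a2 <- a, eps H a2 *: (sw h1 h2 <- h, hmul (S (hmul h1 a1)) h2)).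
      by rewrite counitrE //; slin.
    apply: swE => a1 a2.
    rewrite (@antipoderE _ (fun e => sw h1 h2 <- h, hmul (S (hmul h1 a1)) (hmul h2 e))).
      by congr (_ *: _); apply: swE => h1 h2; rewrite [hmul h2 (uone H)]mulr1.
    by slin.
  rewrite -(coassocE (G := fun a1 x y => sw h1 h2 <- h,
      hmul (S (hmul h1 a1)) (hmul h2 (hmul x (S y))))); [|by move=> ?; slin|by move=> ? ?; slin].
  apply: swE => a1 a2; rewrite coprodM; last by slin.
  rewrite [RHS]tlift_exchange; apply: swE => x y; apply: swE => h1 h2.
  by rewrite !mulrA.
rewrite -[in RHS](counitl a) [in RHS]linear_tlift; last by slin.
rewrite [RHS](linear_tlift (L := fun e => eps H h *: e)); last by slin.
apply: swE => a1 a2.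
rewrite (@antipodelE _ (fun e => hmul e (S a2))); last by slin.
rewrite [hmul (uone H) _]mul1r rmorphM linearZ scalerA //.
Qed.

Lemma antipode1 : S (uone H) = uone H.
Proof.
have := antipodel (uone H); rewrite Delta1 tlift_pure; last by slin.
by rewrite [hmul _ (uone H)]mulr1 => ->; rewrite rmorph1 rmorph1.
Qed.

Lemma lin_epsf (X : lmodType k) (f : X -> uvs H) :
  linear f -> @linear_for k X k^o *:%R (fun x => eps H (f x)).
Proof. by move=> lf c x y; rewrite lf rmorphD epsZ. Qed.

Lemma eps_antipode (h : uvs H) : eps H (S h) = eps H h.
Proof.
have lS : @linear_for k (uvs H) k^o *:%R (fun x => eps H (S x)).
  by apply: lin_epsf; slin.
rewrite -[LHS](counitrE h lS).
have lE : @linear_for k (uvs H) k^o *:%R (fun x : uvs H => eps H x).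
  by apply: lin_epsf; slin.
transitivity (tlift (fun x y : uvs H => (eps H (hmul (S x) y) : k^o)) (D h)).
  by apply: (@swE k^o) => x y; rewrite rmorphM [RHS]mulrC.
by rewrite (antipodelE h lE) rmorph1 [LHS]mulr1.
Qed.

(** Insert h_2 S(h_3) and apply [antipode_cancel] to S(h_1 a) h_2. *)
Lemma antipodeM (h a : uvs H) : S (hmul h a) = hmul (S a) (S h).
Proof.
transitivity (sw h1 h2 <- h, hmul (sw x y <- h1, hmul (S (hmul x a)) y) (S h2)).
  transitivity (sw h1 h2 <- h, sw x y <- h2, hmul (S (hmul h1 a)) (hmul x (S y))).
    rewrite -[LHS](@counitrE _ (fun e : uvs H => S (hmul e a))); last by slin.
    apply: swE => x y.
    rewrite (@antipoderE _ (fun e : uvs H => hmul (S (hmul x a)) e)); last by slin.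
    by rewrite [hmul _ (uone H)]mulr1.
  rewrite -(coassocE (G := fun h1 x y => hmul (S (hmul h1 a)) (hmul x (S y))));
    [|by move=> ?; slin|by move=> ? ?; slin].
  apply: swE => x y; rewrite [RHS](linear_tlift (L := fun e : uvs H => hmul e (S y))); last by slin.
  by apply: swE => x1 x2; rewrite mulrA.
rewrite -(@counitlE _ (fun e : uvs H => hmul (S a) (S e))); last by slin.
apply: swE => x y; rewrite antipode_cancel.
by rewrite (linfZ (@mul_linl _ H (S y))).
Qed.

Section Integral.
Variable L : lintegral H.
Notation Lam := (intg L : uvs H).

Lemma integral_scale (h : uvs H) : hmul h Lam = eps H h *: Lam.
Proof. exact: intgP. Qed.

Lemma integral_invariant (W : lmodType k) (G : uvs H -> uvs H -> W) h : bilin G ->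
  (sw h1 h2 <- h, sw x y <- Lam, G (hmul h1 x) (hmul h2 y)) =
  eps H h *: (sw x y <- Lam, G x y).
Proof.
by move=> bG; rewrite -coprodM // integral_scale linearZ tliftZ.
Qed.

(** Invariance turns Lam_1 (x) S(Lam_2) h into h_1 Lam_1 (x) S(h_2 Lam_2)
    h_3, whose last factor collapses to S(Lam_2) by [antipode_cancel]. *)
Lemma integral_move (W : lmodType k) (G : uvs H -> uvs H -> W) h : bilin G ->
  (sw x y <- Lam, G (hmul h x) (S y)) = (sw x y <- Lam, G x (hmul (S y) h)).
Proof.
move=> bG; have [bG1 bG2] := bG.
have lG1 (X : lmodType k) (f : X -> uvs H) v : linear f -> linear (fun x => G (f x) v).
  by move=> lf; exact: linear_compose (bG1 v) lf.
have lG2 (X : lmodType k) (f : X -> uvs H) u : linear f -> linear (fun x => G u (f x)).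
  by move=> lf; exact: linear_compose (bG2 u) lf.
symmetry.
rewrite -[LHS](@counitlE _ (fun e : uvs H => sw x y <- Lam, G x (hmul (S y) e))); last first.
  by slin; apply: lG2; slin.
transitivity (sw h1 h2 <- h, sw a b <- h1, sw x y <- Lam,
   G (hmul a x) (hmul (S (hmul b y)) h2)).
  apply: swE => h1 h2.
  rewrite (integral_invariant (G := fun x y => G x (hmul (S y) h2))) //.
  by split=> ?; [apply: lG1|apply: lG2]; slin.
rewrite (coassocE (G := fun a b c => sw x y <- Lam,
   G (hmul a x) (hmul (S (hmul b y)) c))); last 2 first.
- by move=> a; split=> ? /=; slin; apply: lG2; slin.
- by move=> a b; slin; apply: lG1; slin.
transitivity (sw h1 h2 <- h, sw x y <- Lam, eps H h2 *: G (hmul h1 x) (S y)).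
  apply: swE => h1 h2; rewrite tlift_exchange; apply: swE => x y.
  by rewrite -(linear_tlift _ _ (bG2 _)) antipode_cancel (linfZ (bG2 _)).
rewrite tlift_exchange; apply: swE => x y.
by rewrite (@counitrE _ (fun e : uvs H => G (hmul e x) (S y))) //; apply: lG1; slin.
Qed.

(** By [integral_move] the hypothesis gives f(S(Lam_2) u) Lam_1 = 0 for
    every u. Apply Delta to the first leg and let u be S(S(-)) h of its
    second part; as S(y_2) S(S(y_1)) sums to eps(y), the vanishing sum is
    f(h) Lam. Coordinates c i are needed because u depends on a leg of Lam. *)
Lemma integral_pairing_inj (f : {linear uvs H -> k^o}) :
  (sw x y <- Lam, f (S y) *: x) = 0 -> forall h, f h = 0.
Proof.
move=> f0 h.
have fS0 (u : uvs H) : (sw x y <- Lam, f (hmul (S y) u) *: x) = 0.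
  rewrite -(integral_move (G := fun x y => f y *: x)); last first.
    split=> ? /=; first by slin.
    by move=> c x y; rewrite linearP scalerDl scalerA.
  transitivity (hmul u (sw x y <- Lam, f (S y) *: x)); last by rewrite f0 [LHS]mulr0.
  rewrite [RHS](linear_tlift (L := fun e : uvs H => hmul u e)); last by slin.
  by apply: swE => x y; rewrite (linfZ (@mul_linr _ H u)).
have [n [e [c [cE _]]]] := findim_basis (hp_findim H).
have lf (X : lmodType k) (g : X -> uvs H) (w : uvs H) :
   linear g -> linear (fun x => f (g x) *: w).
  by move=> lg a x y; rewrite lg linearP scalerDl scalerA.
pose T (x1 x2 y : uvs H) : uvs H := f (hmul (S y) (hmul (S (S x2)) h)) *: x1.
have E1 : (sw x y <- Lam, sw x1 x2 <- x, T x1 x2 y) = f h *: Lam.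
  rewrite /T (coassocE (G := T)); last 2 first.
  - by move=> ?; rewrite /T; split=> ? /=; apply: lf; slin.
  - by move=> ? ?; rewrite /T; slin.
  rewrite -[RHS](@counitrE _ (fun e : uvs H => f h *: e)); last by slin.
  apply: swE => x y; rewrite /T.
  transitivity (f (hmul (sw y z <- y, S (hmul (S y) z)) h) *: x).
    rewrite (linear_tlift (L := fun e : uvs H => f (hmul e h) *: x)); last by apply: lf; slin.
    by apply: swE => y1 y2; rewrite antipodeM mulrA.
  rewrite (@antipodelE _ (fun e : uvs H => S e)); last by slin.
  rewrite antipode1 (linfZ (@mul_linl _ H h)) linearZ [hmul (uone H) h]mul1r.
  by rewrite scalerA.
have E2 : (sw x y <- Lam, sw x1 x2 <- x, T x1 x2 y) = 0.
  have lc i : @bilin k (uvs H) (uvs H) (uvs H) (fun x1 x2 => c i x2 *: x1).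
    split=> ? /=; first by slin.
    by move=> a x y; rewrite linearP scalerDl scalerA.
  transitivity (\sum_i (sw x1 x2 <- (sw x y <- Lam, f (hmul (S y) (hmul (S (S (e i))) h)) *: x),
     c i x2 *: x1)); last first.
    by apply: big1 => i _; rewrite fS0 linear0; exact: linf0 (tlift_is_linear (lc i)).
  transitivity (\sum_i (sw x y <- Lam, sw x1 x2 <- x,
     f (hmul (S y) (hmul (S (S (e i))) h)) *: (c i x2 *: x1))).
    rewrite /tlift /tsum exchange_big; apply: eq_bigr => p _.
    rewrite exchange_big; apply: eq_bigr => q _.
    rewrite /T {1}[q.2]cE !linear_sum mulr_suml mulr_sumr linear_sum scaler_suml.
    apply: eq_bigr => i _; rewrite !linearZ /= (linfZ (@mul_linl _ H h)).
    rewrite (linfZ (@mul_linr _ H _)) linearZ /= scalerA; congr (_ *: _); rewrite [LHS]mulrC.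
  apply: eq_bigr => i _.
  rewrite [RHS](linear_tlift (L := fun e : uvs H => sw x1 x2 <- e, c i x2 *: x1)); last first.
    by apply: (lin_tlift (lc i)); slin.
  apply: swE => x y; rewrite linearZ tliftZ; last exact: lc.
  rewrite (linear_tlift (L := fun e : uvs H => f (hmul (S y) (hmul (S (S (_ i))) h)) *: e)) //.
  by slin.
have := E2; rewrite E1 => /eqP; rewrite scaler_eq0 => /orP[/eqP //|/eqP L0].
by have := intg_neq0 L0.
Qed.

(** The vectors f(S(Lam_2)) Lam_1, for f in a basis of functionals, are free
    by [integral_pairing_inj] and so span H; lam is the functional whose
    vector is 1. Then lam(Lam) Lam = Lam by invariance of the integral. *)
Lemma frobenius_form : exists lam : {linear uvs H -> k^o},
  (forall h, (sw x y <- Lam, lam (hmul (S y) h) *: x) = h) /\ lam Lam = 1.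
Proof.
have [n [e [c [cE cd]]]] := findim_basis (hp_findim H).
pose b i := sw x y <- Lam, c i (S y) *: x.
have bfree (r : 'I_n -> k) : \sum_i r i *: b i = 0 -> forall i, r i = 0.
  move=> r0 i.
  have := @integral_pairing_inj (lincomb c r) _ (e i); rewrite /= /lincomb.
  rewrite (bigD1 i) //= cd eqxx mulr1 big1 ?addr0; last first.
    by move=> j /negPf ji; rewrite cd ji mulr0.
  apply; rewrite -[RHS]r0 /b /tlift /tsum.
  under [RHS]eq_bigr => j _ do rewrite scaler_sumr.
  rewrite [RHS]exchange_big; apply: eq_bigr => p _.
  by rewrite /= scaler_suml; apply: eq_bigr => j _; rewrite scalerA.
have [r rE] := free_span cE bfree (uone H).
pose lam : {linear uvs H -> k^o} := lincomb c r.
have lamL h : (sw x y <- Lam, lam (hmul (S y) h) *: x) = h.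
  rewrite -(integral_move (G := fun x y => lam y *: x)); last first.
    split=> ? /=; first by slin.
    by move=> a x y; rewrite linearP scalerDl scalerA.
  transitivity (hmul h (sw x y <- Lam, lam (S y) *: x)).
    rewrite [RHS](linear_tlift (L := fun e : uvs H => hmul h e)); last by slin.
    by apply: swE => x y; rewrite (linfZ (@mul_linr _ H h)).
  suff -> : (sw x y <- Lam, lam (S y) *: x) = uone H by rewrite [LHS]mulr1.
  rewrite [RHS]rE /b /tlift /tsum.
  under [RHS]eq_bigr => j _ do rewrite scaler_sumr.
  rewrite [RHS]exchange_big; apply: eq_bigr => p _.
  by rewrite /= /lincomb scaler_suml; apply: eq_bigr => j _; rewrite scalerA.
exists lam; split; [exact: lamL|].
have E : lam Lam *: Lam = Lam :> uvs H.
  rewrite -[RHS](lamL Lam).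
  rewrite -[LHS](@counitrE _ (fun e : uvs H => lam Lam *: e)); last first.
    by slin.
  apply: swE => x y; rewrite integral_scale eps_antipode.
  by rewrite [lam (_ *: _)]linearZ scalerA.
apply/eqP; rewrite -subr_eq0; apply/eqP.
have /eqP : (lam Lam - 1) *: Lam = 0 by rewrite scalerBl E scale1r subrr.
rewrite scaler_eq0 => /orP[/eqP //|/eqP L0].
by have := intg_neq0 L0.
Qed.

(** A functional that vanishes on the image of S pairs to zero with the
    integral. *)
Lemma antipode_bij : exists g : {linear uvs H -> uvs H}, cancel S g /\ cancel g S.
Proof.
apply: transpose_inj_bij (hp_findim H) _ => f fS.
by apply: integral_pairing_inj; rewrite /tlift /tsum big1 // => p _; rewrite fS scale0r.
Qed.
End Integral.

End Sweedler.

(** * Maps between tensor modules *)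

Definition mklin (R : pzRingType) (U V : lmodType R) (f : U -> V) (lf : linear f) :
  {linear U -> V} := HB.pack f (GRing.isLinear.Build R U V *:%R f lf).

Section TensorUniversal.
Variables (k : fieldType) (H : fdHopf k) (A : comodAlg H).
Variables (V : lmodType H) (M : lmodType A).

Lemma lin_toT (X : lmodType k) (f : X -> tensor (ksp V) (ksp M)) :
  linear f -> @linear_for k X (ksp (hten V M)) *:%R f.
Proof. by move=> lf c x y; rewrite lf [in RHS]hten_scaleE. Qed.

Lemma lin_fromT (X : lmodType k) (f : tensor (ksp V) (ksp M) -> X) :
  linear f -> @linear_for k (ksp (hten V M)) X *:%R f.
Proof. by move=> lf c x y; rewrite hten_scaleE lf. Qed.

Lemma hpure_bilin : @bilin k (ksp V) (ksp M) (ksp (hten V M)) (@hpure k H A V M).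
Proof. by split=> ?; apply: lin_toT; rewrite /hpure; lin. Qed.

Lemma lin_hpurel (X : lmodType k) (f : X -> ksp V) (m : ksp M) :
  linear f -> @linear_for k X (ksp (hten V M)) *:%R (fun x => hpure (f x) m).
Proof. exact: linear_compose (hpure_bilin.1 m). Qed.
Lemma lin_hpurer (X : lmodType k) (v : ksp V) (f : X -> ksp M) :
  linear f -> @linear_for k X (ksp (hten V M)) *:%R (fun x => hpure v (f x)).
Proof. exact: linear_compose (hpure_bilin.2 v). Qed.

Lemma hpureE (a : A) (v : V) (m : M) : a *: hpure v m =
  tlift (W := ksp (hten V M))
    (fun (h : uvs H) (b : uvs A) => hpure ((h : H) *: v) ((b : A) *: m)) (coact A a).
Proof. by rewrite [LHS]/(hscale a _) /hscale /hscale2 tlift_pure //; exact: pact_bilin2. Qed.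

Lemma hten_ind (Q : hten V M -> Prop) :
  (forall v m, Q (hpure v m)) -> (forall s t, Q s -> Q t -> Q (s + t)) ->
  forall t, Q t.
Proof. exact: (@tensor_ind k (ksp V) (ksp M) Q). Qed.

Lemma hten_additive_eq (N : zmodType) (f g : hten V M -> N) :
  {morph f : x y / x + y} -> {morph g : x y / x + y} ->
  (forall v m, f (hpure v m) = g (hpure v m)) -> f =1 g.
Proof.
move=> fD gD e; elim/hten_ind => [|x y ex ey]; first exact: e.
by rewrite fD gD ex ey.
Qed.

Lemma hten_linear_eq (N : lmodType A) (f g : {linear hten V M -> N}) :
  (forall v m, f (hpure v m) = g (hpure v m)) -> f =1 g.
Proof. by apply: hten_additive_eq => x y; rewrite raddfD. Qed.

Section Lift.
Variables (N : lmodType A) (F : V -> M -> N).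
Hypothesis bF : @bilin k (ksp V) (ksp M) (ksp N) F.
Hypothesis FA : forall (a : A) v m,
  tlift (W := ksp N) (fun (h : uvs H) (b : uvs A) => F ((h : H) *: v) ((b : A) *: m)) (coact A a)
  = a *: F v m.

Definition htlift (x : hten V M) : N := @tlift k (ksp V) (ksp M) (ksp N) F x.

Lemma htlift_pure v m : htlift (hpure v m) = F v m.
Proof. exact: (@tlift_pure k (ksp V) (ksp M) (ksp N) F bF v m). Qed.

Fact htlift_linear : linear htlift.
Proof.
have D x y : htlift (x + y) = htlift x + htlift y by exact: (@tliftD k (ksp V) (ksp M) (ksp N) F bF).
move=> a x y; rewrite D; congr (_ + _).
elim/hten_ind: x => [v m|x x' IH IH']; last by rewrite scalerDr !D scalerDr IH IH'.
rewrite htlift_pure -FA hpureE.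
rewrite [LHS](linear_tlift (L := @tlift k (ksp V) (ksp M) (ksp N) F : ksp (hten V M) -> ksp N)).
  apply: (@tlift_eq k _ _ (ksp N)) => h b; exact: htlift_pure.
by apply: lin_fromT; apply: tlift_is_linear.
Qed.

(** Balanced bilinear maps are the A-linear maps out of the tensor module;
    the condition on pure tensors is linearity over A. *)
Lemma hten_lift : exists f : {linear hten V M -> N}, forall v m, f (hpure v m) = F v m.
Proof. by exists (mklin htlift_linear) => v m; rewrite /= htlift_pure. Qed.
End Lift.
End TensorUniversal.

Lemma lin_form (k : fieldType) (X U W : lmodType k) (phi : {linear U -> k^o})
  (f : X -> U) (w : W) : linear f -> linear (fun x => (phi (f x) : k) *: w).
Proof. by move=> lf a x y; rewrite lf linearP scalerDl scalerA. Qed.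

Ltac hlin := repeat first
  [ exact: lin_id | assumption | apply: lin_form | apply: lin_eps
  | apply: lin_hpurel | apply: lin_hpurer
  | apply: lin_purel | apply: lin_purer | apply: lin_mull | apply: lin_mulr
  | apply: lin_scale | apply: lin_actl | apply: lin_actr | apply: lin_map
  | (apply: tlift_linear => ? ?) | (apply: lin_tlift; [split=> ? /=|])
  | (split=> ? /=) ].

Section HopfMaps.
Variables (k : fieldType) (H : fdHopf k).
Notation S := (antipode H).
Notation hmul x y := ((x : H) * (y : H) : uvs H).

(** The map b (x) w |-> b_1 (x) S(b_2) w trivializes the diagonal action on
    the second factor, so that H (x) W is free on the vector space W. *)
Lemma hten_spread (W U : lmodType H) (th : {linear ksp W -> ksp U}) :
  exists f : {linear hten H^o W -> U}, forall (b : H) w,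
    f (hpure (b : H^o) w) = tlift (W := ksp U)
      (fun x y : uvs H => (x : H) *: (th ((S y : H) *: (w : W)) : U)) (Delta H b).
Proof.
apply: (@hten_lift _ _ _ H^o W U (fun (b : H) w => tlift (W := ksp U)
      (fun x y : uvs H => (x : H) *: (th ((S y : H) *: (w : W)) : U)) (Delta H b))).
  by split=> ? /=; hlin.
move=> a b w; rewrite -[coact _ a]/(Delta H a).
transitivity (tlift (W := ksp U) (fun h1 h2 : uvs H => sw x1 x2 <- h1, sw b1 b2 <- b,
    ((hmul x1 b1 : H) *: (th ((S (hmul x2 b2) : H) *: ((h2 : H) *: (w : W))) : U) : ksp U)) (Delta H a)).
  by apply: tlift_eq => h1 h2; rewrite coprodM //; hlin.
rewrite (coassocE (G := fun x1 x2 h2 => sw b1 b2 <- b,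
    ((hmul x1 b1 : H) *: (th ((S (hmul x2 b2) : H) *: ((h2 : H) *: (w : W))) : U) : ksp U)));
  [|by move=> ?; hlin|by move=> ? ?; hlin].
transitivity (sw h1 h2 <- a, sw b1 b2 <- b, eps H h2 *: 
    ((hmul h1 b1 : H) *: (th ((S b2 : H) *: (w : W)) : U) : ksp U)).
  apply: tlift_eq => h1 h2; rewrite tlift_exchange; apply: tlift_eq => b1 b2.
  rewrite -(linfZ (f := fun e : uvs H => (hmul h1 b1 : H) *: (th ((e : H) *: (w : W)) : U) : ksp U));
    last by hlin.
  rewrite -antipode_cancel [RHS](linear_tlift (L := fun e : uvs H => (hmul h1 b1 : H) *: (th ((e : H) *: (w : W)) : U) : ksp U));
    last by hlin.
  by apply: tlift_eq => x y; rewrite scalerA.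
rewrite tlift_exchange.
rewrite [RHS](linear_tlift (L := fun e : ksp U => (a : H) *: (e : U) : ksp U)); last by hlin.
apply: tlift_eq => b1 b2.
rewrite (@counitrE _ _ _ (fun e : uvs H => (hmul e b1 : H) *: (th ((S b2 : H) *: (w : W)) : U) : ksp U)); last by hlin.
by rewrite scalerA.
Qed.

Variable L : lintegral H.
Notation Lam := (intg L : uvs H).

(** The retraction spreads v (x) a |-> lam(a_2) S^-1(a_1) v (x) 1 over H;
    the Frobenius form is dual to the integral, which leaves S^-1(a_1)
    cancelled by the diagonal action of a_2. *)
Lemma hten_right_retraction (V : lmodType H) :
  exists r : {linear hten H^o (hten V H^o) -> hten V H^o},
    forall w, r (hpure (intg L : H^o) w) = w.
Proof.
have [lam [lamE _]] := frobenius_form L; have [g [SK gK]] := antipode_bij L.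
have gM x y : g (hmul x y) = hmul (g y) (g x).
  by apply: (can_inj SK); rewrite antipodeM !gK.
have g1 : g (uone H) = uone H by rewrite -[in LHS](antipode1 H) SK.
have gcanc (W : lmodType k) (G : uvs H -> W) h : linear G ->
    (sw x y <- h, G (hmul (g y) x)) = eps H h *: G (uone H).
  move=> lG; rewrite -g1 -(@antipodelE _ _ _ (fun e : uvs H => G (g e))); last first.
    by apply: linear_compose lG _; hlin.
  by apply: tlift_eq => x y; rewrite gM SK.
have gcanc' (W : lmodType k) (G : uvs H -> W) h : linear G ->
    (sw x y <- h, G (hmul y (g x))) = eps H h *: G (uone H).
  move=> lG; rewrite -g1 -(@antipoderE _ _ _ (fun e : uvs H => G (g e))); last first.
    by apply: linear_compose lG _; hlin.
  by apply: tlift_eq => x y; rewrite gM SK.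
pose F (v : ksp V) (a : uvs H) : ksp (hten V H^o) :=
  sw a1 a2 <- a, lam a2 *: (hpure ((g a1 : H) *: (v : V)) (1 : H^o) : ksp (hten V H^o)).
have bF : bilin F.
  by rewrite /F; split=> ? /=; hlin.
pose th : {linear ksp (hten V H^o) -> ksp (hten V H^o)} :=
  mklin (lin_fromT (tlift_is_linear bF)).
have thE (s : H) v (a : H^o) : th (s *: hpure v a) =
  sw a1 a2 <- a, lam (hmul s a2) *: (hpure ((g a1 : H) *: (v : V)) (1 : H^o) : ksp (hten V H^o)).
  rewrite hpureE linear_tlift; last by move=> c x y; rewrite linearP.
  rewrite -[coact _ s]/(Delta H s).
  transitivity (sw s1 s2 <- s, F ((s1 : H) *: (v : V)) (hmul s2 a)).
    by apply: tlift_eq => s1 s2; rewrite /= tlift_pure.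
  rewrite /F.
  transitivity (sw s1 s2 <- s, sw x1 x2 <- s2, sw a1 a2 <- a, lam (hmul x2 a2) *:
    (hpure ((hmul (g a1) (hmul (g x1) s1) : H) *: (v : V)) (1 : H^o) : ksp (hten V H^o))).
    apply: tlift_eq => s1 s2; rewrite coprodM; last by split=> ? /=; hlin.
    apply: tlift_eq => x1 x2; apply: tlift_eq => a1 a2.
    by rewrite gM scalerA !mulrA.
  rewrite -(coassocE (G := fun s1 x1 x2 => sw a1 a2 <- a, lam (hmul x2 a2) *:
    (hpure ((hmul (g a1) (hmul (g x1) s1) : H) *: (v : V)) (1 : H^o) : ksp (hten V H^o))));
   [|by move=> ?; split=> ? /=; hlin
    |by move=> ? ?; hlin].
  transitivity (sw s1 s2 <- s, sw a1 a2 <- a, eps H s1 *: (lam (hmul s2 a2) *: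
    (hpure ((g a1 : H) *: (v : V)) (1 : H^o) : ksp (hten V H^o)))).
    apply: tlift_eq => s1 s2; rewrite tlift_exchange; apply: tlift_eq => a1 a2.
    rewrite (gcanc _ (fun e : uvs H => lam (hmul s2 a2) *:
      (hpure ((hmul (g a1) e : H) *: (v : V)) (1 : H^o) : ksp (hten V H^o)))); last by hlin.
    by rewrite [hmul _ (uone H)]mulr1.
  rewrite tlift_exchange; apply: tlift_eq => a1 a2.
  by rewrite (@counitlE _ _ _ (fun e : uvs H => lam (hmul e a2) *:
      (hpure ((g a1 : H) *: (v : V)) (1 : H^o) : ksp (hten V H^o)))) //; hlin.
have [r rE] := hten_spread th.
exists r; elim/hten_ind => [v a|x y IHx IHy]; last first.
  have := (bilinDr (@hpure_bilin _ _ _ H^o (hten V H^o)) (intg L) x y) => ->.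
  by rewrite raddfD -[in RHS]IHx -[in RHS]IHy.
rewrite rE.
transitivity (sw x y <- Lam, sw a1 a2 <- a, 
   ((lam (hmul (S y) a2) *: x : uvs H) : H) *: (hpure ((g a1 : H) *: (v : V)) (1 : H^o) : ksp (hten V H^o))).
  apply: tlift_eq => x y; rewrite thE.
  rewrite [LHS](linear_tlift (L := fun e : ksp (hten V H^o) => (x : H) *: (e : hten V H^o) : ksp (hten V H^o))); last by hlin.
  apply: tlift_eq => a1 a2.
  by rewrite (linfZ (@act_linr _ _ _ x)) (linfZ (@act_linl _ _ _ _)).
rewrite tlift_exchange.
transitivity (sw a1 a2 <- a, (a2 : H) *: (hpure ((g a1 : H) *: (v : V)) (1 : H^o) : (hten V H^o)) : ksp (hten V H^o)).
  apply: tlift_eq => a1 a2.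
  rewrite -[in RHS](lamE a2) [RHS](linear_tlift (L := fun e : uvs H => (e : H) *:
    (hpure ((g a1 : H) *: (v : V)) (1 : H^o) : (hten V H^o)) : ksp (hten V H^o))) //; hlin.
transitivity (sw a1 a2 <- a, sw x1 x2 <- a2, (hpure ((hmul x1 (g a1) : H) *: (v : V)) (x2 : H^o) : ksp (hten V H^o))).
  apply: tlift_eq => a1 a2; rewrite hpureE; apply: tlift_eq => x1 x2.
  by rewrite scalerA [x2 *: _]mulr1.
rewrite -(coassocE (G := fun a1 x1 x2 => (hpure ((hmul x1 (g a1) : H) *: (v : V)) (x2 : H^o) : ksp (hten V H^o))));
  [|by move=> ?; hlin|by move=> ? ?; hlin].
transitivity (sw a1 a2 <- a, eps H a1 *: (hpure v (a2 : H^o) : ksp (hten V H^o))).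
  apply: tlift_eq => a1 a2.
  rewrite (gcanc' _ (fun e : uvs H => (hpure ((e : H) *: (v : V)) (a2 : H^o) : ksp (hten V H^o)))); last by hlin.
  by rewrite scale1r.
by rewrite (@counitlE _ _ _ (fun e : uvs H => (hpure v (e : H^o) : ksp (hten V H^o)))) //; hlin.
Qed.

(** Spread v (x) a |-> lam(a) (1 (x) v): the inclusion of V in V (x) H by
    the integral has this linear retraction because lam(Lam) = 1, and H (x)
    - makes linear retractions H-linear. *)
Lemma hten_left_retraction (V : lmodType H) :
  exists r : {linear hten H^o (hten V H^o) -> hten H^o V},
    forall (b : H^o) (v : V), r (hpure b (hpure v (intg L : H^o))) = hpure b v.
Proof.
have [lam [_ lam1]] := frobenius_form L.
pose F (v : ksp V) (a : uvs H) : ksp (hten H^o V) :=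
  lam a *: (hpure (1 : H^o) v : ksp (hten H^o V)).
have bF : bilin F by rewrite /F; split=> ? /=; hlin.
pose th : {linear ksp (hten V H^o) -> ksp (hten H^o V)} :=
  mklin (lin_fromT (tlift_is_linear bF)).
have thE (s : H) v : th (s *: hpure v (intg L : H^o)) = hpure (1 : H^o) (s *: v).
  rewrite hpureE linear_tlift; last by move=> c x y; rewrite linearP.
  rewrite -[coact _ s]/(Delta H s).
  rewrite -[RHS](@counitrE _ _ _ (fun e : uvs H => hpure (1 : H^o) ((e : H) *: v) : ksp (hten H^o V))); last by hlin.
  apply: tlift_eq => s1 s2; rewrite /= tlift_pure // /F.
  rewrite -[lam _]/(lam (hmul s2 Lam)) integral_scale linearZ /=.
  by rewrite lam1 [_%:A]mulr1.
have [r rE] := hten_spread th.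
exists r => b v; rewrite rE.
transitivity (sw x y <- b, sw x1 x2 <- x, 
   (hpure (x1 : H^o) ((hmul x2 (S y) : H) *: v) : ksp (hten H^o V))).
  apply: tlift_eq => x y; rewrite thE hpureE; apply: tlift_eq => x1 x2.
  by rewrite scalerA; congr (hpure _ _); exact: mulr1.
rewrite (coassocE (G := fun x1 x2 y => hpure (x1 : H^o) ((hmul x2 (S y) : H) *: v) : ksp (hten H^o V)));
  [|by move=> ?; hlin|by move=> ? ?; hlin].
rewrite -[RHS](@counitrE _ _ _ (fun e : uvs H => (hpure (e : H^o) v : ksp (hten H^o V)))); last by hlin.
apply: tlift_eq => x y.
rewrite (@antipoderE _ _ _ (fun e : uvs H => (hpure (x : H^o) ((e : H) *: v) : ksp (hten H^o V)))); last by hlin.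
by rewrite scale1r.
Qed.

Lemma hten_comult : exists f : {linear H^o -> hten H^o H^o}, forall h : H,
  f h = sw h1 h2 <- h, (hpure (h1 : H^o) (h2 : H^o) : ksp (hten H^o H^o)).
Proof.
pose f (h : H^o) : hten H^o H^o := sw h1 h2 <- h, (hpure (h1 : H^o) (h2 : H^o) : ksp (hten H^o H^o)).
have lf : linear f.
  have fD x y : f (x + y) = f x + f y.
    rewrite /f raddfD tliftD //; exact: hpure_bilin.
  move=> a x y; rewrite fD; congr (_ + _).
  rewrite /f [D in tlift _ D](_ : _ = Delta H (hmul a x)) // coprodM; last exact: hpure_bilin.
  rewrite tlift_exchange [RHS](linear_tlift (L := fun e : ksp (hten H^o H^o) => a *: (e : hten H^o H^o) : ksp (hten H^o H^o))); last by hlin.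
  by apply: tlift_eq => x1 x2; rewrite hpureE; apply: tlift_eq.
by exists (mklin lf).
Qed.
End HopfMaps.

Section Coherence.
Variables (k : fieldType) (H : fdHopf k) (A : comodAlg H).

Lemma cm_coassocE (W : lmodType k) (G : uvs H -> uvs H -> uvs A -> W) (a : A) :
  (forall x, bilin (G x)) -> (forall y z, linear (fun x => G x y z)) ->
  tlift (fun h b => sw h1 h2 <- h, G h1 h2 b) (coact A a) =
  tlift (fun h b => tlift (fun h' b' => G h h' b') (coact A b)) (coact A a).
Proof.
move=> bG lG.
have bG' : bilin (fun x t => tlift (G x) t).
  split=> [t|x]; first exact: tlift_linear.
  exact: tlift_is_linear.
have lL := tlift_is_linear bG'.
have := congr1 (tlift (fun x t => tlift (G x) t)) (cm_coassoc (a : uvs A)).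
rewrite !(linear_tlift _ _ lL) => E.
transitivity (tlift (fun (h : uvs H) (b : uvs A) => tlift (fun x t => tlift (G x) t)
  (sw h1 h2 <- h, h1 \ot (h2 \ot b))) (coact A a)).
  apply: tlift_eq => u v; rewrite (linear_tlift _ _ lL).
  by apply: tlift_eq => x y; rewrite !tlift_pure.
by rewrite E; apply: tlift_eq => u v; rewrite tlift_pure.
Qed.

Lemma cm_counitE (W : lmodType k) (G : uvs A -> W) (a : A) :
  linear G -> tlift (fun (x : uvs H) y => eps H x *: G y) (coact A a) = G a.
Proof.
move=> lG; rewrite -[in RHS](cm_counit (a : uvs A)) linear_tlift //.
by apply: tlift_eq => x y; rewrite (linfZ lG).
Qed.

Section Assoc.
Variables (V W : lmodType H) (M : lmodType A).

Definition hassoc_fun (t : hten V W) (m : M) : hten V (hten W M) :=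
  @tlift k (ksp V) (ksp W) (ksp (hten V (hten W M))) (fun v w => hpure v (hpure w m)) t.

Fact hassoc_bilin3 (m : ksp M) : @bilin k (ksp V) (ksp W) (ksp (hten V (hten W M)))
   (fun v w => hpure v (hpure w m)).
Proof. by hlin. Qed.

Fact hassoc_bilin : @bilin k (ksp (hten V W)) (ksp M) (ksp (hten V (hten W M))) hassoc_fun.
Proof.
split=> [m|t] /=; last by rewrite /hassoc_fun; hlin.
by apply: lin_fromT; apply: tlift_is_linear; exact: hassoc_bilin3.
Qed.

Fact hassoc_balanced (a : A) (t : hten V W) (m : M) :
  tlift (W := ksp (hten V (hten W M)))
    (fun (h : uvs H) (b : uvs A) => hassoc_fun ((h : H) *: t) ((b : A) *: m)) (coact A a)
  = a *: hassoc_fun t m.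
Proof.
have D x y n : hassoc_fun (x + y) n = hassoc_fun x n + hassoc_fun y n.
  exact: (bilinDl hassoc_bilin x y n).
elim/hten_ind: t => [v w|x y IHx IHy]; last first.
  rewrite D scalerDr -IHx -IHy /tlift /tsum -big_split.
  by apply: eq_bigr => p _; rewrite scalerDr D.
rewrite [in RHS]/hassoc_fun [in RHS]/hpure tlift_pure; last exact: hassoc_bilin3.
rewrite hpureE.
transitivity (tlift (fun (h : uvs H) (b : uvs A) => sw h1 h2 <- h,
   (hpure ((h1 : H) *: v) (hpure ((h2 : H) *: w) ((b : A) *: m)) : ksp (hten V (hten W M)))) (coact A a)).
  apply: tlift_eq => h b; rewrite /hassoc_fun hpureE.
  rewrite [LHS](linear_tlift (L := @tlift k (ksp V) (ksp W) (ksp (hten V (hten W M))) (fun v w => hpure v (hpure w ((b : A) *: m))) : ksp (hten V W) -> _)).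
    by apply: tlift_eq => h1 h2; rewrite tlift_pure //; exact: hassoc_bilin3.
  by apply: lin_fromT; apply: tlift_is_linear; exact: hassoc_bilin3.
rewrite (cm_coassocE (G := fun h1 h2 b => (hpure ((h1 : H) *: v) (hpure ((h2 : H) *: w) ((b : A) *: m)) : ksp (hten V (hten W M)))));
  [|by move=> ?; hlin|by move=> ? ?; hlin].
apply: tlift_eq => h b; rewrite hpureE.
by rewrite [RHS](linear_tlift (L := fun e : ksp (hten W M) => hpure ((h : H) *: v) e : ksp (hten V (hten W M)))) //; hlin.
Qed.

Definition hassoc : {linear hten (hten V W) M -> hten V (hten W M)} :=
  locked (mklin (htlift_linear hassoc_bilin hassoc_balanced)).
Lemma hassoc_pure v w m : hassoc (hpure (hpure v w) m) = hpure v (hpure w m).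
Proof.
by rewrite /hassoc -lock /= htlift_pure ?[LHS]tlift_pure //; [exact: hassoc_bilin3|exact: hassoc_bilin].
Qed.

Definition hassocV_fun (v : V) (t : hten W M) : hten (hten V W) M :=
  @tlift k (ksp W) (ksp M) (ksp (hten (hten V W) M)) (fun w m => hpure (hpure v w) m) t.

Fact hassocV_bilin3 (v : ksp V) : @bilin k (ksp W) (ksp M) (ksp (hten (hten V W) M))
   (fun w m => hpure (hpure v w) m).
Proof. by hlin. Qed.

Fact hassocV_bilin : @bilin k (ksp V) (ksp (hten W M)) (ksp (hten (hten V W) M)) hassocV_fun.
Proof.
split=> [t|v] /=; first by rewrite /hassocV_fun; hlin.
by apply: lin_fromT; apply: tlift_is_linear; exact: hassocV_bilin3.
Qed.

Fact hassocV_balanced (a : A) (v : V) (t : hten W M) :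
  tlift (W := ksp (hten (hten V W) M))
    (fun (h : uvs H) (b : uvs A) => hassocV_fun ((h : H) *: v) ((b : A) *: t)) (coact A a)
  = a *: hassocV_fun v t.
Proof.
have D x y u : hassocV_fun u (x + y) = hassocV_fun u x + hassocV_fun u y.
  exact: (bilinDr hassocV_bilin u x y).
elim/hten_ind: t => [w m|x y IHx IHy]; last first.
  rewrite D scalerDr -IHx -IHy /tlift /tsum -big_split.
  by apply: eq_bigr => p _; rewrite scalerDr D.
rewrite [in RHS]/hassocV_fun [in RHS]/hpure tlift_pure; last exact: hassocV_bilin3.
rewrite hpureE.
transitivity (tlift (fun (h : uvs H) (b : uvs A) => tlift (fun (h' : uvs H) (b' : uvs A) =>
   (hpure (hpure ((h : H) *: v) ((h' : H) *: w)) ((b' : A) *: m) : ksp (hten (hten V W) M))) (coact A b)) (coact A a)).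
  apply: tlift_eq => h b; rewrite /hassocV_fun hpureE.
  rewrite [LHS](linear_tlift (L := @tlift k (ksp W) (ksp M) (ksp (hten (hten V W) M)) (fun w m => hpure (hpure ((h : H) *: v) w) m) : ksp (hten W M) -> _)).
    by apply: tlift_eq => h1 h2; rewrite tlift_pure //; exact: hassocV_bilin3.
  by apply: lin_fromT; apply: tlift_is_linear; exact: hassocV_bilin3.
rewrite -(cm_coassocE (G := fun h1 h2 b => (hpure (hpure ((h1 : H) *: v) ((h2 : H) *: w)) ((b : A) *: m) : ksp (hten (hten V W) M))));
  [|by move=> ?; hlin|by move=> ? ?; hlin].
apply: tlift_eq => h b; rewrite hpureE.
by rewrite [RHS](linear_tlift (L := fun e : ksp (hten V W) => hpure e ((b : A) *: m) : ksp (hten (hten V W) M))) //; hlin.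
Qed.

Definition hassocV : {linear hten V (hten W M) -> hten (hten V W) M} :=
  locked (mklin (htlift_linear hassocV_bilin hassocV_balanced)).
Lemma hassocV_pure v w m : hassocV (hpure v (hpure w m)) = hpure (hpure v w) m.
Proof.
by rewrite /hassocV -lock /= htlift_pure ?[LHS]tlift_pure //; [exact: hassocV_bilin3|exact: hassocV_bilin].
Qed.
End Assoc.

Section Unit.
Variable M : lmodType A.

Fact eps_map_bilin (V : lmodType H) (e : {linear ksp V -> k^o}) :
  @bilin k (ksp V) (ksp M) (ksp M) (fun v m => (e v : k) *: (m : ksp M)).
Proof. by hlin. Qed.

Fact eps_map_balanced (V : lmodType H) (e : {linear ksp V -> k^o}) :
  (forall (h : H) v, e (h *: v) = eps H h * e v) ->
  forall (a : A) v m, tlift (W := ksp M) (fun (h : uvs H) (b : uvs A) =>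
    (e ((h : H) *: v) : k) *: ((b : A) *: m : ksp M)) (coact A a) = a *: ((e v : k) *: (m : ksp M) : M).
Proof.
move=> eH a v m; rewrite (linfZ (@act_linr _ A M a)).
rewrite -(@cm_counitE _ (fun y : uvs A => e v *: ((y : A) *: m : ksp M))); last by hlin.
by apply: tlift_eq => h b; rewrite eH -scalerA.
Qed.

(** For V = H and the counit of H this is the counit of H (x) -, and for the
    trivial module it is the unit isomorphism. *)
Definition hform (V : lmodType H) (e : {linear ksp V -> k^o})
  (eH : forall (h : H) v, e (h *: v) = eps H h * e v) : {linear hten V M -> M} :=
  locked (mklin (htlift_linear (eps_map_bilin e) (eps_map_balanced eH))).
Lemma hform_pure V e eH v m : @hform V e eH (hpure v m) = ((e v : k) *: (m : ksp M) : M).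
Proof. by rewrite /hform -lock /= htlift_pure //; exact: eps_map_bilin. Qed.
End Unit.
End Coherence.

(** * Cokernels, kernels and factorizations *)

Local Open Scope quotient_scope.

Section Modules.
Variable R : pzRingType.

Section Cokernel.
Variables (X Y : lmodType R) (i : {linear X -> Y}).

Definition coker_rel (y y' : Y) : bool := `[< exists x, y - y' = i x >].

Fact coker_equiv : equiv_class_of coker_rel.
Proof.
split=> [y|y y'|y z t].
- by apply/asboolP; exists 0; rewrite subrr raddf0.
- by apply/asboolP/asboolP=> -[x e]; exists (- x); rewrite [i _]linearN -e opprB.
- move=> /asboolP[x e] /asboolP[x' e']; apply/asboolP; exists (x + x').
  by rewrite [i _]linearD -e -e' addrA subrK.
Qed.
Canonical coker_equiv_rel := EquivRelPack coker_equiv.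

Definition coker : Type := {eq_quot coker_rel}.
HB.instance Definition _ := Choice.copy coker {eq_quot coker_rel}.

Definition ckcls (y : Y) : coker := \pi_{eq_quot coker_rel} y.
Definition ckrep (x : coker) : Y := repr (x : {eq_quot coker_rel}).
Lemma ckrepK x : ckcls (ckrep x) = x. Proof. exact: reprK. Qed.
Lemma ckclsP y y' : ckcls y = ckcls y' <-> exists x, y - y' = i x.
Proof. by split=> [/eqmodP/asboolP //|e]; apply/eqmodP/asboolP. Qed.

Definition ckadd (x y : coker) := ckcls (ckrep x + ckrep y).
Definition ckopp (x : coker) := ckcls (- ckrep x).
Definition ckscale (a : R) (x : coker) := ckcls (a *: ckrep x).

Fact ckaddE x y : ckadd (ckcls x) (ckcls y) = ckcls (x + y).
Proof.
have [c e] := iffLR (ckclsP _ _) (ckrepK (ckcls x)).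
have [d e'] := iffLR (ckclsP _ _) (ckrepK (ckcls y)).
by apply/ckclsP; exists (c + d); rewrite [i _]linearD -e -e' opprD addrACA.
Qed.
Fact ckoppE x : ckopp (ckcls x) = ckcls (- x).
Proof.
have [c e] := iffLR (ckclsP _ _) (ckrepK (ckcls x)).
by apply/ckclsP; exists (- c); rewrite [i _]linearN -e opprB opprK addrC.
Qed.
Fact ckscaleE a x : ckscale a (ckcls x) = ckcls (a *: x).
Proof.
have [c e] := iffLR (ckclsP _ _) (ckrepK (ckcls x)).
by apply/ckclsP; exists (a *: c); rewrite [i _]linearZ_LR -e scalerBr.
Qed.
Fact ckclsE (Q : coker -> Prop) : (forall y, Q (ckcls y)) -> forall x, Q x.
Proof. by move=> Qh x; rewrite -(ckrepK x). Qed.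

Fact ckaddA : associative ckadd.
Proof.
by move=> x y z; elim/ckclsE: x => x; elim/ckclsE: y => y; elim/ckclsE: z => z;
  rewrite !ckaddE addrA.
Qed.
Fact ckaddC : commutative ckadd.
Proof.
by move=> x y; elim/ckclsE: x => x; elim/ckclsE: y => y; rewrite !ckaddE addrC.
Qed.
Fact ckadd0 : left_id (ckcls 0) ckadd.
Proof. by move=> x; elim/ckclsE: x => x; rewrite ckaddE add0r. Qed.
Fact ckaddN : left_inverse (ckcls 0) ckopp ckadd.
Proof. by move=> x; elim/ckclsE: x => x; rewrite ckoppE ckaddE addNr. Qed.
HB.instance Definition _ := GRing.isZmodule.Build coker ckaddA ckaddC ckadd0 ckaddN.

Fact ckscaleA a b x : ckscale a (ckscale b x) = ckscale (a * b) x.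
Proof. by elim/ckclsE: x => x; rewrite !ckscaleE scalerA. Qed.
Fact ckscale1 : left_id 1 ckscale.
Proof. by move=> x; elim/ckclsE: x => x; rewrite ckscaleE scale1r. Qed.
Fact ckscaleDr : right_distributive ckscale +%R.
Proof.
move=> a x y; elim/ckclsE: x => x; elim/ckclsE: y => y.
by rewrite [_ + _]ckaddE !ckscaleE scalerDr -[LHS]ckaddE.
Qed.
Fact ckscaleDl x : {morph ckscale^~ x : a b / a + b}.
Proof.
by move=> a b; elim/ckclsE: x => x; rewrite !ckscaleE scalerDl -[LHS]ckaddE.
Qed.
HB.instance Definition _ := GRing.Zmodule_isLmodule.Build R coker
  ckscaleA ckscale1 ckscaleDr ckscaleDl.

Fact ckcls_linear : linear ckcls.
Proof. by move=> a x y; rewrite -[LHS]ckaddE -[ckcls (a *: x)]ckscaleE. Qed.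

Lemma coker_exists : exists (Q : lmodType R) (p : {linear Y -> Q}),
  (forall z, exists y, p y = z) /\ (forall y, p y = 0 <-> exists x, y = i x).
Proof.
exists coker, (mklin ckcls_linear); split=> [z|y]; first by exists (ckrep z); exact: ckrepK.
rewrite -[X in _ = X <-> _](raddf0 (mklin ckcls_linear)) /= ckclsP.
by rewrite subr0.
Qed.
End Cokernel.

Section Kernel.
Variables (Y Z : lmodType R) (p : {linear Y -> Z}).

Definition ker_pred : {pred Y} := [pred y | p y == 0].
Fact ker_submod : submod_closed ker_pred.
Proof.
split; first by rewrite inE /= raddf0.
by move=> a x y; rewrite !inE linearP => /eqP -> /eqP ->; rewrite scaler0 addr0.
Qed.
HB.instance Definition _ := GRing.isSubmodClosed.Build R Y ker_pred ker_submod.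

Record kernel := Kernel { kerval : Y; _ : kerval \in ker_pred }.
HB.instance Definition _ := [isSub for kerval].
HB.instance Definition _ := [Choice of kernel by <:].
HB.instance Definition _ := [SubChoice_isSubLmodule of kernel by <:].

Lemma kernel_exists : exists (K : lmodType R) (i : {linear K -> Y}),
  injective i /\ (forall y, p y = 0 <-> exists x, y = i x).
Proof.
exists kernel, (val : {linear kernel -> Y}); split; first exact: val_inj.
move=> y; split=> [p0|[[x px] ->]]; last exact/eqP.
have py : y \in ker_pred by rewrite inE p0.
by exists (Kernel py).
Qed.
End Kernel.

Lemma factor_surj (Y Z N : lmodType R) (p : {linear Y -> Z}) (g : {linear Y -> N}) :
  (forall z, exists y, p y = z) -> (forall y, p y = 0 -> g y = 0) ->
  exists f : {linear Z -> N}, forall y, f (p y) = g y.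
Proof.
move=> /choice[s sK] g0.
have gs y : g (s (p y)) = g y.
  by apply/eqP; rewrite -subr_eq0 -linearB; apply/eqP/g0; rewrite linearB sK subrr.
have lf : linear (fun z => g (s z)).
  by move=> a x y; rewrite -[in LHS](sK x) -[in LHS](sK y) -linearP gs linearP.
by exists (mklin lf).
Qed.

Lemma factor_inj (X Y N : lmodType R) (i : {linear X -> Y}) (g : {linear N -> Y}) :
  injective i -> (forall n, exists x, g n = i x) ->
  exists f : {linear N -> X}, forall n, i (f n) = g n.
Proof.
move=> inji /choice[s sK].
have lf : linear s by move=> a x y; apply: inji; rewrite -sK !linearP !sK.
by exists (mklin lf) => n; rewrite /= -sK.
Qed.
End Modules.

(** * Functoriality and exactness of the tensor product *)

Section Functoriality.
Variables (k : fieldType) (H : fdHopf k) (A : comodAlg H).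
Implicit Types (V W : lmodType H) (M N : lmodType A).

Lemma hmap_id V M (f : {linear M -> M}) : f =1 id -> hmap V f =1 id.
Proof.
move=> e; apply: (@hten_linear_eq _ _ _ _ _ _ (hmap V f) idfun) => v m.
by rewrite /= hmap_pure e.
Qed.
Lemma hmap_comp V M N (Q : lmodType A) (g : {linear N -> Q}) (f : {linear M -> N}) (h : {linear M -> Q}) :
  (forall x, h x = g (f x)) -> forall t, hmap V h t = hmap V g (hmap V f t).
Proof.
move=> e; apply: (@hten_linear_eq _ _ _ _ _ _ (hmap V h) (hmap V g \o hmap V f)) => v m.
by rewrite /= !hmap_pure e.
Qed.
Lemma hmap_add V M N (f g h : {linear M -> N}) :
  (forall x, h x = f x + g x) -> forall t, hmap V h t = hmap V f t + hmap V g t.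
Proof.
move=> e; apply: (@hten_linear_eq _ _ _ _ _ _ (hmap V h) (hmap V f \+ hmap V g)) => v m.
by rewrite /= !hmap_pure e; exact: (bilinDr (@hpure_bilin _ _ _ V N)).
Qed.

Lemma hmapl_id M V (f : {linear V -> V}) : f =1 id -> hmapl M f =1 id.
Proof.
move=> e; apply: (@hten_linear_eq _ _ _ _ _ _ (hmapl M f) idfun) => v m.
by rewrite /= hmapl_pure e.
Qed.
Lemma hmapl_comp M V W (U : lmodType H) (g : {linear W -> U}) (f : {linear V -> W}) (h : {linear V -> U}) :
  (forall x, h x = g (f x)) -> forall t, hmapl M h t = hmapl M g (hmapl M f t).
Proof.
move=> e; apply: (@hten_linear_eq _ _ _ _ _ _ (hmapl M h) (hmapl M g \o hmapl M f)) => v m.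
by rewrite /= !hmapl_pure e.
Qed.
Lemma hmapl_add M V W (f g h : {linear V -> W}) :
  (forall x, h x = f x + g x) -> forall t, hmapl M h t = hmapl M f t + hmapl M g t.
Proof.
move=> e; apply: (@hten_linear_eq _ _ _ _ _ _ (hmapl M h) (hmapl M f \+ hmapl M g)) => v m.
by rewrite /= !hmapl_pure e; exact: (bilinDl (@hpure_bilin _ _ _ W M)).
Qed.
Lemma hmap_hmapl V W (g : {linear V -> W}) M N (f : {linear M -> N}) t :
  hmap W f (hmapl M g t) = hmapl N g (hmap V f t).
Proof.
apply: (@hten_linear_eq _ _ _ _ _ _ (hmap W f \o hmapl M g) (hmapl N g \o hmap V f)) t => v m.
by rewrite /= !(hmap_pure, hmapl_pure).
Qed.

Lemma hmap_surj V M N (p : {linear M -> N}) :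
  (forall n, exists m, p m = n) -> forall t, exists s, hmap V p s = t.
Proof.
move=> sp; elim/hten_ind => [v n|t t' [s <-] [s' <-]].
  by have [m <-] := sp n; exists (hpure v m); rewrite hmap_pure.
by exists (s + s'); rewrite raddfD.
Qed.

Lemma hmapl_surj M V W (p : {linear V -> W}) :
  (forall n, exists m, p m = n) -> forall t, exists s, hmapl M p s = t.
Proof.
move=> sp; elim/hten_ind => [w m|t t' [s <-] [s' <-]].
  by have [v <-] := sp w; exists (hpure v m); rewrite hmapl_pure.
by exists (s + s'); rewrite raddfD.
Qed.

(** The map from V (x) Q to the cokernel of V (x) i that sends v (x) z to
    the class of v (x) y, for any y above z, inverts the map induced by V
    (x) p. *)
Lemma hmap_exact V M N (Q : lmodType A) (i : {linear M -> N}) (p : {linear N -> Q}) :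
  (forall n, exists m, p m = n) -> (forall y, p y = 0 -> exists x, y = i x) ->
  forall t, hmap V p t = 0 -> exists s, t = hmap V i s.
Proof.
move=> /choice[s sK] ex t.
have [C [c [cs cP]]] := coker_exists (hmap V i).
have cE v y y' : p y = p y' -> c (hpure v y) = c (hpure v y').
  move=> e; have [x xE] : exists x, y - y' = i x.
    by apply: ex; rewrite linearB e subrr.
  rewrite -[y](subrK y') xE (bilinDr (@hpure_bilin _ _ _ V N)) raddfD.
  rewrite [X in X + _](_ : _ = 0) ?add0r //.
  by apply/cP; exists (hpure v x); rewrite /= hmap_pure.
pose F (v : ksp V) (z : ksp Q) : ksp C := c (hpure v (s z)).
have lc a (x y : ksp (hten V N)) : c (a *: x + y) = a *: (c x : ksp C) + c y.
  exact: (@restr_map_is_linear _ _ (kunit A) _ _ c).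
have lp a (x y : ksp N) : p (a *: x + y) = a *: (p x : ksp Q) + p y.
  exact: (@restr_map_is_linear _ _ (kunit A) _ _ p).
have bF : bilin F.
  split=> [z|v] a x y; rewrite /F /=.
    by rewrite -lc; congr (c _); exact: ((hpure_bilin V N).1 (s z) a x y).
  rewrite -lc; transitivity (c (hpure v (a *: (s x : ksp N) + s y))).
    by apply: cE; rewrite sK lp !sK.
  by congr (c _); exact: ((hpure_bilin V N).2 v a (s x) (s y)).
have E : tlift F (hmap V p t) = c t.
  apply: (@hten_additive_eq _ _ _ _ _ _ (fun t => tlift F (hmap V p t)) c) t.
  - by move=> x y; rewrite raddfD tliftD.
  - by move=> x y; rewrite raddfD.
  - by move=> v y; rewrite hmap_pure tlift_pure //; apply: cE; rewrite sK.
by move=> t0; apply/cP; rewrite -E t0; exact: linf0 (tlift_is_linear bF).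
Qed.

Lemma hmapl_exact M V W (U : lmodType H) (i : {linear V -> W}) (p : {linear W -> U}) :
  (forall n, exists m, p m = n) -> (forall y, p y = 0 -> exists x, y = i x) ->
  forall t, hmapl M p t = 0 -> exists s, t = hmapl M i s.
Proof.
move=> /choice[s sK] ex t.
have [C [c [cs cP]]] := coker_exists (hmapl M i).
have cE m y y' : p y = p y' -> c (hpure y m) = c (hpure y' m).
  move=> e; have [x xE] : exists x, y - y' = i x.
    by apply: ex; rewrite linearB e subrr.
  rewrite -[y](subrK y') xE (bilinDl (@hpure_bilin _ _ _ W M)) raddfD.
  rewrite [X in X + _](_ : _ = 0) ?add0r //.
  by apply/cP; exists (hpure x m); rewrite /= hmapl_pure.
pose F (z : ksp U) (m : ksp M) : ksp C := c (hpure (s z) m).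
have lc a (x y : ksp (hten W M)) : c (a *: x + y) = a *: (c x : ksp C) + c y.
  exact: (@restr_map_is_linear _ _ (kunit A) _ _ c).
have lp a (x y : ksp W) : p (a *: x + y) = a *: (p x : ksp U) + p y.
  exact: (@restr_map_is_linear _ _ (kunit H) _ _ p).
have bF : bilin F.
  split=> [m|z] a x y; rewrite /F /=; last first.
    by rewrite -lc; congr (c _); exact: ((hpure_bilin W M).2 (s z) a x y).
  rewrite -lc; transitivity (c (hpure (a *: (s x : ksp W) + s y) m)).
    by apply: cE; rewrite sK lp !sK.
  by congr (c _); exact: ((hpure_bilin W M).1 m a (s x) (s y)).
have E : tlift F (hmapl M p t) = c t.
  apply: (@hten_additive_eq _ _ _ _ _ _ (fun t => tlift F (hmapl M p t)) c) t.
  - by move=> x y; rewrite raddfD tliftD.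
  - by move=> x y; rewrite raddfD.
  - by move=> y m; rewrite hmapl_pure tlift_pure //; apply: cE; rewrite sK.
by move=> t0; apply/cP; rewrite -E t0; exact: linf0 (tlift_is_linear bF).
Qed.
End Functoriality.

(** * The inclusion of X in H (x) X, its quotient TX, and the counit *)

Section RelativelyFree.
Variables (k : fieldType) (H : fdHopf k) (A : comodAlg H).
Implicit Types (V W : lmodType H) (M N X Y Q : lmodType A).

Lemma linear_restr (M N : lmodType A) (f : {linear M -> N}) : @linear_for k (ksp M) (ksp N) *:%R f.
Proof. exact: (@restr_map_is_linear _ _ (kunit A) _ _ f). Qed.

Lemma trivA (h : H) (x : trivmod H) : h *: x = (eps H h * (x : k) : k).
Proof. reflexivity. Qed.
Lemma kspE (V : lmodType H) (c : k) (x : V) : c *: (x : ksp V) = (kunit H c *: x : V).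
Proof. reflexivity. Qed.
Lemma trivZ (c : k) (x : ksp (trivmod H)) : c *: x = (c * (x : k) : k).
Proof. rewrite [LHS]kspE. rewrite [LHS]trivA. rewrite eps_kunit. by []. Qed.
Lemma hpureBl V M (v w : ksp V) (m : ksp M) :
  hpure (v - w) m = (hpure v m - hpure w m : ksp (hten V M)).
Proof. by rewrite -scaleN1r addrC (hpure_bilin V M).1 scaleN1r addrC. Qed.
Fact trivmod_id_linear : @linear_for k (ksp (trivmod H)) k^o *:%R id.
Proof. by move=> c x y; rewrite /= trivZ. Qed.
Lemma hpureZl V M (c : k) (v : ksp V) (m : ksp M) :
  hpure (c *: v) m = (c *: (hpure v m : ksp (hten V M)) : ksp (hten V M)).
Proof. exact: (linfZ ((@hpure_bilin k H A V M).1 m) c v). Qed.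
Lemma hpureZr V M (c : k) (v : ksp V) (m : ksp M) :
  hpure v (c *: m) = (c *: (hpure v m : ksp (hten V M)) : ksp (hten V M)).
Proof. exact: (linfZ ((@hpure_bilin k H A V M).2 v) c m). Qed.
Definition hunit M : {linear hten (trivmod H) M -> M} :=
  @hform k H A M (trivmod H) (mklin trivmod_id_linear) (fun h v => erefl).

Definition tone : trivmod H := (1 : k).
Fact hunitV_linear M : linear (fun m : M => hpure tone m : hten (trivmod H) M).
Proof.
move=> a x y; rewrite (bilinDr (@hpure_bilin _ _ _ (trivmod H) M)); congr (_ + _).
rewrite hpureE -(@cm_counitE _ _ _ _ (fun y : uvs A => hpure tone ((y : A) *: x) : ksp (hten (trivmod H) M))); last by hlin.
apply: tlift_eq => h b; rewrite -hpureZl; congr hpure.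
by rewrite trivZ trivA.
Qed.
Definition hunitV M : {linear M -> hten (trivmod H) M} := locked (mklin (@hunitV_linear M)).
Lemma hunitVE M m : hunitV M m = hpure tone m.
Proof. by rewrite /hunitV -lock. Qed.

Lemma hunit_pure M (v : trivmod H) m : hunit M (hpure v m) = ((v : k) *: (m : ksp M) : M).
Proof. exact: hform_pure. Qed.

Lemma hunitVK M : cancel (hunitV M) (hunit M).
Proof. by move=> m; rewrite hunitVE hunit_pure; exact: (scale1r (m : ksp M)). Qed.
Lemma hunitK M : cancel (hunit M) (hunitV M).
Proof.
apply: (@hten_linear_eq _ _ _ _ _ _ (hunitV M \o hunit M) idfun) => v m.
rewrite /= hunit_pure hunitVE hpureZr -hpureZl; congr hpure.
by rewrite trivZ [LHS]mulr1.
Qed.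

Fact eps_linear : @linear_for k (ksp H^o) k^o *:%R (fun h : H => eps H h).
Proof. by apply: lin_epsf; hlin. Qed.
Fact eps_balanced (h : H) (v : H^o) : mklin eps_linear (h *: v) = eps H h * mklin eps_linear v.
Proof. exact: rmorphM. Qed.
Definition hcounit M : {linear hten H^o M -> M} := hform M eps_balanced.
Lemma hcounit_pure M (h : H) m : hcounit M (hpure (h : H^o) m) = (eps H h *: (m : ksp M) : M).
Proof. exact: hform_pure. Qed.
Lemma hcounit_nat M N (f : {linear M -> N}) t : f (hcounit M t) = hcounit N (hmap H^o f t).
Proof.
apply: (@hten_linear_eq _ _ _ _ _ _ (f \o hcounit M) (hcounit N \o hmap H^o f)) t => v m.
by rewrite /= hmap_pure !hcounit_pure (linfZ (linear_restr f)).
Qed.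
Lemma hcounit_surj M m : exists t, hcounit M t = m.
Proof. by exists (hpure ((1 : H) : H^o) m); rewrite hcounit_pure rmorph1 scale1r. Qed.

(** The comultiplication makes H (x) - a comonad; s is a section of the
    counit over any tensor product with H, which gives lifts against maps
    that split after tensoring with H. *)
Lemma hcomult_exists M : exists s : {linear hten H^o M -> hten H^o (hten H^o M)},
  (forall (h : H) m, s (hpure (h : H^o) m) =
     sw x y <- h, (hpure (x : H^o) (hpure (y : H^o) m) : ksp (hten H^o (hten H^o M)))) /\
  forall t, hcounit _ (s t) = t.
Proof.
have [D DE] := hten_comult H.
pose s := hassoc H^o H^o M \o hmapl M D.
have sE (h : H) m : s (hpure (h : H^o) m) =
     sw x y <- h, (hpure (x : H^o) (hpure (y : H^o) m) : ksp (hten H^o (hten H^o M))).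
  rewrite /s /= hmapl_pure DE.
  rewrite (linear_tlift (L := fun e : ksp (hten H^o H^o) => hassoc H^o H^o M (hpure (e : hten H^o H^o) m) : ksp (hten H^o (hten H^o M)))).
    by apply: tlift_eq => x y; exact: hassoc_pure.
  apply: (linear_compose (@linear_restr _ _ (hassoc H^o H^o M))).
  exact: (hpure_bilin (hten H^o H^o) M).1.
exists s; split=> // t.
apply: (@hten_linear_eq _ _ _ _ _ _ (hcounit _ \o s) idfun) t => h m.
rewrite [LHS](congr1 (hcounit _) (sE h m)).
rewrite (linear_tlift (L := hcounit (hten H^o M) : ksp (hten H^o (hten H^o M)) -> ksp (hten H^o M))); last exact: linear_restr.
rewrite -[RHS](@counitlE _ _ _ (fun e : uvs H => hpure (e : H^o) m : ksp (hten H^o M))); last by hlin.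
by apply: tlift_eq => x y; rewrite hcounit_pure.
Qed.

Variable L : lintegral H.
Notation xi := (lamid L).
Notation qu := (Tquo L).

Lemma hmap_lamid M N (f : {linear M -> N}) m : hmap H^o f (xi m) = xi (f m).
Proof. exact: hmap_pure. Qed.

Lemma Tquo_nat M N (f : {linear M -> N}) t : hmap (HmodL L) f (qu M t) = qu N (hmap H^o f t).
Proof. exact: hmap_hmapl. Qed.

Lemma Lclass_surj y : exists h, @Lclass k H L h = y.
Proof. by exists (Lrepr y); exact: LreprK. Qed.

Lemma Lclass_ker (h : H^o) : Lclass L h = 0 -> exists c, h = kunit H c * intg L.
Proof. by move=> /LclassP[c]; rewrite subr0 => ->; exists c. Qed.

Lemma Tquo_surj M t : exists s, qu M s = t.
Proof. by apply: hmapl_surj; exact: Lclass_surj. Qed.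

Lemma Tquo_pure M h m : qu M (hpure h m) = hpure (Lclass L h) m.
Proof. exact: hmapl_pure. Qed.

Lemma Tquo_lamid M m : qu M (xi m) = 0.
Proof.
rewrite /lamid Tquo_pure (_ : Lclass L _ = 0).
  exact: (bilin0l (hpure_bilin (HmodL L) M)).
by apply/LclassP; exists 1; rewrite rmorph1 mul1r subr0.
Qed.

(** The Frobenius form takes the value 1 on the integral, hence gives a
    k-linear retraction of m |-> Lam (x) m and splits H -> H / k Lam. *)
Lemma lamid_split M : exists ret : hten H^o M -> M,
  (forall m, ret (xi m) = m) /\
  (forall t, qu M t = 0 -> t = xi (ret t)).
Proof.
have [lam [_ lam1]] := frobenius_form L.
have bret : @bilin k (ksp H^o) (ksp M) (ksp M) (fun h m => (lam h : k) *: (m : ksp M)).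
  by hlin.
pose ret (t : hten H^o M) : M := @tlift k (ksp H^o) (ksp M) (ksp M) (fun h m => (lam h : k) *: (m : ksp M)) t.
have retD x y : ret (x + y) = ret x + ret y by exact: (tliftD bret).
have retE h m : ret (hpure h m) = (lam h *: (m : ksp M) : M) by exact: (tlift_pure bret).
have xiD x y : xi (x + y) = xi x + xi y :> hten H^o M by exact: raddfD.
pose nu : ksp H^o -> ksp H^o := fun h => h - (lam h : k) *: (intg L : ksp H^o).
have lnu : linear nu.
  move=> a x y; rewrite /nu linearP scalerDl scalerBr -scalerA opprD.
  by rewrite addrACA.
have nu0 (y : ksp H^o) : Lclass L y = 0 -> nu y = 0.
  move=> /Lclass_ker[c ->]; rewrite /nu -[kunit H c * _]/(c *: (intg L : ksp H^o)).
  by rewrite [lam _]linearZ_LR lam1 [_%:A]mulr1 subrr.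
have [nu' nu'E] := @factor_surj k (ksp H^o) (ksp (HmodL L)) (ksp H^o)
   (@restr_map _ _ (kunit H) _ _ (@Lclass k H L)) (mklin lnu) Lclass_surj nu0.
have bu : @bilin k (ksp (HmodL L)) (ksp M) (ksp (hten H^o M)) (fun c m => hpure (nu' c : H^o) m).
  by hlin.
exists ret; split=> [m|t qt].
  by rewrite /lamid retE lam1 scale1r.
have E : @tlift k (ksp (HmodL L)) (ksp M) (ksp (hten H^o M)) (fun c m => hpure (nu' c : H^o) m) (qu M t)
   = t - xi (ret t).
  apply: (@hten_additive_eq _ _ _ _ _ _ (fun t => @tlift k (ksp (HmodL L)) (ksp M) (ksp (hten H^o M)) (fun c m => hpure (nu' c : H^o) m) (qu M t)) (fun t => t - xi (ret t))) => [x y|x y|h m].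
  - by rewrite raddfD; exact: (tliftD bu).
  - by rewrite retD xiD opprD addrACA.
  - rewrite Tquo_pure [LHS](tlift_pure bu) [nu' _]nu'E /= /nu retE /lamid hpureZr -hpureZl.
    exact: hpureBl.
apply/eqP; rewrite -subr_eq0 -E qt; apply/eqP.
exact: linf0 (tlift_is_linear bu).
Qed.

Lemma lamid_inj M : injective (lamid L (M := M)).
Proof. by have [ret [retK _]] := lamid_split M => x y e; rewrite -(retK x) e retK. Qed.

Lemma Tquo_ker M t : qu M t = 0 -> exists m, t = xi m.
Proof. by have [ret [_ r]] := lamid_split M => /r e; exists (ret t). Qed.
End RelativelyFree.

(** * Relatively injective modules *)

Section RelativeInjectives.
Variables (k : fieldType) (H : fdHopf k) (A : comodAlg H) (L : lintegral H).
Implicit Types (V W : lmodType H) (M N X Y Q : lmodType A).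
Notation xi := (lamid L).
Notation qu := (Tquo L).

Lemma hten_linear_eq3 V W M N (f g : {linear hten V (hten W M) -> N}) :
  (forall v w m, f (hpure v (hpure w m)) = g (hpure v (hpure w m))) -> f =1 g.
Proof.
move=> e; apply: hten_linear_eq => v; elim/hten_ind => [w m|x y IHx IHy] //.
by rewrite (bilinDr (hpure_bilin V (hten W M))) !linearD IHx IHy.
Qed.

Lemma hten_linear_eq3l V W M N (f g : {linear hten (hten V W) M -> N}) :
  (forall v w m, f (hpure (hpure v w) m) = g (hpure (hpure v w) m)) -> f =1 g.
Proof.
move=> e; apply: hten_linear_eq; elim/hten_ind => [v w|x y IHx IHy] m //.
by rewrite (bilinDl (hpure_bilin (hten V W) M)) !linearD IHx IHy.
Qed.

Lemma hassoc_nat V W X Y (f : {linear X -> Y}) t :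
  hassoc V W Y (hmap (hten V W) f t) = hmap V (hmap W f) (hassoc V W X t).
Proof.
refine (@hten_linear_eq3l _ _ _ _ (hassoc V W Y \o hmap (hten V W) f) (hmap V (hmap W f) \o hassoc V W X) _ t) => {t} v w m.
by rewrite /= hmap_pure !hassoc_pure hmap_pure /= hmap_pure.
Qed.
Lemma hassocV_nat V W X Y (f : {linear X -> Y}) t :
  hassocV V W Y (hmap V (hmap W f) t) = hmap (hten V W) f (hassocV V W X t).
Proof.
refine (@hten_linear_eq3 _ _ _ _ (hassocV V W Y \o hmap V (hmap W f)) (hmap (hten V W) f \o hassocV V W X) _ t) => {t} v w m.
by rewrite /= hmap_pure /= hmap_pure !hassocV_pure hmap_pure.
Qed.

(** Relative injectivity of V (x) H, carried along by Q through the
    associator. *)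
Lemma tensor_free_split V Q :
  exists r : {linear hten H^o (hten V (hten H^o Q)) -> hten V (hten H^o Q)},
    forall t, r (xi t) = t.
Proof.
have [r rE] := hten_right_retraction L V.
exists (hassoc V H^o Q \o hmapl Q r \o hassocV H^o (hten V H^o) Q \o hmap H^o (hassocV V H^o Q)) => t.
refine (@hten_linear_eq3 _ _ _ _ (hassoc V H^o Q \o hmapl Q r \o hassocV H^o (hten V H^o) Q
  \o hmap H^o (hassocV V H^o Q) \o lamid L (M := hten V (hten H^o Q))) idfun _ t) => {t} v h q.
by rewrite /= hmap_lamid /lamid !hassocV_pure hmapl_pure rE hassoc_pure.
Qed.

Lemma free_split Q : exists r : {linear hten H^o (hten H^o Q) -> hten H^o Q},
  forall t, r (xi t) = t.
Proof.
have [r rE] := tensor_free_split (trivmod H) Q.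
exists (hunit _ \o r \o hmap H^o (hunitV (hten H^o Q))) => t.
by rewrite /= hmap_lamid rE hunitVK.
Qed.

(** As xi splits on H (x) Q, every map M -> H (x) Q extends along xi : M ->
    H (x) M. *)
Lemma null_homotopicP M N (f : {linear M -> N}) :
  null_homotopic f <-> exists h : {linear hten H^o M -> N}, forall x, f x = h (xi x).
Proof.
split=> [[Q [g [h fE]]]|[h fE]]; last by exists M, (lamid L (M := M)), h.
have [r rE] := free_split Q.
exists (h \o r \o hmap H^o g) => x.
by rewrite /= hmap_lamid rE fE.
Qed.

(** The flip of V and H is not H-linear unless H is cocommutative; xi
    followed by the left retraction is a substitute that agrees with it on V
    (x) Lam. *)
Lemma hchi_exists V : exists chi : {linear hten V H^o -> hten H^o V},
  forall v, chi (hpure v (intg L : H^o)) = hpure (intg L : H^o) v.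
Proof.
have [r rE] := hten_left_retraction L V.
by exists (r \o lamid L (M := hten V H^o)) => v; exact: rE.
Qed.

(** The interchange that makes V (x) - commute with H (x) - up to a natural
    map, which need not be invertible. *)
Definition hswap V X : {linear hten V (hten H^o X) -> hten H^o (hten V X)} :=
  hassoc H^o V X \o hmapl X (projT1 (cid (hchi_exists V))) \o hassocV V H^o X.

Lemma hswap_lamid V X t : hswap V X (hmap V (lamid L (M := X)) t) = xi t.
Proof.
refine (@hten_linear_eq _ _ _ _ _ _ (hswap V X \o hmap V (lamid L (M := X))) (lamid L (M := hten V X)) _ t) => {t} v x.
rewrite /= hmap_pure [in LHS]/lamid hassocV_pure hmapl_pure (projT2 (cid (hchi_exists V))).
by rewrite hassoc_pure.
Qed.

Lemma hswap_nat V X Y (f : {linear X -> Y}) t :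
  hswap V Y (hmap V (hmap H^o f) t) = hmap H^o (hmap V f) (hswap V X t).
Proof.
by rewrite /hswap /= hassocV_nat -hmap_hmapl hassoc_nat.
Qed.

(** The map HY -> TY splits after tensoring with H, since its kernel xi
    does; the section s of the counit then transports the lift back to H (x)
    Q. *)
Lemma free_lift Q Y (phi : {linear hten H^o Q -> Tmod L Y}) :
  exists psi : {linear hten H^o Q -> hten H^o Y}, forall t, qu Y (psi t) = phi t.
Proof.
have [r rE] : exists r : {linear hten H^o (hten H^o Y) -> hten H^o Y},
    forall t, r (hmap H^o (lamid L (M := Y)) t) = t.
  have [r rE] := hten_left_retraction L (trivmod H).
  exists (hmap H^o (hunit Y) \o hassoc H^o (trivmod H) Y \o hmapl Y r \o hassocV H^o (hten (trivmod H) H^o) Y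
    \o hmap H^o (hassocV (trivmod H) H^o Y) \o hmap H^o (hunitV (hten H^o Y))) => t.
  refine (@hten_linear_eq _ _ _ _ _ _ (hmap H^o (hunit Y) \o hassoc H^o (trivmod H) Y \o hmapl Y r \o hassocV H^o (hten (trivmod H) H^o) Y
    \o hmap H^o (hassocV (trivmod H) H^o Y) \o hmap H^o (hunitV (hten H^o Y)) \o hmap H^o (lamid L (M := Y))) idfun _ t) => {t} h y.
  rewrite /= !hmap_pure hunitVE /lamid !hassocV_pure hmapl_pure rE hassoc_pure hmap_pure.
  by rewrite -hunitVE hunitVK.
have [s [_ sE]] := hcomult_exists Q.
pose E : {linear hten H^o (hten H^o Y) -> hten H^o (hten H^o Y)} :=
  idfun \- (hmap H^o (lamid L (M := Y)) \o r).
have [sg sgE] : exists sg : {linear hten H^o (Tmod L Y) -> hten H^o (hten H^o Y)},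
    forall t, sg (hmap H^o (qu Y) t) = E t.
  apply: factor_surj; first exact: hmap_surj (@Tquo_surj _ _ _ _ _).
  move=> t /(hmap_exact (i := lamid L (M := Y)) (@Tquo_surj _ _ _ _ _) (@Tquo_ker _ _ _ _ _))[u ->].
  by rewrite /E /= rE subrr.
have qsg t : hmap H^o (qu Y) (sg t) = t.
  have [u <-] := hmap_surj (V := H^o) (@Tquo_surj _ _ _ L Y) t.
  rewrite sgE /E /= raddfB -[X in _ - X]/(hmap H^o (qu Y) _).
  rewrite -(@hmap_comp _ _ _ _ _ _ _ (qu Y) (lamid L (M := Y)) \0); last first.
    by move=> x; rewrite /= Tquo_lamid.
  rewrite [X in _ - X](_ : _ = 0) ?subr0 //.
  apply: (@hten_linear_eq _ _ _ _ _ _ (hmap H^o \0) \0) => h x.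
  by rewrite /= hmap_pure; exact: (bilin0r (hpure_bilin _ _)).
exists (hcounit _ \o sg \o hmap H^o phi \o s) => t.
by rewrite [LHS]hcounit_nat /= qsg -hcounit_nat sE.
Qed.

(** Here K is the kernel of eps : HY -> Y. The two maps eps_HY and H (x)
    eps_Y agree after eps_Y, so their difference D takes values in K, and
    psi(z) = Lam_1 (x) D(Lam_2 (x) z) extends the inclusion of K in H (x) K.
    Hence Y is the suspension of K. *)
Lemma syzygy_exists Y : exists (K : lmodType A) (i : {linear K -> hten H^o Y})
    (psi : {linear hten H^o Y -> hten H^o K}),
  [/\ injective i, forall t, hcounit Y t = 0 <-> exists x, t = i x
    & forall x, psi (i x) = xi x].
Proof.
have [K [i [inji iP]]] := kernel_exists (hcounit Y).
pose D : {linear hten H^o (hten H^o Y) -> hten H^o Y} :=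
  hcounit (hten H^o Y) \- hmap H^o (hcounit Y).
have DK t : exists x, D t = i x.
  apply/iP; rewrite /D /= raddfB; apply/eqP; rewrite subr_eq0; apply/eqP.
  exact: hcounit_nat.
have [d dE] := factor_inj inji DK.
have [s [sE _]] := hcomult_exists (hten H^o Y).
exists K, i, (hmap H^o d \o s \o lamid L (M := hten H^o Y)); split=> // x.
rewrite /= /lamid sE.
rewrite (linear_tlift (L := hmap H^o d : ksp (hten H^o _) -> ksp (hten H^o K))); last exact: linear_restr.
rewrite -[RHS](@counitrE _ _ _ (fun e : uvs H => hpure (e : H^o) x : ksp (hten H^o K))); last by hlin.
apply: tlift_eq => h1 h2; rewrite hmap_pure -hpureZr; congr hpure.
apply: inji; rewrite dE /D /= hcounit_pure hmap_pure.
have -> : hcounit Y (i x) = 0 by apply/iP; exists x.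
rewrite (bilin0r (hpure_bilin _ _)) subr0.
by rewrite (linfZ (linear_restr i)).
Qed.
End RelativeInjectives.

(** * Additive categories with setoids of morphisms *)

Local Open Scope hom_scope.

#[local] Hint Extern 0 (eqh _ _) => reflexivity : core.

Definition is_zero (C : precat) (X : C) : Prop := idm X === zerom.

Existing Class additive_category.

Section Additive.
Context {C : precat} {Ca : additive_category C}.

#[global] Instance eqh_equiv X Y : Equivalence (@eqh C X Y).
Proof.
split; [exact: (ac_refl Ca)|exact: (ac_sym Ca)|exact: (ac_trans Ca)].
Qed.
#[global] Instance comp_proper X Y Z :
  Proper (@eqh C Y Z ==> @eqh C X Y ==> @eqh C X Z) (@comp C X Y Z).
Proof. by move=> g g' eg f f' ef; exact: (ac_comp Ca). Qed.
#[global] Instance addm_proper X Y :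
  Proper (@eqh C X Y ==> @eqh C X Y ==> @eqh C X Y) (@addm C X Y).
Proof. by move=> g g' eg f f' ef; exact: (ac_add Ca). Qed.
#[global] Instance oppm_proper X Y :
  Proper (@eqh C X Y ==> @eqh C X Y) (@oppm C X Y).
Proof. by move=> g g' eg; exact: (ac_opp Ca). Qed.

Lemma addm0 (X Y : C) (f : Hom X Y) : addm f zerom === f.
Proof. by rewrite (ac_addC Ca) (ac_add0 Ca). Qed.
Lemma addmN (X Y : C) (f : Hom X Y) : addm f (oppm f) === zerom.
Proof. by rewrite (ac_addC Ca) (ac_addN Ca). Qed.
Lemma addm_cancel (X Y : C) (f g h : Hom X Y) : addm f g === addm f h -> g === h.
Proof.
move=> e; rewrite -(ac_add0 Ca g) -(ac_addN Ca f) -(ac_addA Ca) e.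
by rewrite (ac_addA Ca) (ac_addN Ca) (ac_add0 Ca).
Qed.
Lemma comp0m (X Y Z : C) (f : Hom X Y) : (zerom : Hom Y Z) \oc f === zerom.
Proof.
apply: (addm_cancel (f := zerom \oc f)).
by rewrite -(ac_compDl Ca) (ac_add0 Ca) addm0.
Qed.
Lemma compm0 (X Y Z : C) (g : Hom Y Z) : g \oc (zerom : Hom X Y) === zerom.
Proof.
apply: (addm_cancel (f := g \oc zerom)).
by rewrite -(ac_compDr Ca) (ac_add0 Ca) addm0.
Qed.
Lemma compNm (X Y Z : C) (g : Hom Y Z) (f : Hom X Y) : oppm g \oc f === oppm (g \oc f).
Proof.
apply: (addm_cancel (f := g \oc f)).
by rewrite -(ac_compDl Ca) !addmN comp0m.
Qed.
Lemma compmN (X Y Z : C) (g : Hom Y Z) (f : Hom X Y) : g \oc oppm f === oppm (g \oc f).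
Proof.
apply: (addm_cancel (f := g \oc f)).
by rewrite -(ac_compDr Ca) !addmN compm0.
Qed.
Lemma addm_swap (X Y : C) (f g h : Hom X Y) : f === addm g h <-> addm f (oppm h) === g.
Proof.
split=> e.
  by rewrite e -(ac_addA Ca) addmN // addm0.
by rewrite -e -(ac_addA Ca) (ac_addN Ca) addm0.
Qed.
Lemma subm_eq0 (X Y : C) (f g : Hom X Y) : addm f (oppm g) === zerom <-> f === g.
Proof. by rewrite -addm_swap (ac_add0 Ca). Qed.
Lemma oppmK (X Y : C) (f : Hom X Y) : oppm (oppm f) === f.
Proof. by apply: (addm_cancel (f := oppm f)); rewrite addmN // (ac_addN Ca). Qed.
Lemma oppm0 (X Y : C) : oppm (zerom : Hom X Y) === zerom.
Proof. by rewrite -[oppm _](ac_add0 Ca) addmN. Qed.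
Lemma oppm_eq0 (X Y : C) (f : Hom X Y) : oppm f === zerom -> f === zerom.
Proof. by move=> e; rewrite -(oppmK f) e oppm0. Qed.

Lemma zero_to (X Y : C) (f : Hom X Y) : is_zero X -> f === zerom.
Proof. by move=> X0; rewrite -(ac_idr Ca f) X0 compm0. Qed.
Lemma zero_from (X Y : C) (f : Hom X Y) : is_zero Y -> f === zerom.
Proof. by move=> X0; rewrite -(ac_idl Ca f) X0 comp0m. Qed.
Lemma zero_exists : exists Z : C, is_zero Z.
Proof. by have [Z ZP] := ac_zero Ca; exists Z; exact: (ZP Z).1. Qed.

(** Composites are normalized to the right; [whisk] applies an equation of
    composites at the head of such a chain. *)
Lemma whisk (X Y Y' Z V : C) (g : Hom Y Z) (f : Hom X Y) (g' : Hom Y' Z) (f' : Hom X Y')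
   (x : Hom V X) : g \oc f === g' \oc f' -> g \oc (f \oc x) === g' \oc (f' \oc x).
Proof. by move=> e; rewrite !(ac_compA _) e. Qed.
Lemma whisk_id (X Y V : C) (g : Hom Y X) (f : Hom X Y)
   (x : Hom V X) : g \oc f === idm X -> g \oc (f \oc x) === x.
Proof. by move=> e; rewrite !(ac_compA _) e (ac_idl _). Qed.

Lemma iso_id (X : C) : is_iso (idm X).
Proof. by exists (idm X); rewrite !(ac_idl Ca). Qed.
Lemma iso_comp (X Y Z : C) (g : Hom Y Z) (f : Hom X Y) : is_iso g -> is_iso f -> is_iso (g \oc f).
Proof.
move=> [g' [g'g gg']] [f' [f'f ff']]; exists (f' \oc g').
rewrite !(ac_compA Ca); split.
  by rewrite -[f' \oc g' \oc g](ac_compA Ca) g'g (ac_idr Ca).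
by rewrite -[g \oc f \oc f'](ac_compA Ca) ff' (ac_idr Ca).
Qed.
Lemma iso_eq (X Y : C) (f g : Hom X Y) : f === g -> is_iso f -> is_iso g.
Proof. by move=> e [f' [f1 f2]]; exists f'; rewrite -e. Qed.
Lemma iso_zero (X Y : C) (f : Hom X Y) : is_iso f -> is_zero X -> is_zero Y.
Proof. by move=> [g [_ fg]] X0; rewrite /is_zero -fg (zero_to f X0) comp0m. Qed.
Lemma iso_mono (X Y W : C) (f : Hom X Y) (g h : Hom W X) : is_iso f -> f \oc g === f \oc h -> g === h.
Proof.
move=> [f' [f'f _]] e.
by rewrite -(ac_idl Ca g) -(ac_idl Ca h) -f'f -!(ac_compA Ca) e.
Qed.
Lemma iso_epi (X Y W : C) (f : Hom X Y) (g h : Hom Y W) : is_iso f -> g \oc f === h \oc f -> g === h.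
Proof.
move=> [f' [_ ff']] e.
by rewrite -(ac_idr Ca g) -(ac_idr Ca h) -ff' !(ac_compA Ca) e.
Qed.
Lemma iso_compl (X Y Z : C) (g : Hom Y Z) (f : Hom X Y) : is_iso g -> is_iso (g \oc f) -> is_iso f.
Proof.
move=> ig [h [hgf gfh]]; exists (h \oc g); split; first by rewrite -(ac_compA Ca).
by apply: (iso_mono ig); rewrite !(ac_compA Ca) gfh (ac_idl Ca) (ac_idr Ca).
Qed.
Lemma iso_compr (X Y Z : C) (g : Hom Y Z) (f : Hom X Y) : is_iso f -> is_iso (g \oc f) -> is_iso g.
Proof.
move=> jf [h [hgf gfh]]; exists (f \oc h); split; last by rewrite (ac_compA Ca).
apply: (iso_epi jf); rewrite -!(ac_compA Ca) hgf.
by rewrite (ac_idl Ca) (ac_idr Ca).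
Qed.
End Additive.

Existing Class additive_functor.
Section AdditiveFunctors.
Context {C D : precat} {Ca : additive_category C} {Da : additive_category D}.
Context {F : prefunctor C D} {Fa : additive_functor F}.

#[global] Instance fmap_proper (X Y : C) : Proper (@eqh C X Y ==> @eqh D (F X) (F Y)) (@fmap C D F X Y).
Proof. by move=> f g e; exact: (af_eq Fa). Qed.

Lemma fmap0 (X Y : C) : fmap F (zerom : Hom X Y) === zerom.
Proof.
apply: (addm_cancel (f := fmap F zerom)).
by rewrite -(af_add Fa) (ac_add0 Ca) addm0.
Qed.
Lemma fmapN (X Y : C) (f : Hom X Y) : fmap F (oppm f) === oppm (fmap F f).
Proof.
apply: (addm_cancel (f := fmap F f)).
by rewrite -(af_add Fa) !addmN // fmap0.
Qed.
Lemma fmap_iso (X Y : C) (f : Hom X Y) : is_iso f -> is_iso (fmap F f).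
Proof.
by move=> [g [gf fg]]; exists (fmap F g); rewrite -!(af_comp Fa) gf fg !(af_id Fa).
Qed.
Lemma fmap_zero (X : C) : is_zero X -> is_zero (F X).
Proof. by rewrite /is_zero => X0; rewrite -(af_id Fa) X0 fmap0. Qed.
End AdditiveFunctors.

(** Transport of morphisms of triangles and of rotations along isomorphisms of
    sextuples, for any candidate shift functor. *)
Section Sextuples.
Context {C : precat} {Ca : additive_category C} {T : prefunctor C C} {Ta : additive_functor T}.

Lemma iso_tri_refl (X Y Z : C) (u u' : Hom X Y) (v v' : Hom Y Z) (w w' : Hom Z (T X)) :
  u === u' -> v === v' -> w === w' -> iso_tri u v w u' v' w'.
Proof.
move=> eu ev ew; exists (idm X), (idm Y), (idm Z).
split; split; try exact: iso_id.
- by rewrite (ac_idl _) (ac_idr _).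
- by rewrite (ac_idl _) (ac_idr _).
- by rewrite (af_id _) (ac_idl _) (ac_idr _).
Qed.

Lemma iso_tri_trans (X Y Z : C) (u : Hom X Y) (v : Hom Y Z) (t : Hom Z (T X))
   (X' Y' Z' : C) (u' : Hom X' Y') (v' : Hom Y' Z') (t' : Hom Z' (T X'))
   (X2 Y2 Z2 : C) (u2 : Hom X2 Y2) (v2 : Hom Y2 Z2) (t2 : Hom Z2 (T X2)) :
  iso_tri u v t u' v' t' -> iso_tri u' v' t' u2 v2 t2 -> iso_tri u v t u2 v2 t2.
Proof.
move=> [a [b [c [[ia ib ic] [e1 e2 e3]]]]] [a' [b' [c' [[ia' ib' ic'] [e1' e2' e3']]]]].
exists (a' \oc a), (b' \oc b), (c' \oc c); split; split; try exact: iso_comp.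
- by rewrite -(ac_compA _) e1 (ac_compA _) e1' -(ac_compA _).
- by rewrite -(ac_compA _) e2 (ac_compA _) e2' -(ac_compA _).
- by rewrite (af_comp _) -(ac_compA _) e3 (ac_compA _) e3' -(ac_compA _).
Qed.

Lemma iso_tri_rotate (X Y Z : C) (u : Hom X Y) (v : Hom Y Z) (t : Hom Z (T X))
   (X' Y' Z' : C) (u' : Hom X' Y') (v' : Hom Y' Z') (t' : Hom Z' (T X')) :
  iso_tri u v t u' v' t' ->
  iso_tri v t (oppm (fmap T u)) v' t' (oppm (fmap T u')).
Proof.
move=> [a [b [c [[ia ib ic] [e1 e2 e3]]]]].
exists b, c, (fmap T a); split; split=> //; first exact: fmap_iso.
by rewrite compmN compNm -!(af_comp _) e1.
Qed.

(** The completion axiom as a property of two sextuples, to be checked on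
    representatives of their isomorphism classes. *)
Definition extends (X Y Z : C) (u : Hom X Y) (v : Hom Y Z) (t : Hom Z (T X))
   (X' Y' Z' : C) (u' : Hom X' Y') (v' : Hom Y' Z') (t' : Hom Z' (T X')) :=
  forall (a : Hom X X') (b : Hom Y Y'), b \oc u === u' \oc a -> exists c : Hom Z Z',
    c \oc v === v' \oc b /\ fmap T a \oc t === t' \oc c.

Lemma extends_transport (X Y Z : C) (u : Hom X Y) (v : Hom Y Z) (t : Hom Z (T X))
   (X' Y' Z' : C) (u' : Hom X' Y') (v' : Hom Y' Z') (t' : Hom Z' (T X'))
   (X0 Y0 Z0 : C) (u0 : Hom X0 Y0) (v0 : Hom Y0 Z0) (t0 : Hom Z0 (T X0))
   (X1 Y1 Z1 : C) (u1 : Hom X1 Y1) (v1 : Hom Y1 Z1) (t1 : Hom Z1 (T X1)) :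
  iso_tri u0 v0 t0 u v t -> iso_tri u1 v1 t1 u' v' t' ->
  extends u0 v0 t0 u1 v1 t1 -> extends u v t u' v' t'.
Proof.
move=> [al [be [ga [[ia ib ic] [e1 e2 e3]]]]].
move=> [al' [be' [ga' [[ia' ib' ic'] [e1' e2' e3']]]]] ext a b e.
have [al'' [k1 k2]] := ia'; have [be'' [k3 k4]] := ib'; have [ga0 [k5 k6]] := ic.
pose a0 := al'' \oc (a \oc al); pose b0 := be'' \oc (b \oc be).
have e0 : b0 \oc u0 === u1 \oc a0.
  apply: (iso_mono ib'); rewrite /b0 /a0 -!(ac_compA _) (whisk_id _ k4) e1 (whisk _ e).
  by rewrite (whisk _ e1') (whisk_id _ k2).
have [c0 [c1 c2]] := ext _ _ e0.
exists (ga' \oc (c0 \oc ga0)); split.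
- apply: (iso_epi ib); rewrite -!(ac_compA _) -e2 (whisk_id _ k5) c1.
  by rewrite (whisk _ e2') /b0 (whisk_id _ k4).
- apply: (iso_epi ic); rewrite -!(ac_compA _) k5 (ac_idr _) -e3.
  rewrite (ac_compA _) -(af_comp _) -(whisk _ e3') -c2 (ac_compA _) -(af_comp _).
  by rewrite /a0 (whisk_id _ k2).
Qed.
End Sextuples.

(** * Triangles *)

(** The axioms of a triangulated category with rotation in one direction
    only and without the octahedral axiom: backward rotation follows from
    them, and the octahedral axiom can then be checked on one representative
    of each composable pair. *)
Record quasi_triangulated (C : pretri) : Prop := QuasiTriangulated {
  qt_additive : additive_category C;
  qt_shift : additive_functor (shift C);
  qt_full : forall (X Y : C) (g : Hom (shift C X) (shift C Y)),
    exists f : Hom X Y, fmap (shift C) f === g;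
  qt_faithful : forall (X Y : C) (f g : Hom X Y),
    fmap (shift C) f === fmap (shift C) g -> f === g;
  qt_esurj : forall Y : C, exists (X : C) (f : Hom (shift C X) Y), is_iso f;
  qt_iso : forall (X Y Z : C) (u : Hom X Y) (v : Hom Y Z) (w : Hom Z (shift C X))
      (X' Y' Z' : C) (u' : Hom X' Y') (v' : Hom Y' Z') (w' : Hom Z' (shift C X')),
    dist u v w -> iso_tri u v w u' v' w' -> dist u' v' w';
  qt_id : forall X Z : C, (forall f : Hom Z Z, f === zerom) ->
    dist (idm X) (zerom : Hom X Z) zerom;
  qt_cone : forall (X Y : C) (u : Hom X Y),
    exists (Z : C) (v : Hom Y Z) (w : Hom Z (shift C X)), dist u v w;
  qt_rotate : forall (X Y Z : C) (u : Hom X Y) (v : Hom Y Z)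
      (w : Hom Z (shift C X)),
    dist u v w -> dist v w (oppm (fmap (shift C) u));
  qt_morph : forall (X Y Z : C) (u : Hom X Y) (v : Hom Y Z) (w : Hom Z (shift C X))
      (X' Y' Z' : C) (u' : Hom X' Y') (v' : Hom Y' Z') (w' : Hom Z' (shift C X'))
      (a : Hom X X') (b : Hom Y Y'),
    dist u v w -> dist u' v' w' -> b \oc u === u' \oc a ->
    exists c : Hom Z Z',
      c \oc v === v' \oc b /\ fmap (shift C) a \oc w === w' \oc c }.

Existing Class quasi_triangulated.
#[global] Existing Instance qt_additive.
#[global] Existing Instance qt_shift.

Section Triangles.
Context {C : pretri} {Ct : quasi_triangulated C}.
Notation T := (shift C).
Let Ca : additive_category C := qt_additive Ct.

Lemma dist_eq (X Y Z : C) (u u' : Hom X Y) (v v' : Hom Y Z) (w w' : Hom Z (T X)) :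
  dist u v w -> u === u' -> v === v' -> w === w' -> dist u' v' w'.
Proof.
move=> d eu ev ew; apply: (qt_iso Ct d); exact: iso_tri_refl.
Qed.

Lemma zero_object (Z : C) : is_zero Z -> forall f : Hom Z Z, f === zerom.
Proof. by move=> Z0 f; exact: zero_to. Qed.

(** Map the triangle of the identity of X to the given one. *)
Lemma dist_comp0 (X Y Z : C) (u : Hom X Y) (v : Hom Y Z) (w : Hom Z (T X)) :
  dist u v w -> v \oc u === zerom.
Proof.
move=> d; have [O O0] := @zero_exists _ Ca.
have [c [cv _]] := qt_morph Ct (a := idm X) (b := u) (qt_id Ct X (zero_object O0)) d (reflexivity _).
by rewrite -cv compm0.
Qed.

Lemma dist_shift_comp0 (X Y Z : C) (u : Hom X Y) (v : Hom Y Z) (w : Hom Z (T X)) :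
  dist u v w -> fmap T u \oc w === zerom.
Proof.
move=> /(qt_rotate Ct)/(qt_rotate Ct)/dist_comp0; rewrite compNm; exact: oppm_eq0.
Qed.

(** Map the rotated triangle of the identity of W to the rotated given one,
    and desuspend. *)
Lemma weak_kernel (X Y Z : C) (u : Hom X Y) (v : Hom Y Z) (w : Hom Z (T X)) :
  dist u v w -> forall (W : C) (f : Hom W Y), v \oc f === zerom ->
  exists g : Hom W X, u \oc g === f.
Proof.
move=> d W f vf; have [O O0] := @zero_exists _ Ca.
have dW := qt_rotate Ct (qt_id Ct W (zero_object O0)).
have e : (zerom : Hom O Z) \oc (zerom : Hom W O) === v \oc f by rewrite vf compm0.
have [c [_ cE]] := qt_morph Ct dW (qt_rotate Ct d) e.
have [g gE] := qt_full Ct c; exists g; apply: (qt_faithful Ct).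
move: cE; rewrite compmN compNm -gE (af_id _) (ac_idr _) -(af_comp _) => cE.
by rewrite -[fmap T f]oppmK cE oppmK.
Qed.

Lemma weak_kernel_rotate (X Y Z : C) (u : Hom X Y) (v : Hom Y Z) (w : Hom Z (T X)) :
  dist u v w -> forall (W : C) (f : Hom W Z), w \oc f === zerom ->
  exists g : Hom W Y, v \oc g === f.
Proof. by move=> /(qt_rotate Ct)/weak_kernel. Qed.

Lemma weak_kernel_rotate2 (X Y Z : C) (u : Hom X Y) (v : Hom Y Z) (w : Hom Z (T X)) :
  dist u v w -> forall (W : C) (f : Hom W (T X)), fmap T u \oc f === zerom ->
  exists g : Hom W Z, w \oc g === f.
Proof.
move=> /(qt_rotate Ct)/(qt_rotate Ct)/weak_kernel wk W f uf; apply: wk.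
by rewrite compNm uf oppm0.
Qed.

(** Exactness of Hom(W, -) makes Hom(W, c) injective for all W and gives a
    right inverse of c. *)
Lemma five_lemma (X Y Z : C) (u : Hom X Y) (v : Hom Y Z) (w : Hom Z (T X))
      (X' Y' Z' : C) (u' : Hom X' Y') (v' : Hom Y' Z') (w' : Hom Z' (T X'))
      (a : Hom X X') (b : Hom Y Y') (c : Hom Z Z') :
  dist u v w -> dist u' v' w' -> b \oc u === u' \oc a -> c \oc v === v' \oc b ->
  fmap T a \oc w === w' \oc c -> is_iso a -> is_iso b -> is_iso c.
Proof.
move=> d d' eu ev ew ia ib.
have inj W (z : Hom W Z) : c \oc z === zerom -> z === zerom.
  move=> cz.
  have wz : w \oc z === zerom.
    apply: (iso_mono (fmap_iso (F := T) ia)).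
    by rewrite (ac_compA _) ew -(ac_compA _) cz !compm0.
  have [y yE] := weak_kernel_rotate d wz.
  have vy : v' \oc (b \oc y) === zerom by rewrite (ac_compA _) -ev -(ac_compA _) yE.
  have [x' x'E] := weak_kernel d' vy.
  have [a' [_ aa']] := ia.
  have uy : u \oc (a' \oc x') === y.
    apply: (iso_mono ib).
    by rewrite (ac_compA _) eu -(ac_compA _) [a \oc (a' \oc x')](ac_compA _) aa' (ac_idl _).
  by rewrite -yE -uy (ac_compA _) (dist_comp0 d) comp0m.
have [Ta' [_ TT]] : is_iso (fmap T a) by exact: fmap_iso.
pose t := Ta' \oc w'.
have ut : fmap T u \oc t === zerom.
  apply: (iso_mono (fmap_iso (F := T) ib)).
  rewrite (ac_compA _) -(af_comp _) eu (af_comp _) -(ac_compA _) [_ \oc t](ac_compA _) TT (ac_idl _).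
  by rewrite (dist_shift_comp0 d') compm0.
have [z zE] := weak_kernel_rotate2 d ut.
have wz : w' \oc (addm (idm Z') (oppm (c \oc z))) === zerom.
  rewrite (ac_compDr _) (ac_idr _) compmN (ac_compA _) -ew -(ac_compA _) zE.
  by rewrite (ac_compA _) TT (ac_idl _) addmN.
have [y' y'E] := weak_kernel_rotate d' wz.
have [b' [_ bb']] := ib.
pose s := addm z (v \oc (b' \oc y')).
have cs : c \oc s === idm Z'.
  rewrite (ac_compDr _) (ac_compA _) ev (ac_compA _) -[v' \oc b \oc b'](ac_compA _) bb' (ac_idr _) y'E.
  by rewrite (ac_addC _) -(ac_addA _) (ac_addN _) addm0.
exists s; split=> //; apply/subm_eq0; apply: inj.
by rewrite (ac_compDr _) compmN (ac_compA _) cs (ac_idl _) (ac_idr _) addmN.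
Qed.

Lemma dist_iso (X Y Z : C) (u : Hom X Y) (v : Hom Y Z) (w : Hom Z (T X))
      (X' Y' Z' : C) (u' : Hom X' Y') (v' : Hom Y' Z') (w' : Hom Z' (T X'))
      (a : Hom X X') (b : Hom Y Y') :
  dist u v w -> dist u' v' w' -> b \oc u === u' \oc a -> is_iso a -> is_iso b ->
  exists c : Hom Z Z', [/\ is_iso c, c \oc v === v' \oc b & fmap T a \oc w === w' \oc c].
Proof.
move=> d d' e ia ib; have [c [cv cw]] := qt_morph Ct d d' e.
by exists c; split=> //; exact: (five_lemma d d' e).
Qed.

(** Rotating three times gives the triangle (-Tu, -Tv, -Tw); an isomorphism
    between two such triangles desuspends. *)
Lemma dist_unrotate (X Y Z : C) (u : Hom X Y) (v : Hom Y Z) (w : Hom Z (T X)) :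
  dist v w (oppm (fmap T u)) -> dist u v w.
Proof.
move=> d; have [Z' [v' [w' d']]] := qt_cone Ct u.
have e : idm (T Y) \oc oppm (fmap T u) === oppm (fmap T u) \oc idm (T X).
  by rewrite (ac_idl _) (ac_idr _).
have [c [ic cv cw]] := dist_iso (qt_rotate Ct (qt_rotate Ct (qt_rotate Ct d')))
   (qt_rotate Ct (qt_rotate Ct d)) e (iso_id _) (iso_id _).
have [g gE] := qt_full Ct c.
have [c' [c'c cc']] := ic; have [g' g'E] := qt_full Ct c'.
have ig : is_iso g.
  by exists g'; split; apply: (qt_faithful Ct); rewrite (af_comp _) (af_id _) gE g'E.
apply: (qt_iso Ct d'); exists (idm X), (idm Y), g; split; split=> //; try exact: iso_id.
- by rewrite (ac_idl _) (ac_idr _).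
- apply: (qt_faithful Ct); move: cv; rewrite !(af_comp _) gE (af_id _) !(ac_idr _) compmN => cv.
  by rewrite -[_ \oc _]oppmK cv oppmK.
- apply: (qt_faithful Ct); move: cw; rewrite !(af_comp _) gE !(af_id _) !(ac_idl _) compNm => cw.
  by rewrite -[fmap T w']oppmK cw oppmK.
Qed.

(** Desuspend the cone of h and rotate backwards. *)
Lemma fiber_exists (X Z : C) (h : Hom X Z) :
  exists (X' : C) (s : Hom X' X) (w : Hom Z (T X')), dist s h w.
Proof.
have [U [a [b d]]] := qt_cone Ct h.
have [X' [i ii]] := qt_esurj Ct U; have [i' [i'i ii']] := ii.
have [s sE] := qt_full Ct (oppm (b \oc i)).
exists X', s, (i' \oc a); apply: dist_unrotate; apply: (qt_iso Ct d).
exists (idm X), (idm Z), i'; split; split; try exact: iso_id.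
- by exists i.
- by rewrite (ac_idl _) (ac_idr _).
- by rewrite (ac_idr _).
- by rewrite (af_id _) (ac_idl _) sE oppmK -(ac_compA _) ii' (ac_idr _).
Qed.

Lemma desuspend_zero (X : C) : is_zero (T X) -> is_zero X.
Proof. by move=> TX0; apply: (qt_faithful Ct); rewrite fmap0 (af_id _). Qed.

Lemma zero_cone_iso (X Y Z : C) (u : Hom X Y) (v : Hom Y Z) (w : Hom Z (T X)) :
  dist u v w -> is_zero Z -> is_iso u.
Proof.
move=> d Z0; have [g gE] := weak_kernel d (zero_from (v \oc idm Y) Z0).
exists g; split=> //; apply: (qt_faithful Ct); rewrite (af_id _); apply/subm_eq0.
have e : fmap T u \oc addm (fmap T (g \oc u)) (oppm (idm (T X))) === zerom.
  rewrite (ac_compDr _) -(af_comp _) (ac_compA _) gE (ac_idl _) compmN (ac_idr _).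
  exact: addmN.
have [z <-] := weak_kernel_rotate2 d e.
by rewrite (zero_from z Z0) compm0.
Qed.

Lemma iso_cone_zero (X Y Z : C) (u : Hom X Y) (v : Hom Y Z) (w : Hom Z (T X)) :
  dist u v w -> is_iso u -> is_zero Z.
Proof.
move=> d iu.
have v0 : v === zerom.
  by apply: (iso_epi iu); rewrite (dist_comp0 d) comp0m.
have w0 : w === zerom.
  by apply: (iso_mono (fmap_iso (F := T) iu)); rewrite (dist_shift_comp0 d) compm0.
have e : w \oc idm Z === zerom by rewrite w0 comp0m.
have [y yE] := weak_kernel_rotate d e.
by rewrite /is_zero -yE v0 comp0m.
Qed.

(** The conclusion of the octahedral axiom for given triangles on u, v and
    their composite. *)
Definition octahedron (X Y Z X' Y' Z' : C) (u : Hom X Y) (v : Hom Y Z)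
      (i : Hom Y Z') (i' : Hom Z' (shift C X))
      (j : Hom Z X') (j' : Hom X' (shift C Y))
      (l : Hom Z Y') (l' : Hom Y' (shift C X)) :=
  exists (f : Hom Z' Y') (g : Hom Y' X'),
      [/\ dist f g (fmap (shift C) i \oc j'),
          f \oc i === l \oc v, l' \oc f === i',
          g \oc l === j & j' \oc g === fmap (shift C) u \oc l'].

(** The octahedral axiom depends only on the isomorphism class of the
    composable pair, and not on the chosen triangles. *)
Lemma octahedron_transport
    (X1 Y1 Z1 X1' Y1' Z1' : C) (u1 : Hom X1 Y1) (v1 : Hom Y1 Z1)
      (i1 : Hom Y1 Z1') (i1' : Hom Z1' (shift C X1))
      (j1 : Hom Z1 X1') (j1' : Hom X1' (shift C Y1))
      (l1 : Hom Z1 Y1') (l1' : Hom Y1' (shift C X1))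
    (X Y Z X' Y' Z' : C) (u : Hom X Y) (v : Hom Y Z)
      (i : Hom Y Z') (i' : Hom Z' (shift C X))
      (j : Hom Z X') (j' : Hom X' (shift C Y))
      (l : Hom Z Y') (l' : Hom Y' (shift C X))
    (a : Hom X1 X) (b : Hom Y1 Y) (c : Hom Z1 Z) :
  dist u1 i1 i1' -> dist v1 j1 j1' -> dist (v1 \oc u1) l1 l1' ->
  dist u i i' -> dist v j j' -> dist (v \oc u) l l' ->
  is_iso a -> is_iso b -> is_iso c -> b \oc u1 === u \oc a -> c \oc v1 === v \oc b ->
  octahedron u1 v1 i1 i1' j1 j1' l1 l1' -> octahedron u v i i' j j' l l'.
Proof.
move=> du1 dv1 dw1 du dv dw ia ib ic ea eb [f1 [g1 [d1 e1 e2 e3 e4]]].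
have ec : c \oc (v1 \oc u1) === v \oc u \oc a.
  by rewrite (ac_compA _) eb -!(ac_compA _) ea.
have [z [iz zi zi']] := dist_iso du1 du ea ia ib.
have [x [ix xj xj']] := dist_iso dv1 dv eb ib ic.
have [y [iy yl yl']] := dist_iso dw1 dw ec ia ic.
have [z' [z'z zz']] := iz; have [y' [y'y yy']] := iy.
exists (y \oc f1 \oc z'), (x \oc g1 \oc y'); split.
- apply: (qt_iso Ct d1); exists z, y, x; split; split=> //.
  + by rewrite -!(ac_compA _) z'z (ac_idr _).
  + by rewrite -!(ac_compA _) y'y (ac_idr _).
  + rewrite (ac_compA _) -(af_comp _) zi (af_comp _) -(ac_compA _) xj'.
    by rewrite (ac_compA _).
- apply: (iso_epi ib); rewrite -!(ac_compA _) -zi [z' \oc _](ac_compA _) z'z (ac_idl _) e1.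
  by rewrite (ac_compA _) yl -eb !(ac_compA _).
- apply: (iso_epi iz); rewrite -!(ac_compA _) z'z (ac_idr _) (ac_compA _) -yl' -(ac_compA _) e2.
  exact: zi'.
- apply: (iso_epi ic); rewrite -!(ac_compA _) -yl [y' \oc _](ac_compA _) y'y (ac_idl _) e3.
  exact: xj.
- apply: (iso_epi iy); rewrite -!(ac_compA _) y'y (ac_idr _) -yl' (ac_compA _) -xj' -(ac_compA _) e4.
  by rewrite !(ac_compA _) -!(af_comp _) ea.
Qed.

(** One octahedron for each isomorphism class of composable pairs suffices,
    by [octahedron_transport]. *)
Lemma quasi_triangulated_triangulated :
  (forall (X Y Z : C) (u : Hom X Y) (v : Hom Y Z),
    exists (X1 Y1 Z1 X1' Y1' Z1' : C) (u1 : Hom X1 Y1) (v1 : Hom Y1 Z1)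
      (i1 : Hom Y1 Z1') (i1' : Hom Z1' (shift C X1))
      (j1 : Hom Z1 X1') (j1' : Hom X1' (shift C Y1))
      (l1 : Hom Z1 Y1') (l1' : Hom Y1' (shift C X1))
      (a : Hom X1 X) (b : Hom Y1 Y) (c : Hom Z1 Z),
    [/\ is_iso a, is_iso b, is_iso c, b \oc u1 === u \oc a & c \oc v1 === v \oc b] /\
    [/\ dist u1 i1 i1', dist v1 j1 j1', dist (v1 \oc u1) l1 l1'
      & octahedron u1 v1 i1 i1' j1 j1' l1 l1']) -> triangulated C.
Proof.
move=> oct; split; try by case: Ct.
  move=> X Y Z u v w; split; [exact: qt_rotate|exact: dist_unrotate].
move=> X Y Z X' Y' Z' u v i i' j j' l l' du dv dw.
have [X1 [Y1 [Z1 [X1' [Y1' [Z1' [u1 [v1 [i1 [i1' [j1 [j1' [l1 [l1' [a [b [c]]]]]]]]]]]]]]]]] := oct _ _ _ u v.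
by move=> [[ia ib ic ea eb] [d1 d2 d3]]; apply: (octahedron_transport d1 d2 d3 du dv dw ia ib ic ea eb).
Qed.
End Triangles.

Lemma triangulated_quasi (C : pretri) : triangulated C -> quasi_triangulated C.
Proof.
case=> *; split=> // X Y Z u v w d; match goal with h : _ |- _ => exact: (iffLR (h _ _ _ _ _ _) d) end.
Qed.

(** * Localization by fractions *)

(** A class of morphisms with a calculus of right fractions, compatible with
    the shift and with triangles; [vc_five] lets denominators be completed
    to denominators of triangles. *)
Record verdier_class (C : pretri) (W : forall X Y : C, Hom X Y -> Prop) : Prop :=
  VerdierClass {
  vc_iso : forall (X Y : C) (f : Hom X Y), is_iso f -> W _ _ f;
  vc_eq : forall (X Y : C) (f g : Hom X Y), f === g -> W _ _ f -> W _ _ g;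
  vc_comp : forall (X Y Z : C) (g : Hom Y Z) (f : Hom X Y), W _ _ g -> W _ _ f -> W _ _ (g \oc f);
  vc_compl : forall (X Y Z : C) (g : Hom Y Z) (f : Hom X Y), W _ _ g -> W _ _ (g \oc f) -> W _ _ f;
  vc_compr : forall (X Y Z : C) (g : Hom Y Z) (f : Hom X Y), W _ _ f -> W _ _ (g \oc f) -> W _ _ g;
  vc_shift : forall (X Y : C) (f : Hom X Y), W _ _ (fmap (shift C) f) <-> W _ _ f;
  vc_ore : forall (X Y Y' : C) (f : Hom X Y) (s : Hom Y' Y), W _ _ s ->
    exists (X' : C) (s' : Hom X' X) (f' : Hom X' Y'), W _ _ s' /\ f \oc s' === s \oc f';
  vc_cancel : forall (X Y Z : C) (s : Hom Y Z) (f g : Hom X Y), W _ _ s ->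
    s \oc f === s \oc g -> exists (X' : C) (t : Hom X' X), W _ _ t /\ f \oc t === g \oc t;
  vc_five : forall (X Y Z : C) (u : Hom X Y) (v : Hom Y Z) (w : Hom Z (shift C X))
      (X' Y' Z' : C) (u' : Hom X' Y') (v' : Hom Y' Z') (w' : Hom Z' (shift C X'))
      (a : Hom X X') (b : Hom Y Y') (c : Hom Z Z'),
    dist u v w -> dist u' v' w' -> b \oc u === u' \oc a -> c \oc v === v' \oc b ->
    fmap (shift C) a \oc w === w' \oc c -> W _ _ a -> W _ _ b -> W _ _ c }.

Section Roofs.
Context {C : pretri} {Ct : quasi_triangulated C}.
Variable W : forall X Y : C, Hom X Y -> Prop.
Hypothesis Wc : verdier_class W.
Notation T := (shift C).
Notation w f := (W f).
Lemma eqh_refl (X Y : C) (f : Hom X Y) : f === f. Proof. by []. Qed.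

#[local] Instance W_proper X Y : Proper (@eqh C X Y ==> iff) (@W X Y).
Proof. by move=> f g e; split; apply: (vc_eq Wc) => //; symmetry. Qed.

Lemma W_id (X : C) : w (idm X). Proof. exact/(vc_iso Wc)/iso_id. Qed.

(** The roof r is the fraction h c^-1. *)
Definition rep (X Y : C) (r : roof W X Y) (V : C) (c : Hom V X) (h : Hom V Y) : Prop :=
  exists Wc : w c, roof_eq r (Roof Wc h).

Lemma common_denominator (X V V' : C) (c : Hom V X) (c' : Hom V' X) : w c -> w c' ->
  exists (P : C) (p : Hom P V) (p' : Hom P V'), [/\ w p, w p' & c \oc p === c' \oc p'].
Proof.
move=> wc wc'; have [P [p [p' [wp e]]]] := vc_ore Wc c wc'.
exists P, p, p'; split=> //; apply: (vc_compl Wc wc').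
by apply: (vc_eq Wc e); exact: (vc_comp Wc).
Qed.

Lemma roof_eq_refl X Y (r : roof W X Y) : roof_eq r r.
Proof.
exists (apex r), (idm _), (idm _); split=> //.
by apply: (vc_comp Wc) (W_id _); exact: rleftW.
Qed.
Lemma roof_eq_sym X Y (r s : roof W X Y) : roof_eq r s -> roof_eq s r.
Proof.
move=> [Z [a [b [wa e e']]]]; exists Z, b, a; split; [|by symmetry|by symmetry].
by apply: (vc_eq Wc e).
Qed.
Lemma roof_eq_trans X Y (r s t : roof W X Y) : roof_eq r s -> roof_eq s t -> roof_eq r t.
Proof.
move=> [Z [a [b [wa e1 e2]]]] [Z' [a' [b' [wb e1' e2']]]].
have wsb : w (rleft s \oc b) by exact: (vc_eq Wc e1).
have [P [p [p' [wp wp' pp']]]] := common_denominator wsb wb.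
rewrite -!(ac_compA _) in pp'.
have [Q [q [wq]]] := vc_cancel Wc (rleftW s) pp'; rewrite -!(ac_compA _) => qq'.
exists Q, (a \oc (p \oc q)), (b' \oc (p' \oc q)); split.
- by rewrite (ac_compA _); apply: (vc_comp Wc) => //; exact: (vc_comp Wc).
- by rewrite (whisk _ e1) qq' (whisk _ e1').
- by rewrite (whisk _ e2) qq' (whisk _ e2').
Qed.

#[global] Instance roof_equiv X Y : Equivalence (@roof_eq C W X Y).
Proof. by split; [exact: roof_eq_refl|exact: roof_eq_sym|exact: roof_eq_trans]. Qed.

Lemma rep_self X Y (r : roof W X Y) : rep r (rleft r) (rright r).
Proof.
exists (rleftW r); exists (apex r), (idm _), (idm _); split=> //.
by apply: (vc_comp Wc) (W_id _); exact: rleftW.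
Qed.
Lemma rep_roof X Y V (c : Hom V X) (h : Hom V Y) (wc : w c) : rep (Roof wc h) c h.
Proof. by exists wc; exact: roof_eq_refl. Qed.
Lemma rep_W X Y (r : roof W X Y) V (c : Hom V X) (h : Hom V Y) : rep r c h -> w c.
Proof. by case. Qed.
Lemma rep_eqr X Y (r s : roof W X Y) V (c : Hom V X) (h : Hom V Y) :
  roof_eq r s -> rep r c h -> rep s c h.
Proof. by move=> e [wc e']; exists wc; rewrite -e. Qed.
Lemma rep_unique X Y (r s : roof W X Y) V (c : Hom V X) (h : Hom V Y) :
  rep r c h -> rep s c h -> roof_eq r s.
Proof.
move=> [wc e] [wc' e']; rewrite e e'.
exists V, (idm _), (idm _); split=> //=.
by apply: (vc_comp Wc) (W_id _).
Qed.
Lemma rep_refine X Y (r : roof W X Y) V (c : Hom V X) (h : Hom V Y) P (p : Hom P V)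
   (c' : Hom P X) (h' : Hom P Y) :
  rep r c h -> w p -> c \oc p === c' -> h \oc p === h' -> rep r c' h'.
Proof.
move=> [wc e] wp ec eh.
have wc' : w c' by apply: (vc_eq Wc ec); exact: (vc_comp Wc).
exists wc'; rewrite e; exists P, p, (idm P); split=> /=.
- exact: (vc_comp Wc).
- by rewrite ec (ac_idr _).
- by rewrite eh (ac_idr _).
Qed.
Lemma rep_refl_eq X Y (r : roof W X Y) V (c c' : Hom V X) (h h' : Hom V Y) :
  rep r c h -> c === c' -> h === h' -> rep r c' h'.
Proof.
by move=> rp ec eh; apply: (rep_refine rp (W_id _)); rewrite (ac_idr _).
Qed.
Lemma rep_compare X Y (r : roof W X Y) V (c : Hom V X) (h : Hom V Y) V' (c' : Hom V' X) (h' : Hom V' Y) :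
  rep r c h -> rep r c' h' -> exists (P : C) (p : Hom P V) (p' : Hom P V'),
  [/\ w p, w p', c \oc p === c' \oc p' & h \oc p === h' \oc p'].
Proof.
move=> [wc e] [wc' e'].
have [P [p [p' [/= w1 e1 e2]]]] : roof_eq (Roof wc h) (Roof wc' h') by rewrite -e.
exists P, p, p'; split=> //; first exact: (vc_compl Wc wc w1).
by apply: (vc_compl Wc wc'); exact: (vc_eq Wc e1).
Qed.

Lemma rep_common X Y Y' (r : roof W X Y) (r' : roof W X Y') :
  exists (V : C) (c : Hom V X) (h : Hom V Y) (h' : Hom V Y'), rep r c h /\ rep r' c h'.
Proof.
have [P [p [p' [wp wp' e]]]] := common_denominator (rleftW r) (rleftW r').
exists P, (rleft r \oc p), (rright r \oc p), (rright r' \oc p'); split.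
  exact: (rep_refine (rep_self r) wp).
by apply: (rep_refine (rep_self r') wp') => //; symmetry.
Qed.

(** A composite can be computed from any representatives and any completion
    of the Ore square; this is well-definedness of composition. The given
    square and the one in r are refined to a common one. *)
Lemma rep_comp X Y Z (g : roof W Y Z) (f : roof W X Y) (r : roof W X Z)
    V (c : Hom V X) (d : Hom V Y) U (t : Hom U Y) (e : Hom U Z)
    P (p : Hom P V) (p' : Hom P U) (c' : Hom P X) (e' : Hom P Z) :
  roof_comp g f r -> rep f c d -> rep g t e -> w p -> d \oc p === t \oc p' ->
  c \oc p === c' -> e \oc p' === e' -> rep r c' e'.
Proof.
move=> [V0 [a [b [wa [wfa [e0 er]]]]]] rf rg wp dp ec ee.
have wc := rep_W rf; have wt := rep_W rg.
have [Z1 [al [be [wal wbe e1 e2]]]] := rep_compare (rep_self f) rf.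
have [Z2 [ga [de [wga wde e3 e4]]]] := rep_compare (rep_self g) rg.
(* a common refinement of V0, Z1 and P over X *)
have [R0 [x0 [x1 [wx0 wx1 ex]]]] := common_denominator wa wal.
have wcbe : w (be \oc x1) by exact: (vc_comp Wc).
have [R1 [y0 [y1 [wy0 wy1 ey]]]] := common_denominator wcbe wp.
(* a refinement of R1 through Z2 *)
have wtde : w (rleft g \oc ga) by apply: (vc_comp Wc) => //; exact: rleftW.
have [R2 [z0 [z1 [wz0 ez]]]] := vc_ore Wc (rleft g \oc b \oc x0 \oc y0) wtde.
have E1 : rleft g \oc (b \oc (x0 \oc (y0 \oc z0))) === rleft g \oc (ga \oc z1).
  by move: ez; rewrite -!(ac_compA _).
have [R3 [z2 [wz2]]] := vc_cancel Wc (rleftW g) E1; rewrite -!(ac_compA _) => E2.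
have E3 : t \oc (p' \oc (y1 \oc (z0 \oc z2))) === t \oc (de \oc (z1 \oc z2)).
  rewrite -(whisk _ dp) -!(whisk _ ey) -!(ac_compA _) -(whisk _ e2) -(whisk _ ex) (whisk _ e0) E2.
  by rewrite (whisk _ e3).
have [R4 [z3 [wz3]]] := vc_cancel Wc wt E3; rewrite -!(ac_compA _) => E4.
have E5 : b \oc (x0 \oc (y0 \oc (z0 \oc (z2 \oc z3)))) === ga \oc (z1 \oc (z2 \oc z3)).
  by move: E2; rewrite !(ac_compA _) => ->.
pose z := z0 \oc (z2 \oc z3).
have wz : w z by apply: (vc_comp Wc) => //; exact: (vc_comp Wc).
have r1 : rep r (rleft f \oc a) (rright g \oc b) by exists wfa.
have r2 : rep r (c' \oc (y1 \oc z)) (e' \oc (y1 \oc z)).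
  apply: (rep_refine r1 (p := x0 \oc (y0 \oc z))).
  - by apply: (vc_comp Wc) => //; exact: (vc_comp Wc).
  - rewrite -ec -!(ac_compA _) -(whisk _ ey) -!(ac_compA _) -(whisk _ e1).
    by rewrite (whisk _ ex).
  - rewrite -ee -!(ac_compA _) /z E4 -(whisk _ e4).
    by rewrite E5.
have wP : w (y1 \oc z) by exact: (vc_comp Wc).
have wc' : w c' by apply: (vc_eq Wc ec); exact: (vc_comp Wc).
have r3 : rep (Roof wc' e') (c' \oc (y1 \oc z)) (e' \oc (y1 \oc z)).
  by apply: (rep_refine (rep_roof e' wc') wP).
exists wc'; exact: (rep_unique r2 r3).
Qed.

Lemma roof_comp_exists X Y Z (g : roof W Y Z) (f : roof W X Y) : exists r, roof_comp g f r.
Proof.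
have [V [a [b [wa e]]]] := vc_ore Wc (rright f) (rleftW g).
have wfa : w (rleft f \oc a) by apply: (vc_comp Wc) wa; exact: rleftW.
by exists (Roof wfa (rright g \oc b)), V, a, b, wa, wfa; split=> //; exact: roof_eq_refl.
Qed.

Lemma roof_add_exists X Y (f g : roof W X Y) : exists r, roof_add f g r.
Proof.
have [V [c [d [e [[wc rf] [wc' rg]]]]]] := rep_common f g.
exists (Roof wc (addm d e)), V, c, wc, d, e; split; [exact: rf| |exact: roof_eq_refl].
by apply: (rep_unique (V := V) (c := c) (h := e)); [exists wc'|exact: rep_roof].
Qed.

Definition wmap_functor (F : prefunctor C C) := forall X Y (f : Hom X Y), w f -> w (fmap F f).

Definition roof_image (F : prefunctor C C) (WF : wmap_functor F) X Y (r : roof W X Y) :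
  roof W (F X) (F Y) := Roof (WF _ _ _ (rleftW r)) (fmap F (rright r)).

Lemma roof_image_induced (F : prefunctor C C) (WF : wmap_functor F) :
  roof_induced (roof_image WF).
Proof. by move=> X Y r; exists (WF _ _ _ (rleftW r)); exact: roof_eq_refl. Qed.

Lemma wmap_shift : wmap_functor T.
Proof. by move=> X Y f; rewrite (vc_shift Wc). Qed.

Lemma fractions_inhabited : inhabited (fractions W).
Proof.
split; apply: (@FracOps C W
  (fun X Y Z g f => projT1 (cid (roof_comp_exists g f)))
  (fun X Y Z g f => projT2 (cid (roof_comp_exists g f)))
  (fun X Y f g => projT1 (cid (roof_add_exists f g)))
  (fun X Y f g => projT2 (cid (roof_add_exists f g)))
  (roof_image wmap_shift) (roof_image_induced wmap_shift)).
Qed.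

Lemma rep_add X Y (f g r : roof W X Y) V (c : Hom V X) (d e : Hom V Y) :
  roof_add f g r -> rep f c d -> rep g c e -> rep r c (addm d e).
Proof.
move=> [V0 [s [ws [d0 [e0 [fE gE rE]]]]]] rf rg.
have wc := rep_W rf.
have rf0 : rep f s d0 by exists ws.
have rg0 : rep g s e0 by exists ws.
have [P [p [p' [wp wp' e1 e2]]]] := rep_compare rf0 rf.
have [Q [q [q' [wq wq' e3 e4]]]] := rep_compare rg0 rg.
have [R [x [y [wx wy e5]]]] := common_denominator (vc_comp Wc ws wp) (vc_comp Wc ws wq).
rewrite -!(ac_compA _) in e5.
have [R1 [z [wz]]] := vc_cancel Wc ws e5; rewrite -!(ac_compA _) => e6.
have e7 : c \oc (p' \oc (x \oc z)) === c \oc (q' \oc (y \oc z)).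
  by rewrite -(whisk _ e1) -(whisk _ e3) e6.
have [R2 [t [wt]]] := vc_cancel Wc wc e7; rewrite -!(ac_compA _) => e8.
have e9 : p \oc (x \oc (z \oc t)) === q \oc (y \oc (z \oc t)).
  by move: e6; rewrite !(ac_compA _) => ->.
have wxzt : w (x \oc (z \oc t)) by apply: (vc_comp Wc) => //; exact: (vc_comp Wc).
have rr : rep r (s \oc (p \oc (x \oc (z \oc t)))) ((addm d0 e0) \oc (p \oc (x \oc (z \oc t)))).
  apply: (rep_refine (c := s) (h := addm d0 e0) (p := p \oc (x \oc (z \oc t)))) => //.
    by exists ws.
  exact: (vc_comp Wc).
have wP : w (p' \oc (x \oc (z \oc t))) by exact: (vc_comp Wc).
exists wc; apply: (rep_unique rr).
apply: (rep_refine (rep_roof _ wc) wP).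
  by rewrite -(whisk _ e1).
have E0 : e0 \oc (p \oc (x \oc (z \oc t))) === e \oc (p' \oc (x \oc (z \oc t))).
  by rewrite e9 (whisk _ e4) e8.
by rewrite !(ac_compDl _) -(whisk _ e2) E0.
Qed.

Section FractionCategory.
Variable Wid : forall X : C, w (idm X).
Variable O : fractions W.
Notation Fr := (frac_cat Wid O).
Notation Q f := (roof_of Wid f : @Hom Fr _ _).

Lemma frac_rep_comp X Y Z (g : roof W Y Z) (f : roof W X Y)
    V (c : Hom V X) (d : Hom V Y) U (t : Hom U Y) (e : Hom U Z)
    P (p : Hom P V) (p' : Hom P U) (c' : Hom P X) (e' : Hom P Z) :
  rep f c d -> rep g t e -> w p -> d \oc p === t \oc p' ->
  c \oc p === c' -> e \oc p' === e' -> rep (fr_comp O g f) c' e'.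
Proof. exact: rep_comp (fr_compP O g f). Qed.

Lemma frac_rep_add X Y (f g : roof W X Y) V (c : Hom V X) (d e : Hom V Y) :
  rep f c d -> rep g c e -> rep (fr_add O f g) c (addm d e).
Proof. exact: rep_add (fr_addP O f g). Qed.

Lemma rep_Q X Y (f : Hom X Y) : rep (roof_of Wid f) (idm X) f.
Proof. exact: rep_roof. Qed.

Lemma rep_pair X Y Z (f : roof W X Y) (g : roof W Y Z) :
  exists V U (c : Hom V X) (d : Hom V U) (t : Hom U Y) (e : Hom U Z),
    [/\ rep f c (t \oc d), rep g t e & rep (fr_comp O g f) c (e \oc d)].
Proof.
have [P [p [p' [wp e]]]] := vc_ore Wc (rright f) (rleftW g).
exists P, (apex g), (rleft f \oc p), p', (rleft g), (rright g); split.
- by apply: (rep_refine (rep_self f) wp).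
- exact: rep_self.
- exact: (frac_rep_comp (rep_self f) (rep_self g) wp e).
Qed.

Lemma Q_eq X Y (f g : Hom X Y) : f === g -> Q f === Q g.
Proof. by move=> e; apply: (rep_unique (rep_Q f)); apply: (rep_refl_eq (rep_Q g)) => //; symmetry. Qed.
Lemma Q_comp X Y Z (g : Hom Y Z) (f : Hom X Y) : Q (g \oc f) === Q g \oc Q f.
Proof.
apply: (rep_unique (rep_Q _)).
by apply: (frac_rep_comp (rep_Q f) (rep_Q g) (W_id _) (p' := f)); rewrite ?(ac_idr _) ?(ac_idl _).
Qed.
Lemma Q_add X Y (f g : Hom X Y) : Q (addm f g) === addm (Q f) (Q g).
Proof. exact: (rep_unique (rep_Q _) (frac_rep_add (rep_Q f) (rep_Q g))). Qed.

#[global] Instance frac_additive : additive_category Fr.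
Proof.
have c_eq X Y Z (g g' : roof W Y Z) (f f' : roof W X Y) :
    roof_eq g g' -> roof_eq f f' -> roof_eq (fr_comp O g f) (fr_comp O g' f').
  move=> eg ef; have [V [U [c [d [t [e [rf rg rgf]]]]]]] := rep_pair f g.
  apply: (rep_unique rgf).
  apply: (frac_rep_comp (rep_eqr ef rf) (rep_eqr eg rg) (W_id _) (p' := d)) => //.
  - by rewrite (ac_idr _).
  - by rewrite (ac_idr _).
have a_eq X Y (f f' g g' : roof W X Y) :
    roof_eq f f' -> roof_eq g g' -> roof_eq (fr_add O f g) (fr_add O f' g').
  move=> ef eg; have [V [c [d [e [rf rg]]]]] := rep_common f g.
  apply: (rep_unique (frac_rep_add rf rg)).
  exact: (frac_rep_add (rep_eqr ef rf) (rep_eqr eg rg)).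
have id_l X Y (f : roof W X Y) : roof_eq (fr_comp O (roof_of Wid (idm Y)) f) f.
  apply: (rep_unique _ (rep_self f)).
  by apply: (frac_rep_comp (rep_self f) (rep_Q _) (W_id _) (p' := rright f)); rewrite ?(ac_idr _) ?(ac_idl _).
have id_r X Y (f : roof W X Y) : roof_eq (fr_comp O f (roof_of Wid (idm X))) f.
  apply: (rep_unique _ (rep_self f)).
  apply: (frac_rep_comp (rep_Q _) (rep_self f) (rleftW f) (p' := idm _)); rewrite ?(ac_idr _) ?(ac_idl _) //.
have rep_opp X Y (f : roof W X Y) V (c : Hom V X) d : rep f c d ->
    rep (Roof (rleftW f) (oppm (rright f))) c (oppm d).
  move=> rf; have [P [p [p' [wp wp' e1 e2]]]] := rep_compare (rep_self f) rf.
  have wc := rep_W rf; exists wc.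
  exists P, p, p'; split=> //=; first by apply: (vc_comp Wc) wp; exact: rleftW.
  by rewrite !compNm e2.
split.
- exact: roof_eq_refl.
- exact: roof_eq_sym.
- exact: roof_eq_trans.
- exact: c_eq.
- exact: a_eq.
- move=> X Y f f' e; have e' := rep_eqr e (rep_self f).
  exact: (rep_unique (rep_opp _ _ _ _ _ _ (rep_self f)) (rep_opp _ _ _ _ _ _ e')).
- move=> X Y Z V h g f.
  have [U1 [U2 [t [d [x [y [rg rh rhg]]]]]]] := rep_pair g h.
  have [P [p [p' [wp e]]]] := vc_ore Wc (rright f) (rep_W rg).
  apply: (rep_unique (c := rleft f \oc p) (h := y \oc (d \oc p'))).
    apply: (frac_rep_comp (p' := d \oc p') _ rh (W_id P)).
    + exact: (frac_rep_comp (rep_self f) rg wp e).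
    + by rewrite (ac_idr _) (ac_compA _).
    + by rewrite (ac_idr _).
    + by [].
  by apply: (frac_rep_comp (rep_self f) rhg wp e) => //; rewrite (ac_compA _).
- exact: id_l.
- exact: id_r.
- move=> X Y f g h; have [V [c [d [e [rf rg]]]]] := rep_common f g.
  have [P [p [p' [wp wp' ep]]]] := common_denominator (rep_W rf) (rleftW h).
  have rf' := rep_refine rf wp (eqh_refl _) (eqh_refl _).
  have rg' := rep_refine rg wp (eqh_refl _) (eqh_refl _).
  have rh' : rep h (c \oc p) (rright h \oc p').
    by apply: (rep_refine (rep_self h) wp') => //; symmetry.
  have r1 := frac_rep_add rf' (frac_rep_add rg' rh').
  have r2 := frac_rep_add (frac_rep_add rf' rg') rh'.
  apply: (rep_unique r1); apply: (rep_refl_eq r2) => //.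
  by rewrite (ac_addA _).
- move=> X Y f g; have [V [c [d [e [rf rg]]]]] := rep_common f g.
  apply: (rep_unique (frac_rep_add rf rg)).
  by apply: (rep_refl_eq (frac_rep_add rg rf)) => //; rewrite (ac_addC _).
- move=> X Y f.
  have r0 : rep (roof_of Wid (zerom : @Hom C X Y)) (rleft f) zerom.
    by apply: (rep_refine (rep_Q _) (rleftW f)); rewrite ?(ac_idl _) ?comp0m.
  apply: (rep_unique _ (rep_self f)).
  by apply: (rep_refl_eq (frac_rep_add r0 (rep_self f))); rewrite // (ac_add0 _).
- move=> X Y f.
  have r0 : rep (roof_of Wid (zerom : @Hom C X Y)) (rleft f) zerom.
    by apply: (rep_refine (rep_Q _) (rleftW f)); rewrite ?(ac_idl _) ?comp0m.
  apply: (rep_unique _ r0).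
  apply: (rep_refl_eq (frac_rep_add (rep_opp _ _ _ _ _ _ (rep_self f)) (rep_self f))); rewrite // (ac_addN _) //.
- move=> X Y Z g g' f.
  have [V [t [e [e' [rg rg']]]]] := rep_common g g'.
  have [P [p [p' [wp ep]]]] := vc_ore Wc (rright f) (rep_W rg).
  apply: (rep_unique (c := rleft f \oc p) (h := addm e e' \oc p')).
    by apply: (frac_rep_comp (rep_self f) (frac_rep_add rg rg') wp ep).
  rewrite -/(@addm Fr _ _).
  apply: (rep_refl_eq (frac_rep_add (frac_rep_comp (rep_self f) rg wp ep (eqh_refl _) (eqh_refl _)) (frac_rep_comp (rep_self f) rg' wp ep (eqh_refl _) (eqh_refl _)))) => //.
  by rewrite (ac_compDl _).
- move=> X Y Z g f f'.
  have [V [c [d [d' [rf rf']]]]] := rep_common f f'.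
  have [P [p [p' [wp ep]]]] := vc_ore Wc d (rleftW g).
  have [P1 [p1 [p1' [wp1 ep1]]]] := vc_ore Wc d' (rleftW g).
  have [R [x [y [wx wy exy]]]] := common_denominator wp wp1.
  have wpx : w (p \oc x) by exact: (vc_comp Wc).
  have E1 : d \oc (p \oc x) === rleft g \oc (p' \oc x) by exact: whisk.
  have E2 : d' \oc (p \oc x) === rleft g \oc (p1' \oc y) by rewrite exy; exact: whisk.
  have E3 : addm d d' \oc (p \oc x) === rleft g \oc addm (p' \oc x) (p1' \oc y).
    by rewrite (ac_compDl _) (ac_compDr _) E1 E2.
  apply: (rep_unique (frac_rep_comp (frac_rep_add rf rf') (rep_self g) wpx E3 (eqh_refl _) (eqh_refl _))).
  apply: (rep_refl_eq (frac_rep_add (frac_rep_comp rf (rep_self g) wpx E1 (eqh_refl _) (eqh_refl _)) (frac_rep_comp rf' (rep_self g) wpx E2 (eqh_refl _) (eqh_refl _)))) => //.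
  by rewrite (ac_compDr _).
- have [Z Z0] := @zero_exists _ (qt_additive Ct); exists Z => X; split=> f.
    have r0 : rep (roof_of Wid (zerom : @Hom C X Z)) (rleft f) zerom.
      by apply: (rep_refine (rep_Q _) (rleftW f)); rewrite ?(ac_idl _) ?comp0m.
    apply: (rep_unique (rep_self f)); apply: (rep_refl_eq r0) => //.
    by symmetry; exact: zero_from.
  have e : rleft f \oc idm _ === rleft f \oc zerom by rewrite (zero_from (rleft f) Z0) !comp0m.
  have [P [t [wt]]] := vc_cancel Wc (rleftW f) e; rewrite (ac_idl _) comp0m => t0.
  have r0 : rep (roof_of Wid (zerom : @Hom C Z X)) (rleft f \oc t) zerom.
    by apply: (rep_refine (rep_Q _) (vc_comp Wc (rleftW f) wt)); rewrite ?(ac_idl _) ?comp0m.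
  apply: (rep_unique _ r0).
  by apply: (rep_refine (rep_self f) wt) => //; rewrite t0 compm0.
- move=> X Y; have [S [i [j [p [q [pi qj pj qi ij]]]]]] := ac_biprod (qt_additive Ct) X Y.
  have tr := roof_eq_trans; have sy := roof_eq_sym.
  exists S, (Q i), (Q j), (Q p), (Q q); split.
  + exact: (tr _ _ _ _ _ (sy _ _ _ _ (Q_comp p i)) (Q_eq pi)).
  + exact: (tr _ _ _ _ _ (sy _ _ _ _ (Q_comp q j)) (Q_eq qj)).
  + exact: (tr _ _ _ _ _ (sy _ _ _ _ (Q_comp p j)) (Q_eq pj)).
  + exact: (tr _ _ _ _ _ (sy _ _ _ _ (Q_comp q i)) (Q_eq qi)).
  + apply: (tr _ _ _ _ _ (a_eq _ _ _ _ _ _ (sy _ _ _ _ (Q_comp i p)) (sy _ _ _ _ (Q_comp j q)))).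
    exact: (tr _ _ _ _ _ (sy _ _ _ _ (Q_add _ _)) (Q_eq ij)).
Qed.

Lemma QfE X Y (r : roof W X Y) V (c : Hom V X) d : rep r c d -> (r : @Hom Fr _ _) \oc Q c === Q d.
Proof.
move=> rf; apply: (rep_unique _ (rep_Q d)).
by apply: (frac_rep_comp (rep_Q c) rf (W_id _) (p' := idm _)); rewrite ?(ac_idr _) ?(ac_idl _).
Qed.

Lemma Q_iso X Y (s : Hom X Y) : w s -> is_iso (Q s).
Proof.
move=> ws; have E := QfE (rep_roof (idm X) ws).
exists (Roof ws (idm X) : @Hom Fr _ _); split; first exact: E.
apply: (rep_unique (c := s) (h := s)).
  by apply: (frac_rep_comp (rep_roof (idm X) ws) (rep_Q s) (W_id _) (p' := idm _)); rewrite ?(ac_idr _) ?(ac_idl _).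
by apply: (rep_refine (rep_Q _) ws); rewrite (ac_idl _).
Qed.

Lemma Q_faithful X Y (f g : Hom X Y) : Q f === Q g ->
  exists (Z : C) (t : Hom Z X), w t /\ f \oc t === g \oc t.
Proof.
move=> e; have [P [p [p' [wp wp' e1 e2]]]] := rep_compare (rep_Q f) (rep_eqr (roof_eq_sym e) (rep_Q g)).
exists P, p; split=> //; rewrite e2.
by move: e1; rewrite !(ac_idl _) => ->.
Qed.

Definition Qfun : prefunctor C Fr := @PreFunctor C Fr (fun X => X) (fun X Y f => Q f).
#[global] Instance Qfun_additive : additive_functor Qfun.
Proof.
split=> [X Y f g|X|X Y Z g f|X Y f g] /=; [exact: Q_eq| |exact: Q_comp|exact: Q_add].
exact: roof_eq_refl.
Qed.

Lemma Q_opp X Y (f : Hom X Y) : Q (oppm f) === oppm (Q f).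
Proof. exact: (fmapN (F := Qfun) f). Qed.

Section Induced.
Variables (F : prefunctor C C) (phi : forall X Y : C, roof W X Y -> roof W (F X) (F Y)).
Hypothesis Fa : additive_functor F.
Hypothesis Fphi : roof_induced phi.

Lemma induced_W X Y (f : Hom X Y) : w f -> w (fmap F f).
Proof. by move=> wf; have [] := Fphi (Roof wf (idm X)). Qed.

Lemma rep_image X Y (r : roof W X Y) V (c : Hom V X) d : rep r c d ->
  rep (phi r) (fmap F c) (fmap F d).
Proof.
move=> rf; have [P [p [p' [wp wp' e1 e2]]]] := rep_compare (rep_self r) rf.
have wFc := induced_W (rep_W rf).
have [WF e] := Fphi r; exists wFc; rewrite e.
exists (F P), (fmap F p), (fmap F p'); split=> /=.
- by apply: (vc_comp Wc) => //; exact: induced_W.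
- by rewrite -!(af_comp _) e1.
- by rewrite -!(af_comp _) e2.
Qed.

Lemma induced_additive : additive_functor (@PreFunctor Fr Fr F phi).
Proof.
split=> [X Y f g e|X|X Y Z g f|X Y f g].
- exact: (rep_unique (rep_image (rep_self f)) (rep_image (rep_eqr e (rep_self f)))).
- apply: (rep_unique _ (rep_Q (@idm C (F X)))).
  by apply: (rep_refl_eq (rep_image (rep_Q (@idm C X)))); rewrite (af_id _).
- have [V [U [c [d [t [e [rf rg rgf]]]]]]] := rep_pair f g.
  apply: (rep_unique (rep_image rgf)).
  apply: (frac_rep_comp (rep_image rf) (rep_image rg) (W_id _) (p' := fmap F d)); by rewrite ?(ac_idr _) -?(af_comp _).
- have [V [c [d [e [rf rg]]]]] := rep_common f g.
  apply: (rep_unique (rep_image (frac_rep_add rf rg))).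
  by apply: (rep_refl_eq (frac_rep_add (rep_image rf) (rep_image rg))); rewrite // (af_add _).
Qed.

Lemma induced_Q X Y (f : Hom X Y) : (phi (Q f) : @Hom Fr _ _) === Q (fmap F f).
Proof.
apply: (rep_unique _ (rep_Q _)).
by apply: (rep_refl_eq (rep_image (rep_Q f))); rewrite // (af_id _).
Qed.
End Induced.

Notation FS := (frac_shift Wid O).
#[global] Instance frac_shift_additive : additive_functor FS.
Proof. exact: (induced_additive (qt_shift Ct) (fr_shiftP O)). Qed.
Lemma shift_Q X Y (f : Hom X Y) : fmap FS (Q f) === Q (fmap T f).
Proof. exact: (induced_Q (qt_shift Ct) (fr_shiftP O) f). Qed.

Notation FT := (frac Wid O).

Lemma frac_dist_Q X Y Z (u : Hom X Y) (v : Hom Y Z) (t : Hom Z (T X)) : dist u v t ->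
  @dist FT _ _ _ (Q u) (Q v) (Q t).
Proof.
move=> d; exists X, Y, Z, u, v, t; split=> //.
exact: iso_tri_refl.
Qed.

Lemma desuspend_source (Z X : C) (f : Hom Z (T X)) :
  exists (Z' : C) (i : Hom (T Z') Z) (f' : Hom Z' X), is_iso i /\ fmap T f' === f \oc i.
Proof.
have [Z' [i ii]] := qt_esurj Ct Z; have [f' f'E] := qt_full Ct (f \oc i).
by exists Z', i, f'.
Qed.

(** Choose denominators of a and b that form a morphism of triangles; the
    numerators then form one as well, and the third denominator is inverted
    by [vc_five]. *)
Lemma Q_morph (X Y Z : C) (u : Hom X Y) (v : Hom Y Z) (t : Hom Z (T X))
   (X' Y' Z' : C) (u' : Hom X' Y') (v' : Hom Y' Z') (t' : Hom Z' (T X'))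
   (a : @Hom Fr X X') (b : @Hom Fr Y Y') :
  dist u v t -> dist u' v' t' -> b \oc Q u === Q u' \oc a ->
  exists c : @Hom Fr Z Z', c \oc Q v === Q v' \oc b /\ fmap FS a \oc Q t === Q t' \oc c.
Proof.
move=> d d' e.
have ra := rep_self a; have rb := rep_self b.
set s := rleft a in ra; set f := rright a in ra; set r := rleft b in rb; set g := rright b in rb.
have [X2 [x [u1 [wx ex]]]] := vc_ore Wc (u \oc s) (rleftW b).
have eg : Q (g \oc u1) === Q (u' \oc (f \oc x)).
  rewrite (Q_comp g u1) -(QfE rb) -(@ac_compA Fr _) -(Q_comp r u1) -(Q_eq ex).
  rewrite -(Q_eq (ac_compA (qt_additive Ct) u s x)) (Q_comp u (s \oc x)) (@ac_compA Fr _) e -(@ac_compA Fr _).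
  rewrite (Q_comp s x) [a \oc _](@ac_compA Fr _) (QfE ra).
  by rewrite -(Q_comp f x) -(Q_comp u' (f \oc x)).
have [X3 [y [wy]]] := Q_faithful eg; rewrite -!(ac_compA _) => ey.
pose si := s \oc (x \oc y); pose ph := f \oc (x \oc y); pose u2 := u1 \oc y.
have wsi : w si by apply: (vc_comp Wc); [exact: rleftW|exact: (vc_comp Wc)].
have rsi : rep a si ph.
  by apply: (rep_refine ra (vc_comp Wc wx wy)).
have [Z3 [v2 [t2 d2]]] := qt_cone Ct u2.
have e1 : r \oc u2 === u \oc si.
  by rewrite /u2 /si (ac_compA _) -ex -!(ac_compA _).
have e2 : g \oc u2 === u' \oc ph by rewrite /u2 /ph ey.
have [ga [ga1 ga2]] := qt_morph Ct d2 d e1.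
have wga : w ga by apply: (vc_five Wc d2 d e1 ga1 ga2 wsi); exact: rleftW.
have [de [de1 de2]] := qt_morph Ct d2 d' e2.
have E := QfE (rep_roof de wga); set c := Roof wga de in E.
exists c; split.
- apply: (iso_epi (Q_iso (rleftW b))); rewrite -!(@ac_compA Fr _) (QfE rb).
  rewrite -(Q_comp v r) -(Q_comp v' g) -(Q_eq ga1) -(Q_eq de1).
  by rewrite (Q_comp ga v2) (Q_comp de v2) (@ac_compA Fr _) E.
- apply: (iso_epi (Q_iso wga)); rewrite -!(@ac_compA Fr _) E.
  rewrite -(Q_comp t ga) -(Q_comp t' de) -(Q_eq ga2) -(Q_eq de2).
  rewrite (Q_comp (fmap T si) t2) (Q_comp (fmap T ph) t2) -!shift_Q.
  by rewrite (@ac_compA Fr _) -(af_comp frac_shift_additive) (QfE rsi).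
Qed.

#[global] Instance frac_quasi_triangulated : quasi_triangulated FT.
Proof.
split.
- exact: frac_additive.
- exact: frac_shift_additive.
- move=> X Y g; have rg := rep_self (g : roof W (T X) (T Y)).
  have [Z' [i [s' [ii es]]]] := desuspend_source (rleft g).
  have [g' eg] := qt_full Ct (rright g \oc i).
  have wi := vc_iso Wc ii.
  have rg' := rep_refine rg wi (eqh_refl _) (eqh_refl _).
  have ws : w s'.
    by rewrite -(vc_shift Wc) es; apply: (vc_comp Wc) => //; exact: rleftW.
  exists (Roof ws g').
  apply: (rep_unique _ (rep_refl_eq rg' (symmetry es) (symmetry eg))).
  exact: (rep_image (qt_shift Ct) (fr_shiftP O) (rep_roof g' ws)).
- move=> X Y f g e; have [V [c [d [d' [rf rg]]]]] := rep_common (f : roof W X Y) (g : roof W X Y).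
  have rf' := rep_image (qt_shift Ct) (fr_shiftP O) rf.
  have rg' := rep_image (qt_shift Ct) (fr_shiftP O) rg.
  have Qe : Q (fmap T d) === Q (fmap T d').
    by rewrite -(QfE rf') -(QfE rg'); apply: (ac_comp _ e).
  have [Z [t [wt te]]] := Q_faithful Qe.
  have [Z' [i [t' [ii ti]]]] := desuspend_source t.
  have wt' : w t'.
    by rewrite -(vc_shift Wc) ti; apply: (vc_comp Wc) => //; exact: (vc_iso Wc).
  have et : d \oc t' === d' \oc t'.
    by apply: (qt_faithful Ct); rewrite !(af_comp _) ti !(ac_compA _) te.
  apply: (rep_unique (rep_refine rf wt' (eqh_refl _) (eqh_refl _))).
  by apply: (rep_refine rg wt') => //; symmetry.
- move=> Y; have [X [f jf]] := qt_esurj Ct Y.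
  by exists X, (Q f); apply: Q_iso; exact: (vc_iso Wc).
- move=> X Y Z u v t X' Y' Z' u' v' t' [X0 [Y0 [Z0 [u0 [v0 [t0 [d i0]]]]]]] i.
  exists X0, Y0, Z0, u0, v0, t0; split=> //; exact: (iso_tri_trans i0 i).
- move=> X Z Z0; have [O0 OO] := @zero_exists _ (qt_additive Ct).
  have OO' : is_zero (O0 : Fr) by exact: (fmap_zero (F := Qfun) OO).
  have ZZ : is_zero Z by exact: Z0.
  exists X, X, O0, (@idm C X), (@zerom C X O0), (@zerom C O0 (T X)); split; first by apply: (qt_id Ct); exact: zero_object.
  exists (idm (X : Fr)), (idm (X : Fr)), zerom; split; split; try exact: iso_id.
  + by exists zerom; split; rewrite compm0; symmetry.
  + by rewrite !(ac_idl _); exact: roof_eq_refl.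
  + by rewrite comp0m; symmetry; exact: zero_from.
  + by rewrite compm0; apply: zero_to.
- move=> X Y u; have ru := rep_self (u : roof W X Y).
  have [Z [v [t d]]] := qt_cone Ct (rright u).
  exists Z, (Q v), (fmap FS (Q (rleft u)) \oc Q t).
  exists (apex u), Y, Z, (rright u), v, t; split=> //.
  exists (Q (rleft u)), (idm (Y : Fr)), (idm (Z : Fr)); split; split; try exact: iso_id.
  + by apply: Q_iso; exact: rleftW.
  + by rewrite (ac_idl _) (QfE ru).
  + by rewrite (ac_idl _) (ac_idr _).
  + by rewrite (ac_idr _).
- move=> X Y Z u v t [X0 [Y0 [Z0 [u0 [v0 [t0 [d i]]]]]]].
  exists Y0, Z0, (T X0), v0, t0, (oppm (fmap T u0)); split; first exact: (qt_rotate Ct).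
  apply: (iso_tri_trans _ (iso_tri_rotate i)).
  apply: (iso_tri_refl (T := FS)) => //.
  by rewrite Q_opp shift_Q.
- move=> X Y Z u v t X' Y' Z' u' v' t' a b.
  move=> [X0 [Y0 [Z0 [u0 [v0 [t0 [d i]]]]]]] [X1 [Y1 [Z1 [u1 [v1 [t1 [d' i']]]]]]] e.
  apply: (extends_transport i i' _ e) => a0 b0; exact: Q_morph.
Qed.

(** A composable pair of fractions is isomorphic to the image of a
    composable pair of morphisms, whose octahedron is carried over. *)
Lemma frac_triangulated : triangulated C -> triangulated FT.
Proof.
move=> Ctr; apply: quasi_triangulated_triangulated => X Y Z u v.
have ru := rep_self (u : roof W X Y); have rv := rep_self (v : roof W Y Z).
set s := rleft u in ru; set f := rright u in ru; set t := rleft v in rv; set v1 := rright v in rv.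
have [X2 [x [u1 [wx ex]]]] := vc_ore Wc f (rleftW v).
have wsx : w (s \oc x) by apply: (vc_comp Wc) wx; exact: rleftW.
have [Z' [i [i' d1]]] := qt_cone Ct u1.
have [X' [j [j' d2]]] := qt_cone Ct v1.
have [Y' [l [l' d3]]] := qt_cone Ct (v1 \oc u1).
have [F [G [dFG e1 e2 e3 e4]]] := tr_octahedron Ctr d1 d2 d3.
exists X2, (apex v), Z, X', Y', Z', (Q u1), (Q v1), (Q i), (Q i'), (Q j), (Q j'), (Q l), (Q l').
exists (Q (s \oc x)), (Q t), (idm (Z : Fr)); split; first split.
- exact: Q_iso.
- apply: Q_iso; exact: rleftW.
- exact: iso_id.
- rewrite -(Q_comp t u1) -(Q_eq ex) (Q_comp s x) (@ac_compA Fr _) (QfE ru).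
  exact: Q_comp.
- by rewrite (ac_idl _) (QfE rv).
split; [exact: frac_dist_Q|exact: frac_dist_Q| |].
  apply: (dist_eq (frac_dist_Q d3)) => //; exact: Q_comp.
exists (Q F), (Q G); split.
- apply: (dist_eq (frac_dist_Q dFG)) => //.
  change (Q (fmap T i \oc j') === fmap FS (Q i) \oc Q j').
  by rewrite (Q_comp (fmap T i) j') -shift_Q; exact: roof_eq_refl.
- by rewrite -(Q_comp F i) -(Q_comp l v1); exact: Q_eq.
- by rewrite -(Q_comp l' F); exact: Q_eq.
- by rewrite -(Q_comp G l); exact: Q_eq.
- change (Q j' \oc Q G === fmap FS (Q u1) \oc Q l').
  by rewrite shift_Q -(Q_comp j' G) -(Q_comp (fmap T u1) l'); exact: Q_eq.
Qed.

(** The comparison of F with the shift is natural for fractions because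
    denominators can be cancelled. *)
Lemma frac_exact (F : prefunctor C C)
  (phi : forall X Y : C, roof W X Y -> roof W (F X) (F Y)) :
  roof_induced phi -> exact_functor (F : prefunctor C C) ->
  exact_functor (frac_functor Wid O phi : prefunctor FT FT).
Proof.
move=> Fphi [Fa [th [th_iso th_nat th_dist]]].
pose FF : prefunctor Fr Fr := @PreFunctor Fr Fr F phi.
have FFa : additive_functor FF by exact: induced_additive.
have FQ X Y (f : Hom X Y) : fmap FF (Q f) === Q (fmap F f) by exact: induced_Q.
have nat X Y (f : @Hom Fr X Y) : Q (th Y) \oc fmap FF (fmap FS f) === fmap FS (fmap FF f) \oc Q (th X).
  have rf := rep_self (f : roof W X Y); set c := rleft f in rf; set d := rright f in rf.
  have wc : w c by exact: rleftW.
  apply: (iso_epi (f := fmap FF (fmap FS (Q c)))); first by do 2! apply: fmap_iso; exact: Q_iso.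
  rewrite -!(@ac_compA Fr _) -(af_comp FFa) -(af_comp frac_shift_additive) (QfE rf).
  rewrite !shift_Q !FQ -(Q_comp (th Y)) -(Q_comp (th X)) (Q_eq (th_nat _ _ d)) (Q_eq (th_nat _ _ c)).
  rewrite (Q_comp (fmap T (fmap F d))) (Q_comp (fmap T (fmap F c))) -!shift_Q -!FQ.
  by rewrite (@ac_compA Fr _) -(af_comp frac_shift_additive) -(af_comp FFa) (QfE rf).
split=> //; exists (fun X => Q (th X)); split.
- by move=> X; apply: Q_iso; apply: (vc_iso Wc); exact: th_iso.
- exact: nat.
- move=> X Y Z u v t [X0 [Y0 [Z0 [u0 [v0 [t0 [d [a [b [c [[ia ib ic] [e1 e2 e3]]]]]]]]]]]].
  have d' := th_dist _ _ _ _ _ _ d.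
  exists (F X0), (F Y0), (F Z0), (fmap F u0), (fmap F v0), (th X0 \oc fmap F t0); split=> //.
  exists (fmap FF a), (fmap FF b), (fmap FF c); split; split; try exact: fmap_iso.
  + by rewrite -FQ -!(af_comp FFa) e1.
  + by rewrite -FQ -!(af_comp FFa) e2.
  + change (fmap FS (fmap FF a) \oc Q (th X0 \oc fmap F t0) === Q (th X) \oc fmap FF t \oc fmap FF c).
    rewrite -(@ac_compA Fr _) -(af_comp FFa) -e3 (af_comp FFa) FQ (Q_comp (th X0)).
    by rewrite !(@ac_compA Fr _) nat.
Qed.
End FractionCategory.
End Roofs.

Section InvertedByFunctor.
Variables (C D : pretri) (Ct : quasi_triangulated C) (Dt : quasi_triangulated D).
Variables (F : prefunctor C D) (Fe : exact_functor F).
Let Fa : additive_functor F := Fe.1.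
Let W (X Y : C) (f : Hom X Y) := is_iso (fmap F f).

Lemma exact_cone_zero (X Y Z : C) (u : Hom X Y) (v : Hom Y Z) (w : Hom Z (shift C X)) :
  dist u v w -> W u <-> is_zero (F Z).
Proof.
have [_ [th [_ _ thd]]] := Fe => /thd d.
by split; [exact: (iso_cone_zero d)|exact: (zero_cone_iso d)].
Qed.

(** A morphism is inverted exactly when F kills its cone. The Ore square is
    completed by the fiber of X -> Y -> cone of s, on which f factors
    through s; equal composites with s are equalized on the fiber of a map
    to the fiber of s. *)
Lemma inverted_verdier : verdier_class W.
Proof.
have [Fa' [th [thi thn thd]]] := Fe.
split.
- by move=> X Y f; exact: fmap_iso.
- by move=> X Y f g e; apply: iso_eq; rewrite e.
- move=> X Y Z g f wg wf; apply: (iso_eq (symmetry (af_comp Fa g f))); exact: iso_comp.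
- move=> X Y Z g f wg wgf; apply: (iso_compl wg); exact: (iso_eq (af_comp Fa g f)).
- move=> X Y Z g f wf wgf; apply: (iso_compr wf); exact: (iso_eq (af_comp Fa g f)).
- move=> X Y f; split=> [wT|wf].
    have : is_iso (fmap (shift D) (fmap F f)).
      apply: (iso_compr (thi X)); apply: (iso_eq (thn _ _ f)); exact: iso_comp.
    move=> [g [gf fg]]; have [g' g'E] := qt_full Dt g; exists g'.
    by split; apply: (qt_faithful Dt); rewrite (af_comp _) (af_id _) g'E.
  apply: (iso_compl (thi Y)); apply: (iso_eq (symmetry (thn _ _ f))).
  by apply: iso_comp => //; exact: fmap_iso.
- move=> X Y Y' f s ws.
  have [Z [c [t d]]] := qt_cone Ct s.
  have [X' [s' [t' d2]]] := fiber_exists (c \oc f).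
  have e : c \oc (f \oc s') === zerom by rewrite (ac_compA _) (dist_comp0 d2).
  have [f' f'E] := weak_kernel d e.
  exists X', s', f'; split; last by symmetry.
  apply/(exact_cone_zero d2); exact/(exact_cone_zero d).
- move=> X Y Z s f g ws e.
  have e0 : s \oc addm f (oppm g) === zerom by rewrite (ac_compDr _) compmN e addmN.
  have [Q [j [t d]]] := fiber_exists s.
  have [h hE] := weak_kernel d e0.
  have FQ : is_zero (F Q).
    apply: desuspend_zero; apply: (iso_zero (thi Q)).
    by apply/(exact_cone_zero (qt_rotate Ct d)).
  have [X' [x [t' d']]] := fiber_exists h.
  exists X', x; split; first exact/(exact_cone_zero d').
  by apply/subm_eq0; rewrite -compNm -(ac_compDl _) -hE -(ac_compA _) (dist_comp0 d') compm0.
- move=> X Y Z u v w X' Y' Z' u' v' w' a b c d d' e1 e2 e3 wa wb.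
  apply: (five_lemma (thd _ _ _ _ _ _ d) (thd _ _ _ _ _ _ d') _ _ _ wa wb).
  + by rewrite -!(af_comp _) e1.
  + by rewrite -!(af_comp _) e2.
  + by rewrite (ac_compA _) -thn -!(ac_compA _) -!(af_comp _) e3.
Qed.
End InvertedByFunctor.

(** * The stable category *)

Section StableCategory.
Variables (k : fieldType) (H : fdHopf k) (A : comodAlg H) (L : lintegral H).
Variable P : modclass A.
Notation xi := (lamid L (M := _)).
Notation HM := (hten H^o).
Notation SC := (stabcat P).

Lemma stab_eqP (M N : pmod P) (f g : {linear M -> N}) :
  @eqh SC M N f g <-> exists h : {linear HM M -> N}, forall x, f x = g x + h (xi x).
Proof.
rewrite /= (null_homotopicP L); split=> -[h hE]; exists h => x.
  by rewrite -hE /= addrC subrK.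
by rewrite /= hE addrC addKr.
Qed.

Lemma stab_eq1 (M N : pmod P) (f g : {linear M -> N}) : f =1 g -> @eqh SC M N f g.
Proof. by move=> e; apply/stab_eqP; exists \0 => x; rewrite e /= addr0. Qed.

Lemma stab_eq_through (M N : pmod P) (f g : {linear M -> N}) (Q : lmodType A)
   (a : {linear M -> HM Q}) (b : {linear HM Q -> N}) :
  (forall x, f x = g x + b (a x)) -> @eqh SC M N f g.
Proof. by move=> e; exists Q, a, b => x; rewrite /= e addrC addKr. Qed.

Lemma zero_module : exists Z : pmod P, forall x : Z, x = 0.
Proof.
have [Z [p [sp pP]]] := coker_exists (idfun : {linear A^o -> A^o}).
have Z0 (z : Z) : z = 0 by have [y <-] := sp z; apply/pP; exists y.
by exists (PMod (mc_zero P Z0)).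
Qed.

Fact inl_linear (M N : lmodType A) : linear (fun m : M => (m, 0) : M * N).
Proof. by move=> a x y; congr (_, _); rewrite /= scaler0 addr0. Qed.
Fact inr_linear (M N : lmodType A) : linear (fun n : N => (0, n) : M * N).
Proof. by move=> a x y; congr (_, _); rewrite /= scaler0 addr0. Qed.

#[global] Instance stab_additive : additive_category SC.
Proof.
split.
- by move=> X Y f; apply: stab_eq1.
- move=> X Y f g /stab_eqP[h e]; apply/stab_eqP; exists (\- h) => x.
  by rewrite /= e addrK.
- move=> X Y f g l /stab_eqP[h e] /stab_eqP[h' e']; apply/stab_eqP; exists (h' \+ h) => x.
  by rewrite /= e e' addrA.
- move=> X Y Z g g' f f' /stab_eqP[h e] /stab_eqP[h' e']; apply/stab_eqP.
  exists ((h \o hmap H^o f) \+ (g' \o h')) => x.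
  rewrite /= hmap_lamid e (_ : g' (f x) = g' (f' x) + g' (h' (xi x))); last by rewrite e' linearD.
  by rewrite -addrA; congr (_ + _); exact: addrC.
- move=> X Y f f' g g' /stab_eqP[h e] /stab_eqP[h' e']; apply/stab_eqP.
  by exists (h \+ h') => x; rewrite /= e e' addrACA.
- move=> X Y f f' /stab_eqP[h e]; apply/stab_eqP; exists (\- h) => x.
  by rewrite /= e opprD.
- by move=> *; apply: stab_eq1.
- by move=> *; apply: stab_eq1.
- by move=> *; apply: stab_eq1.
- by move=> X Y f g h; apply: stab_eq1 => x; rewrite /= addrA.
- by move=> X Y f g; apply: stab_eq1 => x; rewrite /= addrC.
- by move=> X Y f; apply: stab_eq1 => x; rewrite /= add0r.
- by move=> X Y f; apply: stab_eq1 => x; rewrite /= addNr.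
- by move=> *; apply: stab_eq1.
- by move=> X Y Z g f f'; apply: stab_eq1 => x; rewrite /= linearD.
- have [Z Z0] := zero_module; exists Z => X; split=> f; apply: stab_eq1 => x; first exact: etrans (Z0 _) (esym (Z0 _)).
  by rewrite (Z0 x) linear0 [RHS]linear0.
- move=> X Y; exists (PMod (mc_sum (pmodP X) (pmodP Y))).
  exists (mklin (@inl_linear X Y)), (mklin (@inr_linear X Y)),
    (fst : {linear (X * Y)%type -> X}), (snd : {linear (X * Y)%type -> Y}).
  split; apply: stab_eq1 => //.
  by move=> [x y] /=; congr (_, _); rewrite /= ?addr0 ?add0r.
Qed.

Section TensorFunctor.
Variables (V : lmodType H) (PV : forall M : lmodType A, P M -> P (hten V M)).
(** The functor V (x) - preserves null-homotopic maps, as V (x) (H (x) X) is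
    relatively injective. *)
#[global] Instance htenF_additive : additive_functor (htenF PV).
Proof.
split.
- move=> X Y f g /stab_eqP[h e].
  have [r rE] := tensor_free_split L V X.
  apply/stab_eqP; exists (hmap V h \o r \o hmap H^o (hmap V (lamid L (M := X)))) => x.
  rewrite /= hmap_lamid rE.
  rewrite -(@hmap_comp _ _ _ _ _ _ _ h (lamid L (M := X)) (h \o lamid L (M := X))) //.
  exact: hmap_add.
- by move=> X; apply: stab_eq1; exact: hmap_id.
- by move=> X Y Z g f; apply: stab_eq1; exact: hmap_comp.
- by move=> X Y f g; apply: stab_eq1; exact: hmap_add.
Qed.
End TensorFunctor.

#[global] Instance shiftF_additive : additive_functor (shiftF P L).
Proof. exact: htenF_additive. Qed.

(** The pushout of xi and u in terms of elements: maps out of it are built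
    by [cone_map] and compared on the images of ub and v by [cone_eq]. *)
Definition cone_of (X Y C : lmodType A) (u : {linear X -> Y}) (v : {linear Y -> C})
    (ub : {linear HM X -> C}) (w : {linear C -> Tmod L X}) : Prop :=
  [/\ forall x, ub (xi x) = v (u x),
      forall c, exists s y, c = ub s + v y,
      forall s y, ub s + v y = 0 -> exists x, s = xi x /\ y = - u x,
      forall y, w (v y) = 0
    & forall s, w (ub s) = Tquo L X s].

Lemma cone_map (X Y C : lmodType A) (u : {linear X -> Y}) (v : {linear Y -> C})
    (ub : {linear HM X -> C}) (w : {linear C -> Tmod L X}) (N : lmodType A)
    (a : {linear HM X -> N}) (b : {linear Y -> N}) :
  cone_of u v ub w -> (forall x, a (xi x) = b (u x)) ->
  exists c : {linear C -> N}, (forall s, c (ub s) = a s) /\ (forall y, c (v y) = b y).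
Proof.
move=> [c1 c2 c3 c4 c5] ab.
pose p : {linear (HM X * Y)%type -> C} := (ub \o fst) \+ (v \o snd).
pose g : {linear (HM X * Y)%type -> N} := (a \o fst) \+ (b \o snd).
have [c cE] : exists c : {linear C -> N}, forall z, c (p z) = g z.
  apply: factor_surj => [z|[s y] /= /c3[x [-> ->]]].
    by have [s [y ->]] := c2 z; exists (s, y).
  by rewrite /g /= linearN ab subrr.
exists c; split=> [s|y].
  by have := cE (s, 0); rewrite /p /g /= !linear0 !addr0.
by have := cE (0, y); rewrite /p /g /= !linear0 !add0r.
Qed.

Lemma cone_eq (X Y C : lmodType A) (u : {linear X -> Y}) (v : {linear Y -> C})
    (ub : {linear HM X -> C}) (w : {linear C -> Tmod L X}) (N : zmodType) (f g : {additive C -> N}) :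
  cone_of u v ub w -> (forall s, f (ub s) = g (ub s)) -> (forall y, f (v y) = g (v y)) -> f =1 g.
Proof.
by move=> [c1 c2 c3 c4 c5] e e' c; have [s [y ->]] := c2 c; rewrite !raddfD e e'.
Qed.

Lemma cone_std (X Y C : lmodType A) (u : {linear X -> Y}) (v : {linear Y -> C})
    (ub : {linear HM X -> C}) (w : {linear C -> Tmod L X}) :
  cone_of u v ub w -> std_tri u v w.
Proof.
move=> cu; have [c1 c2 c3 c4 c5] := cu; exists ub; split=> //; split=> // N a b ab.
have [c [e e']] := cone_map cu ab; exists c; split=> // c' f f'.
by apply: (@cone_eq _ _ _ _ _ _ _ _ c' c cu) => [s|y] /=; rewrite ?f ?f' ?e ?e'.
Qed.

Lemma cone_exists (X Y : pmod P) (u : {linear X -> Y}) : exists (C : pmod P)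
   (v : {linear Y -> C}) (ub : {linear HM X -> C}) (w : {linear C -> Tmod L X}), cone_of u v ub w.
Proof.
pose i : {linear X -> (HM X * Y)%type} :=
  (mklin (@inl_linear (HM X) Y) \o lamid L (M := X)) \- (mklin (@inr_linear (HM X) Y) \o u).
have iE x : i x = (xi x, - u x).
  by congr (_, _); [exact: subr0|exact: sub0r].
have [C [p [sp pP]]] := coker_exists i.
have PC : P C by apply: (mc_quotient sp); apply: mc_sum; [exact: mc_tensor (pmodP X)|exact: pmodP].
have [w wE] : exists w : {linear C -> Tmod L X}, forall z, w (p z) = Tquo L X z.1.
  apply: (@factor_surj _ _ _ _ p (Tquo L X \o fst)) => // z /pP[x ->].
  by rewrite /= [X in Tquo L _ X](congr1 fst (iE x)) Tquo_lamid.
have pE s y : p (s, y) = p (s, 0) + p (0, y).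
  rewrite -linearD; congr (p (_, _)); [exact: esym (addr0 _)|exact: esym (add0r _)].
exists (PMod PC), (p \o mklin (@inr_linear (HM X) Y)), (p \o mklin (@inl_linear (HM X) Y)), w.
split=> [x|c|s y|y|s] /=.
- apply/eqP; rewrite -subr_eq0 -linearB; apply/eqP/pP; exists x.
  by rewrite iE; congr (_, _); [exact: subr0|exact: sub0r].
- by have [[s y] <-] := sp c; exists s, y; rewrite pE.
- by rewrite -pE => /pP[x]; rewrite iE => -[-> ->]; exists x.
- by rewrite wE /= linear0.
- by rewrite wE.
Qed.

Lemma std_iso_cone (X Y C C' : lmodType A) (u : {linear X -> Y}) (v : {linear Y -> C})
   (w : {linear C -> Tmod L X}) (v' : {linear Y -> C'}) (ub' : {linear HM X -> C'})
   (w' : {linear C' -> Tmod L X}) :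
  std_tri u v w -> cone_of u v' ub' w' -> exists (c : {linear C' -> C}) (c' : {linear C -> C'}),
    [/\ cancel c c', cancel c' c, forall y, c (v' y) = v y & forall z, w (c z) = w' z].
Proof.
move=> [ub [[pu pP] wv wu]] cu; have [c1 c2 c3 c4 c5] := cu.
have [c [e e']] := cone_map cu pu.
have [c' [f f' _]] := pP _ _ _ c1.
have [d [_ _ dU]] := pP _ _ _ pu.
exists c, c'; split=> //.
- by apply: (@cone_eq _ _ _ _ _ _ _ _ (c' \o c) idfun cu) => [s|y] /=; rewrite ?e ?e' ?f ?f'.
- move=> z; transitivity (d z); last symmetry.
    by apply: (dU (c \o c')) => [s|y] /=; rewrite ?f ?f' ?e ?e'.
  by apply: (dU idfun).
- by apply: (@cone_eq _ _ _ _ _ _ _ _ (w \o c) w' cu) => [s|y] /=; rewrite ?e ?e' ?wv ?wu ?c4 ?c5.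
Qed.

Lemma bij_iso (X Y : pmod P) (f : {linear X -> Y}) (g : {linear Y -> X}) :
  cancel f g -> cancel g f -> @is_iso SC X Y f.
Proof. by move=> fK gK; exists g; split; apply: stab_eq1 => x /=; rewrite ?fK ?gK. Qed.

Lemma cone_dist (X Y C : pmod P) (u : {linear X -> Y}) (v : {linear Y -> C})
    (ub : {linear HM X -> C}) (w : {linear C -> Tmod L X}) :
  cone_of u v ub w -> @stab_dist _ _ _ P L X Y C u v w.
Proof.
by move=> cu; exists X, Y, C, u, v, w; split; [exact: cone_std cu|exact: (@iso_tri_refl SC)].
Qed.

Lemma dist_cone (X Y Z : SC) (u : Hom X Y) (v : Hom Y Z) (w : Hom Z (shiftF P L X)) :
  stab_dist u v w -> exists (X' Y' C : pmod P) (u' : {linear X' -> Y'}) (v' : {linear Y' -> C})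
    (ub : {linear HM X' -> C}) (w' : {linear C -> Tmod L X'}),
    cone_of u' v' ub w' /\ @iso_tri SC (shiftF P L) X' Y' C u' v' w' X Y Z u v w.
Proof.
move=> [X' [Y' [C [u' [v' [w' [st i]]]]]]].
have [C' [v2 [ub [w2 cu]]]] := cone_exists u'.
have [c [c' [cK cK' cv cw]]] := std_iso_cone st cu.
exists X', Y', C', u', v2, ub, w2; split=> //; apply: (iso_tri_trans (T := shiftF P L) _ i).
exists (idm (X' : SC)), (idm (Y' : SC)), c; split; split.
- exact: iso_id.
- exact: iso_id.
- exact: bij_iso cK cK'.
- exact: stab_eq1.
- exact: stab_eq1.
- apply: stab_eq1 => z; rewrite /= cw; exact: hmap_id.
Qed.

Local Notation qu := (Tquo L _).

(** Let C be the cone of i. It retracts onto Z with complement H (x) X,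
    which vanishes stably. The section of C -> Z is v - ub psi on Y, so the
    connecting map of C restricts to - wd. *)
Lemma conflation_dist (X Y Z : pmod P) (i : {linear X -> Y}) (p : {linear Y -> Z})
    (psi : {linear Y -> HM X}) (wd : {linear Z -> Tmod L X}) :
  (forall z, exists y, p y = z) -> (forall y, p y = 0 -> exists x, y = i x) ->
  (forall x, p (i x) = 0) -> (forall x, psi (i x) = xi x) ->
  (forall y, wd (p y) = qu (psi y)) -> @stab_dist _ _ _ P L X Y Z i p (\- wd).
Proof.
move=> sp pi0 pi psii wdp.
have [C [v [ub [w cu]]]] := cone_exists i; have [c1 c2 c3 c4 c5] := cu.
have [c [cub cv]] : exists c : {linear C -> Z}, (forall s, c (ub s) = 0) /\ (forall y, c (v y) = p y).
  by apply: (cone_map (a := \0) cu) => x /=; rewrite pi.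
have [d dE] : exists d : {linear Z -> C}, forall y, d (p y) = v y - ub (psi y).
  apply: (@factor_surj _ _ _ _ p (v \- (ub \o psi))) => // y /pi0[x ->] /=.
  by rewrite psii c1 subrr.
have [r [rub rv]] : exists r : {linear C -> HM X}, (forall s, r (ub s) = s) /\ (forall y, r (v y) = psi y).
  by apply: (cone_map (a := idfun) cu) => x /=; rewrite psii.
exists X, Y, C, i, v, w; split; first exact: cone_std cu.
exists (idm (X : SC)), (idm (Y : SC)), c; split; split; try exact: iso_id.
- exists d; split.
    apply: ac_sym; apply: (@stab_eq_through _ _ _ _ _ r ub) => z.
    apply: (@cone_eq _ _ _ _ _ _ _ _ idfun ((d \o c) \+ (ub \o r)) cu) z => [s|y] /=.
      by rewrite cub rub linear0 add0r.
    by rewrite cv rv dE subrK.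
  apply: stab_eq1 => z /=; have [y <-] := sp z.
  by rewrite dE linearB cub cv subr0.
- exact: stab_eq1.
- exact: stab_eq1.
- apply: (@stab_eq_through C (shiftF P L X) (hmap (HmodL L) idfun \o w) ((\- wd) \o c) X r (Tquo L X)) => z /=.
  rewrite (hmap_id (f := idfun)) //.
  apply: (@cone_eq _ _ _ _ _ _ _ _ w ((\- (wd \o c)) \+ (Tquo L X \o r)) cu) z => [s|y] /=.
    by rewrite c5 cub rub linear0 oppr0 add0r.
  by rewrite c4 cv rv wdp addNr.
Qed.

(** Extending i along xi by the retraction r gives a map H (x) X -> Q, and
    on quotients the inverse TX -> Z. *)
Lemma conflation_connecting_iso (X Z : pmod P) (Q : lmodType A) (r : {linear HM Q -> Q})
    (i : {linear X -> Q}) (p : {linear Q -> Z})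
    (psi : {linear Q -> HM X}) (wd : {linear Z -> Tmod L X}) :
  (forall y, r (xi y) = y) ->
  (forall z, exists y, p y = z) ->
  (forall x, p (i x) = 0) -> (forall y, p y = 0 -> exists x, y = i x) ->
  (forall x, psi (i x) = xi x) ->
  (forall y, wd (p y) = qu (psi y)) -> @is_iso SC Z (shiftF P L X) wd.
Proof.
move=> rE sp pi pi0 psii wdp.
pose e := r \o hmap H^o i.
have eE x : e (xi x) = i x by rewrite /e /= hmap_lamid rE.
have [g gE] : exists g : {linear Tmod L X -> Z}, forall t, g (Tquo L X t) = p (e t).
  apply: (@factor_surj _ _ _ _ (Tquo L X) (p \o e)); first exact: Tquo_surj.
  by move=> t /Tquo_ker[x ->]; rewrite /= hmap_lamid rE pi.
have [t tE] : exists t : {linear Z -> Q}, forall y, t (p y) = y - e (psi y).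
  apply: (@factor_surj _ _ _ _ p (idfun \- (e \o psi))) => // y /pi0[x ->].
  by rewrite /= psii hmap_lamid rE subrr.
have [s sE] : exists s : {linear Tmod L X -> HM X}, forall t, s (Tquo L X t) = t - psi (e t).
  apply: (@factor_surj _ _ _ _ (Tquo L X) (idfun \- (psi \o e))); first exact: Tquo_surj.
  by move=> u /Tquo_ker[x ->]; rewrite /= hmap_lamid rE psii subrr.
exists g; split.
  apply: ac_sym; apply: (@stab_eq_through Z Z _ (g \o wd) Q (lamid L (M := Q) \o t) (p \o r)) => z.
  by have [y <-] := sp z; rewrite /= rE wdp gE tE linearB addrC subrK.
apply: ac_sym.
apply: (@stab_eq_through (shiftF P L X) (shiftF P L X) idfun (wd \o g) X s (Tquo L X)) => z.
have [u <-] := @Tquo_surj _ _ _ L X z.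
by rewrite /= gE wdp sE linearB addrC subrK.
Qed.

Lemma shift_esurj (Y : pmod P) : exists (X : SC) (f : Hom (shiftF P L X) (Y : SC)), is_iso f.
Proof.
have [K [i [psi [inji iP psii]]]] := syzygy_exists L Y.
have PK : P K.
  apply: (mc_subquotient (mc_tensor (pmodP Y))); exists K, i, idfun; split=> // y.
  by exists y.
have pi x : hcounit Y (i x) = 0 by apply/iP; exists x.
have [wd wdE] : exists wd : {linear Y -> Tmod L K}, forall y, wd (hcounit Y y) = Tquo L K (psi y).
  apply: (@factor_surj _ _ _ _ (hcounit Y) (Tquo L K \o psi)); first exact: hcounit_surj.
  by move=> y /iP[x ->]; rewrite /= psii Tquo_lamid.
have [r rE] := free_split L Y.
have [f [f1 f2]] := @conflation_connecting_iso (PMod PK) Y _ r i (hcounit Y) psi wd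
  rE (@hcounit_surj _ _ _ Y) pi (fun y => iffLR (iP y)) psii wdE.
by exists (PMod PK), f; exists wd.
Qed.

(** Lift HX -> TX -> TY along HY -> TY and restrict to the kernels X -> Y. *)
Lemma shift_full (X Y : SC) (g : Hom (shiftF P L X) (shiftF P L Y)) :
  exists f : Hom X Y, fmap (shiftF P L) f === g.
Proof.
have [psi psiE] := free_lift (g \o Tquo L X).
have ex x : exists y, psi (xi x) = xi y.
  by apply: Tquo_ker; rewrite psiE /= Tquo_lamid linear0.
have [f fE] := factor_inj (i := lamid L (M := Y)) (g := psi \o lamid L (M := X)) (@lamid_inj _ _ _ L Y) ex.
have [e eE] : exists e : {linear Tmod L X -> HM Y}, forall t, e (Tquo L X t) = hmap H^o f t - psi t.
  apply: (@factor_surj _ _ _ _ (Tquo L X) (hmap H^o f \- psi)); first exact: Tquo_surj.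
  by move=> t /Tquo_ker[x ->]; rewrite /= hmap_lamid fE subrr.
exists f.
apply: (@stab_eq_through (shiftF P L X) (shiftF P L Y) (hmap (HmodL L) f) g Y e (Tquo L Y)) => z.
have [t <-] := @Tquo_surj _ _ _ L X z.
rewrite /= Tquo_nat eE linearB psiE /=.
by rewrite addrC subrK.
Qed.

(** A homotopy for Tf - Tg lifts to HTX -> HY; subtracting it from H (x) f -
    H (x) g gives a map into the kernel Y of HY -> TY, which is a homotopy
    for f - g. *)
Lemma shift_faithful (X Y : SC) (f g : Hom X Y) :
  fmap (shiftF P L) f === fmap (shiftF P L) g -> f === g.
Proof.
move=> /stab_eqP[h hE]; have [psi psiE] := free_lift h.
pose d : {linear HM X -> HM Y} := hmap H^o f \- hmap H^o g \- (psi \o lamid L (M := Tmod L X) \o Tquo L X).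
have ex t : exists y, d t = xi y.
  apply: Tquo_ker; rewrite /d /= !linearB /= -!Tquo_nat psiE.
  by have := hE (Tquo L X t); rewrite /= => ->; rewrite addrAC addrK subrr.
have [kk kE] := factor_inj (i := lamid L (M := Y)) (g := d) (@lamid_inj _ _ _ L Y) ex.
apply/stab_eqP; exists kk => x.
have -> : kk (xi x) = f x - g x.
  apply: (@lamid_inj _ _ _ L Y); rewrite [LHS]kE /d /= !hmap_lamid Tquo_lamid.
  by rewrite (linear0 (lamid L (M := Tmod L X))) (linear0 psi) subr0 linearB.
by rewrite addrC subrK.
Qed.

(** Y -> C -> TX is a short exact sequence along which xi extends, by H (x)
    u on the image of H (x) X; so [conflation_dist] applies to it. *)
Lemma cone_rotate (X Y C : pmod P) (u : {linear X -> Y}) (v : {linear Y -> C})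
    (ub : {linear HM X -> C}) (w : {linear C -> Tmod L X}) : cone_of u v ub w ->
  exists psi : {linear C -> HM Y},
  [/\ forall z, exists y, w y = z, forall y, w y = 0 -> exists x, y = v x,
      forall x, w (v x) = 0, forall x, psi (v x) = xi x
    & forall y, hmap (HmodL L) u (w y) = qu (psi y)].
Proof.
move=> cu; have [c1 c2 c3 c4 c5] := cu.
have [psi [p1 p2]] : exists psi : {linear C -> HM Y},
   (forall s, psi (ub s) = hmap H^o u s) /\ (forall y, psi (v y) = xi y).
  by apply: (cone_map (b := lamid L (M := Y)) cu) => x; exact: hmap_lamid.
exists psi; split=> //.
- by move=> z; have [s <-] := Tquo_surj z; exists (ub s).
- move=> y; have [s [y' ->]] := c2 y; rewrite linearD c4 c5 addr0 => /Tquo_ker[x ->].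
  by exists (u x + y'); rewrite c1 linearD.
- apply: (@cone_eq _ _ _ _ _ _ _ _ (hmap (HmodL L) u \o w) (Tquo L Y \o psi) cu) => [s|y] /=.
    by rewrite c5 p1 Tquo_nat.
  by rewrite c4 p2 Tquo_lamid linear0.
Qed.

(** A homotopy h between b u and u' a is absorbed by adding v' h on the
    image of H (x) X. *)
Lemma cone_morph (X Y C X' Y' C' : pmod P) (u : {linear X -> Y}) (v : {linear Y -> C})
    (ub : {linear HM X -> C}) (w : {linear C -> Tmod L X})
    (u' : {linear X' -> Y'}) (v' : {linear Y' -> C'})
    (ub' : {linear HM X' -> C'}) (w' : {linear C' -> Tmod L X'}) :
  cone_of u v ub w -> cone_of u' v' ub' w' ->
  @extends SC (shiftF P L) X Y C u v w X' Y' C' u' v' w'.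
Proof.
move=> cu cu' a b /stab_eqP[h hE]; have [c1 c2 c3 c4 c5] := cu; have [c1' c2' c3' c4' c5'] := cu'.
have [c [cub cv]] : exists c : {linear C -> C'},
    (forall s, c (ub s) = ub' (hmap H^o a s) + v' (h s)) /\ (forall y, c (v y) = v' (b y)).
  apply: (cone_map (a := (ub' \o hmap H^o a) \+ (v' \o h)) (b := v' \o b) cu) => x.
  by rewrite /= hmap_lamid c1' -linearD; have := hE x; rewrite /= => ->.
exists c; split; first exact: stab_eq1.
apply: stab_eq1.
apply: (@cone_eq _ _ _ _ _ _ _ _ (hmap (HmodL L) a \o w) (w' \o c) cu) => [s|y] /=.
  by rewrite c5 cub linearD c5' c4' addr0 Tquo_nat.
by rewrite c4 cv c4' linear0.
Qed.

#[global] Instance stab_quasi_triangulated : quasi_triangulated (stab P L).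
Proof.
split.
- exact: stab_additive.
- exact: shiftF_additive.
- exact: shift_full.
- exact: shift_faithful.
- exact: shift_esurj.
- move=> X Y Z u v w X' Y' Z' u' v' w' [X0 [Y0 [Z0 [u0 [v0 [w0 [st i0]]]]]]] i.
  exists X0, Y0, Z0, u0, v0, w0; split=> //; exact: (iso_tri_trans (T := shiftF P L) i0 i).
- move=> X Z Z0; have ZZ : @is_zero SC Z by exact: Z0.
  have [C [v [ub [w cu]]]] := cone_exists (idfun : {linear X -> X}); have [c1 c2 c3 c4 c5] := cu.
  exists X, X, C, idfun, v, w; split; first exact: cone_std cu.
  have [r [rub rv]] : exists r : {linear C -> HM X}, (forall s, r (ub s) = s) /\ (forall y, r (v y) = xi y).
    by apply: (cone_map (a := idfun) cu).
  have CC : @is_zero SC C.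
    apply: (@stab_eq_through _ _ _ _ _ r ub) => z.
    apply: (@cone_eq _ _ _ _ _ _ _ _ idfun (\0 \+ (ub \o r)) cu) z => [s|y] /=; rewrite add0r ?rub //.
    by rewrite rv c1.
  exists (idm (X : SC)), (idm (X : SC)), (@zerom SC C Z); split; split; try exact: iso_id.
  + exists (@zerom SC Z C); split; first by rewrite comp0m; symmetry.
    by rewrite comp0m; symmetry.
  + exact: stab_eq1.
  + by rewrite (ac_idr _) comp0m.
  + by rewrite compm0; apply: zero_to.
- move=> X Y u; have [C [v [ub [w cu]]]] := cone_exists u.
  exists C, v, w; exact: cone_dist cu.
- move=> X Y Z u v w /dist_cone[X' [Y' [C [u' [v' [ub [w' [cu i]]]]]]]].
  have [psi [p1 p2 p3 p4 p5]] := cone_rotate cu.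
  have [X0 [Y0 [Z0 [u0 [v0 [w0 [st i0]]]]]]] :=
    @conflation_dist Y' C (shiftF P L X') v' w' psi (hmap (HmodL L) u') p1 p2 p3 p4 p5.
  exists X0, Y0, Z0, u0, v0, w0; split=> //.
  exact: (iso_tri_trans (T := shiftF P L) i0 (iso_tri_rotate (T := shiftF P L) i)).
- move=> X Y Z u v w X' Y' Z' u' v' w' a b.
  move=> /dist_cone[X0 [Y0 [C0 [u0 [v0 [ub0 [w0 [cu0 i0]]]]]]]].
  move=> /dist_cone[X1 [Y1 [C1 [u1 [v1 [ub1 [w1 [cu1 i1]]]]]]]].
  exact: (extends_transport (T := shiftF P L) i0 i1 (cone_morph cu0 cu1)).
Qed.
End StableCategory.

(** * The octahedral axiom for stable module categories *)

Section StableOctahedron.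
Variables (k : fieldType) (H : fdHopf k) (A : comodAlg H) (L : lintegral H).
Variable P : modclass A.
Notation xi := (lamid L (M := _)).
Notation HM := (hten H^o).
Notation SC := (stabcat P).

(** Up to stable isomorphism v may be replaced by (xi, v) : Y -> HY x Z,
    along which xi extends, so that its cokernel is its cone. The octahedron
    is then given by maps of modules, and its third triangle is again a
    short exact sequence along which xi extends. *)
Theorem stab_triangulated : triangulated (stab P L).
Proof.
have Ca : additive_category SC by exact: (stab_additive L).
apply: quasi_triangulated_triangulated => X Y Z u v.
pose Z1 := PMod (mc_sum (mc_tensor (pmodP Y)) (pmodP Z)).
pose v1 : {linear Y -> Z1} :=
  (mklin (@inl_linear _ _ _ (HM Y) Z) \o lamid L (M := Y)) \+ (mklin (@inr_linear _ _ _ (HM Y) Z) \o v).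
have v1E y : v1 y = (xi y, v y) by congr (_, _); [exact: addr0|exact: add0r].
pose ps : {linear Z1 -> HM Y} := fst.
have psE y : ps (v1 y) = xi y by rewrite v1E.
have [Q [p [sp pP]]] := coker_exists v1.
have PQ : P Q by exact: (mc_quotient sp (pmodP Z1)).
have pv y : p (v1 y) = 0 by apply/pP; exists y.
have [wv wvE] : exists wv : {linear Q -> Tmod L Y}, forall z, wv (p z) = Tquo L Y (ps z).
  apply: (@factor_surj _ _ _ _ p (Tquo L Y \o ps)) => // z /pP[y ->].
  by rewrite /= [X in Tquo L Y X](psE y) Tquo_lamid.
have [C [i [ub [i' cu]]]] := cone_exists L u.
have [D [l [ub' [l' cd]]]] := cone_exists L (v1 \o u).
have [c1 c2 c3 c4 c5] := cu; have [d1 d2 d3 d4 d5] := cd.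
have [f [f1 f2]] : exists f : {linear C -> D},
    (forall s, f (ub s) = ub' s) /\ (forall y, f (i y) = l (v1 y)).
  exact: (cone_map (a := ub') (b := l \o v1) cu).
have [g [g1 g2]] : exists g : {linear D -> Q},
    (forall s, g (ub' s) = 0) /\ (forall z, g (l z) = p z).
  by apply: (cone_map (a := \0) (b := p) cd) => x; rewrite [RHS]pv.
have [ps' [q1 q2]] : exists ps' : {linear D -> HM C},
    (forall s, ps' (ub' s) = xi (ub s)) /\ (forall z, ps' (l z) = hmap H^o i (ps z)).
  apply: (cone_map (a := lamid L (M := C) \o ub) (b := hmap H^o i \o ps) cd) => x.
  by rewrite -[RHS]/(hmap H^o i (ps (v1 (u x)))) psE hmap_lamid /= c1.
have [m [m1 m2]] : exists m : {linear D -> HM Y},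
    (forall s, m (ub' s) = hmap H^o u s) /\ (forall z, m (l z) = ps z).
  apply: (cone_map (a := hmap H^o u) (b := ps) cd) => x.
  by rewrite [RHS]psE /= hmap_lamid.
have gf z : g (f z) = 0.
  apply: (@cone_eq _ _ _ _ _ _ _ _ _ _ _ _ (g \o f) \0 cu) z => [s|y] /=; first by rewrite f1 g1.
  by rewrite f2 g2 pv.
have dfg : @stab_dist _ _ _ P L C D (PMod PQ) f g (\- (hmap (HmodL L) i \o wv)).
  apply: (@conflation_dist _ _ _ _ _ C D (PMod PQ) f g ps') => //.
  - by move=> z; have [y <-] := sp z; exists (l y).
  - move=> y; have [s [z ->]] := d2 y; rewrite linearD g1 g2 add0r => /pP[x ->].
    by exists (ub s + i x); rewrite [RHS]linearD f1 f2.
  - apply: (@cone_eq _ _ _ _ _ _ _ _ _ _ _ _ (ps' \o f) (lamid L (M := C)) cu) => [s|y] /=.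
      by rewrite f1 q1.
    by rewrite f2 q2 psE hmap_lamid.
  - apply: (@cone_eq _ _ _ _ _ _ _ _ _ _ _ _ (hmap (HmodL L) i \o wv \o g) (Tquo L C \o ps') cd) => [s|z] /=.
      by rewrite g1 q1 Tquo_lamid !linear0.
    by rewrite g2 q2 wvE Tquo_nat.
pose jv : {linear Q -> Tmod L Y} := \- wv.
exists X, Y, Z1, (PMod PQ), D, C, u, v1, i, i', p, jv, l, l'.
exists (idm (X : SC)), (idm (Y : SC)), (snd : {linear (HM Y * Z)%type -> Z}); split; first split.
- exact: iso_id.
- exact: iso_id.
- exists (mklin (@inr_linear _ _ _ (HM Y) Z)); split; last exact: (stab_eq1 L).
  apply: ac_sym; apply: (@stab_eq_through _ _ _ _ Z1 Z1 _ _ Y ps (mklin (@inl_linear _ _ _ (HM Y) Z))) => -[s z].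
  by congr (_, _); rewrite /= ?add0r ?addr0.
- exact: (stab_eq1 L).
- by apply: (stab_eq1 L) => y; rewrite /= add0r.
split.
- exact: cone_dist cu.
- apply: (@conflation_dist _ _ _ _ _ Y Z1 (PMod PQ) v1 p ps) => //.
  by move=> z /pP.
- exact: cone_dist cd.
exists f, g; split.
- apply: (dist_eq (C := stab P L) dfg) => //.
  by apply: (stab_eq1 L) => z; rewrite /= linearN.
- by apply: (stab_eq1 L) => y; rewrite /= f2.
- apply: (stab_eq1 L); apply: (@cone_eq _ _ _ _ _ _ _ _ _ _ _ _ (l' \o f) i' cu) => [s|y] /=.
    by rewrite f1 d5 c5.
  by rewrite f2 d4 c4.
- exact: (stab_eq1 L).
- apply: ac_sym.
  apply: (@stab_eq_through _ _ _ _ D (shiftF P L Y) (hmap (HmodL L) u \o l') ((\- wv) \o g) Y m (Tquo L Y)) => z.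
  apply: (@cone_eq _ _ _ _ _ _ _ _ _ _ _ _ (hmap (HmodL L) u \o l') (((\- wv) \o g) \+ (Tquo L Y \o m)) cd) z => [s|z] /=.
    by rewrite d5 g1 m1 Tquo_nat linear0 oppr0 add0r.
  by rewrite d4 g2 m2 wvE addNr linear0.
Qed.
End StableOctahedron.

(** * Exact functors from functors of modules *)

(** Additive right exact functors with a natural comparison [mf_swap] that
    carries F(xi) to xi, and with relatively injective values on H (x) Q.
    This much forces exactness on stable categories, and V (x) -, - (x) M
    and restriction to H share it. *)
Record module_functor (k : fieldType) (H : fdHopf k) (L : lintegral H) (A A' : comodAlg H) := ModuleFunctor {
  mf_ob :> lmodType A -> lmodType A';
  mf_map : forall M N : lmodType A, {linear M -> N} -> {linear mf_ob M -> mf_ob N};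
  mf_id : forall (M : lmodType A) (f : {linear M -> M}), f =1 id -> mf_map f =1 id;
  mf_comp : forall (M N Q : lmodType A) (g : {linear N -> Q}) (f : {linear M -> N}) (h : {linear M -> Q}),
    (forall x, h x = g (f x)) -> forall t, mf_map h t = mf_map g (mf_map f t);
  mf_add : forall (M N : lmodType A) (f g h : {linear M -> N}),
    (forall x, h x = f x + g x) -> forall t, mf_map h t = mf_map f t + mf_map g t;
  mf_surj : forall (M N : lmodType A) (p : {linear M -> N}),
    (forall n, exists m, p m = n) -> forall t, exists s, mf_map p s = t;
  mf_exact : forall (M N Q : lmodType A) (i : {linear M -> N}) (p : {linear N -> Q}),
    (forall n, exists m, p m = n) -> (forall y, p y = 0 -> exists x, y = i x) ->
    forall t, mf_map p t = 0 -> exists s, t = mf_map i s;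
  mf_swap : forall X : lmodType A, {linear mf_ob (hten H^o X) -> hten H^o (mf_ob X)};
  mf_swap_lamid : forall (X : lmodType A) t, mf_swap X (mf_map (lamid L (M := X)) t) = lamid L t;
  mf_swap_nat : forall (X Y : lmodType A) (f : {linear X -> Y}) t,
    mf_swap Y (mf_map (hmap H^o f) t) = hmap H^o (mf_map f) (mf_swap X t);
  mf_split : forall Q : lmodType A,
    exists r : {linear hten H^o (mf_ob (hten H^o Q)) -> mf_ob (hten H^o Q)},
      forall t, r (lamid L t) = t }.

Section ModuleFunctors.
Variables (k : fieldType) (H : fdHopf k) (L : lintegral H) (A A' : comodAlg H).
Variables (F : module_functor L A A') (P : modclass A) (P' : modclass A').
Hypothesis PF : forall M : lmodType A, P M -> P' (F M).
Notation xi := (lamid L (M := _)).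
Notation mm f := (mf_map F f).

Definition stab_functor : prefunctor (stab P L) (stab P' L) :=
  @PreFunctor (stab P L) (stab P' L) (fun M : pmod P => PMod (PF (pmodP M)))
    (fun (M N : pmod P) (f : {linear M -> N}) => mm f).

Lemma mf_zero (M N : lmodType A) (f : {linear M -> N}) : (forall x, f x = 0) -> forall t, mm f t = 0.
Proof.
move=> f0 t; apply: (addrI (mm f t)); rewrite addr0; symmetry.
by apply: mf_add => x; rewrite f0 addr0.
Qed.

#[global] Instance stab_functor_additive : additive_functor stab_functor.
Proof.
split.
- move=> X Y f g /(stab_eqP L)[h e].
  have [r rE] := mf_split F X.
  apply/(stab_eqP L); exists (mm h \o r \o hmap H^o (mm (lamid L (M := X)))) => x.
  rewrite /= hmap_lamid rE -(@mf_comp _ _ _ _ _ F _ _ _ h (lamid L (M := X)) (h \o lamid L (M := X))) //.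
  exact: mf_add.
- by move=> X; apply: (stab_eq1 L); exact: mf_id.
- by move=> X Y Z g f; apply: (stab_eq1 L); exact: mf_comp.
- by move=> X Y f g; apply: (stab_eq1 L); exact: mf_add.
Qed.

Lemma mf_theta (X : lmodType A) : exists th : {linear F (Tmod L X) -> Tmod L (F X)},
  forall t, th (mm (Tquo L X) t) = Tquo L (F X) (mf_swap F X t).
Proof.
apply: (@factor_surj _ _ _ _ (mm (Tquo L X)) (Tquo L (F X) \o mf_swap F X)).
  by apply: mf_surj; exact: Tquo_surj.
move=> t t0; have [s ->] := mf_exact (i := lamid L (M := X)) (@Tquo_surj _ _ _ L X) (@Tquo_ker _ _ _ L X) t0.
by rewrite /= mf_swap_lamid Tquo_lamid.
Qed.

Definition mf_th (X : lmodType A) := projT1 (cid (mf_theta X)).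
Lemma mf_thE X t : mf_th X (mm (Tquo L X) t) = Tquo L (F X) (mf_swap F X t).
Proof. exact: projT2 (cid (mf_theta X)) t. Qed.

Lemma mf_th_nat (X Y : lmodType A) (f : {linear X -> Y}) z :
  mf_th Y (mm (hmap (HmodL L) f) z) = hmap (HmodL L) (mm f) (mf_th X z).
Proof.
have [t <-] := mf_surj (@Tquo_surj _ _ _ L X) z.
rewrite -(@mf_comp _ _ _ _ _ F _ _ _ (hmap (HmodL L) f) (Tquo L X) (hmap (HmodL L) f \o Tquo L X)) //.
rewrite (@mf_comp _ _ _ _ _ F _ _ _ (Tquo L Y) (hmap H^o f)); last by move=> x /=; rewrite Tquo_nat.
by rewrite !mf_thE mf_swap_nat Tquo_nat.
Qed.

Definition stab_th (X : stab P L) :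
  @Hom (stab P' L) (stab_functor (shift (stab P L) X)) (shift (stab P' L) (stab_functor X)) := mf_th X.

(** F(X) -> F(HX) -> F(TX) is a short exact sequence along which xi extends,
    with relatively injective middle term. *)
Lemma mf_th_iso (X : pmod P) : @is_iso (stabcat P') (stab_functor (shiftF P L X)) (shiftF P' L (stab_functor X)) (mf_th X).
Proof.
have [r rE] := mf_split F X.
apply: (@conflation_connecting_iso _ _ _ L P' (stab_functor X) (stab_functor (shiftF P L X)) _ r
   (mm (lamid L (M := X))) (mm (Tquo L X)) (mf_swap F X)) => //.
- by apply: mf_surj; exact: Tquo_surj.
- move=> x; rewrite -(@mf_comp _ _ _ _ _ F _ _ _ (Tquo L X) (lamid L (M := X)) (Tquo L X \o lamid L (M := X))) //.
  by apply: mf_zero => y; exact: Tquo_lamid.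
- exact: (mf_exact (i := lamid L (M := X)) (@Tquo_surj _ _ _ L X) (@Tquo_ker _ _ _ L X)).
- exact: mf_swap_lamid.
- exact: mf_thE.
Qed.

(** The rotation of a standard triangle is a short exact sequence along
    which xi extends, and the functor preserves these; rotating backwards
    gives the image of the triangle. The rotation is needed because F(HX)
    differs from H (x) F(X), so that the image of a standard triangle is not
    itself standard. *)
Theorem stab_functor_exact : exact_functor stab_functor.
Proof.
split; first exact: stab_functor_additive.
have nat (X Y : stab P L) (f : Hom X Y) :
    stab_th Y \oc fmap stab_functor (fmap (shift (stab P L)) f) ===
    fmap (shift (stab P' L)) (fmap stab_functor f) \oc stab_th X.
  by apply: (stab_eq1 L) => z; exact: mf_th_nat.
exists stab_th; split; [exact: mf_th_iso|exact: nat|].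
move=> X Y Z u v w /dist_cone[X' [Y' [C [u' [v' [ub [w' [cu i]]]]]]]].
have [psi [p1 p2 p3 p4 p5]] := cone_rotate cu.
have d1 : @stab_dist _ _ _ P' L (stab_functor Y') (stab_functor C) (stab_functor (shiftF P L X'))
    (mm v') (mm w') (\- (mf_th Y' \o mm (hmap (HmodL L) u'))).
  apply: (@conflation_dist _ _ _ L P' (stab_functor Y') (stab_functor C) (stab_functor (shiftF P L X'))
    (mm v') (mm w') (mf_swap F Y' \o mm psi)).
  - exact: mf_surj.
  - exact: mf_exact.
  - move=> x; rewrite -(@mf_comp _ _ _ _ _ F _ _ _ w' v' (w' \o v')) //.
    exact: mf_zero.
  - move=> x /=; rewrite -(@mf_comp _ _ _ _ _ F _ _ _ psi v' (lamid L (M := Y'))) //.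
    exact: mf_swap_lamid.
  - move=> y /=; rewrite -mf_thE; congr (mf_th _ _).
    rewrite -(@mf_comp _ _ _ _ _ F _ _ _ (hmap (HmodL L) u') w' (hmap (HmodL L) u' \o w')) //.
    exact: mf_comp.
have d2 : @dist (stab P' L) (stab_functor X') (stab_functor Y') (stab_functor C)
    (mm u') (mm v') (stab_th X' \oc (mm w' : @Hom (stab P' L) (stab_functor C) (stab_functor (shift (stab P L) X')))).
  apply: dist_unrotate; apply: (qt_iso (stab_quasi_triangulated L P') d1).
  exists (idm _), (idm _), (stab_th X'); split; split; try exact: iso_id.
  + exact: mf_th_iso.
  + exact: (stab_eq1 L).
  + exact: (stab_eq1 L).
  + apply: (stab_eq1 L) => z /=; rewrite mf_th_nat.
    exact: hmap_id.
have [a [b [c [[ia ib ic] [e1 e2 e3]]]]] := i.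
apply: (qt_iso (stab_quasi_triangulated L P') d2).
exists (fmap stab_functor a), (fmap stab_functor b), (fmap stab_functor c).
have Fa := stab_functor_additive.
split; split; try exact: fmap_iso.
- have := af_eq Fa e1; rewrite !(af_comp Fa); exact.
- have := af_eq Fa e2; rewrite !(af_comp Fa); exact.
- have e3' := af_eq Fa e3; rewrite !(af_comp Fa) in e3'.
  rewrite (ac_compA _) -nat -!(ac_compA _).
  exact: (ac_comp (stab_additive L P') (ac_refl (stab_additive L P') _) e3').
Qed.
End ModuleFunctors.

(** * Tensoring and restriction as functors of modules *)

Section TensorFunctors.
Variables (k : fieldType) (H : fdHopf k) (L : lintegral H) (A : comodAlg H).

Definition tensor_functor (V : lmodType H) : module_functor L A A :=
  @ModuleFunctor k H L A A (fun M => hten V M) (fun M N f => hmap V f)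
    (@hmap_id _ _ _ V) (@hmap_comp _ _ _ V) (@hmap_add _ _ _ V) (@hmap_surj _ _ _ V) (@hmap_exact _ _ _ V)
    (hswap L V) (@hswap_lamid _ _ _ L V) (@hswap_nat _ _ _ L V) (tensor_free_split L V).

Lemma hassoc_swap_lamid (M : lmodType A) (V : lmodType H) (t : hten V M) :
  hassoc H^o V M (hmapl M (lamid L (A := hopf_comod H) (M := V)) t) = lamid L t.
Proof.
refine (@hten_linear_eq _ _ _ _ _ _ (hassoc H^o V M \o hmapl M (lamid L (A := hopf_comod H) (M := V))) (lamid L (M := hten V M)) _ t) => {t} v m.
by rewrite /= hmapl_pure [in LHS]/lamid hassoc_pure.
Qed.

Lemma hassoc_swap_nat (M : lmodType A) (V W : lmodType H) (f : {linear V -> W}) t :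
  hassoc H^o W M (hmapl M (hmap (A := hopf_comod H) H^o f) t) = hmap H^o (hmapl M f) (hassoc H^o V M t).
Proof.
refine (@hten_linear_eq3l _ _ _ _ _ _ _ (hassoc H^o W M \o hmapl M (hmap (A := hopf_comod H) H^o f)) (hmap H^o (hmapl M f) \o hassoc H^o V M) _ t) => {t} h v m.
by rewrite /= hmapl_pure hassoc_pure /= hmap_pure hassoc_pure hmap_pure /= hmapl_pure.
Qed.

Lemma hassocK (V W : lmodType H) (M : lmodType A) : cancel (hassoc V W M) (hassocV V W M).
Proof.
refine (@hten_linear_eq3l _ _ _ _ _ _ _ (hassocV V W M \o hassoc V W M) idfun _) => v w m.
by rewrite /= hassoc_pure hassocV_pure.
Qed.
Lemma hassocVK (V W : lmodType H) (M : lmodType A) : cancel (hassocV V W M) (hassoc V W M).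
Proof.
refine (@hten_linear_eq3 _ _ _ _ _ _ _ (hassoc V W M \o hassocV V W M) idfun _) => v w m.
by rewrite /= hassocV_pure hassoc_pure.
Qed.

Lemma tensor_right_split (M : lmodType A) (Q : lmodType H) :
  exists r : {linear hten H^o (hten (hten H^o Q) M) -> hten (hten H^o Q) M},
    forall t, r (lamid L t) = t.
Proof.
have [r rE] := free_split L (hten Q M).
exists (hassocV H^o Q M \o r \o hmap H^o (hassoc H^o Q M)) => t.
apply: etrans (congr1 (fun e => hassocV H^o Q M (r e)) (@hmap_lamid _ _ _ L _ _ (hassoc H^o Q M) t)) _.
by rewrite rE; exact: hassocK.
Qed.

Definition tensor_right_functor (M : lmodType A) : module_functor L (hopf_comod H) A :=
  @ModuleFunctor k H L (hopf_comod H) A (fun V => hten V M) (fun V W f => hmapl M f)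
    (@hmapl_id _ _ _ M) (@hmapl_comp _ _ _ M) (@hmapl_add _ _ _ M) (@hmapl_surj _ _ _ M) (@hmapl_exact _ _ _ M)
    (fun V => hassoc H^o V M) (@hassoc_swap_lamid M) (@hassoc_swap_nat M) (tensor_right_split M).
End TensorFunctors.

Section Restriction.
Variables (k : fieldType) (H : fdHopf k) (B : modAlg H).
Notation AB := (smash_comod B).
Notation res M := (restr (smash_incl B) (M : lmodType AB)).

Lemma smash_incl_kunit (c : k) : smash_incl B (kunit H c) = kunit (smash_alg B) c.
Proof.
rewrite /smash_incl /spure /= /skunit /sone /spure -(bilinZl (@pure_bilin _ (uvs H) (uvs B))).
by congr (_ \ot _); exact: kunit_scale.
Qed.

(** The modules V (x) res M and res (V (x) M) have the same underlying tensors,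
    but k acts on the second factor through H in the one and through A in the
    other; [iota] is the identity on pure tensors. *)
Section Iota.
Variables (V : lmodType H) (M : lmodType AB).

Lemma restr_scaleE (c : k) (m : M) :
  c *: (m : ksp (res M : lmodType H)) = (c *: (m : ksp M) : M).
Proof. by rewrite [LHS](congr1 (fun e : AB => e *: m) (smash_incl_kunit c)). Qed.

Lemma smash_act_pure (h : H) (v : V) (m : M) :
  (h *: (hpure v m : res (hten V M)) : res (hten V M)) =
  sw x y <- h, (hpure ((x : H) *: v) ((smash_incl B y : AB) *: m) : ksp (hten V M)).
Proof.
transitivity ((smash_incl B h : AB) *: (hpure v m : hten V M)); first by [].
rewrite hpureE -[coact AB _]/(scoact (supure (B := B) h (uone B))).
rewrite scoact_pure [LHS]linear_tlift; last first.
  by apply: tlift_is_linear; hlin.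
by apply: tlift_eq => x y; rewrite tlift_pure //; hlin.
Qed.

Definition iotaV_fun (v : V) (m : res M) : res (hten V M) := hpure v (m : M).

Fact iotaV_bilin : @bilin k (ksp V) (ksp (res M : lmodType H)) (ksp (res (hten V M) : lmodType H)) iotaV_fun.
Proof.
have Z c (x : hten V M) : c *: (x : ksp (res (hten V M) : lmodType H)) = c *: (x : ksp (hten V M)).
  exact: (congr1 (fun e : AB => e *: x) (smash_incl_kunit c)).
split=> [m|v] c x y; rewrite /iotaV_fun.
  by rewrite Z; exact: ((hpure_bilin V M).1 m c x y).
by rewrite Z restr_scaleE; exact: ((hpure_bilin V M).2 v c x y).
Qed.

Fact iotaV_balanced (h : H) (v : V) (m : res M) :
  tlift (W := ksp (res (hten V M) : lmodType H)) (fun (a : uvs H) (b : uvs H) => iotaV_fun ((a : H) *: v) ((b : H) *: m)) (Delta H h)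
  = h *: iotaV_fun v m.
Proof. by rewrite [RHS]smash_act_pure; apply: tlift_eq. Qed.

Definition iotaV : {linear hten V (res M) -> res (hten V M)} :=
  locked (mklin (@htlift_linear k H (hopf_comod H) V (res M) (res (hten V M)) iotaV_fun iotaV_bilin iotaV_balanced)).
Lemma iotaV_pure v m : iotaV (hpure v m) = hpure v (m : M).
Proof. by rewrite /iotaV -lock /= htlift_pure //; exact: iotaV_bilin. Qed.

Definition iota_fun (t : res (hten V M)) : hten V (res M) :=
  @tlift k (ksp V) (ksp M) (tensor (ksp V) (ksp (res M : lmodType H))) (fun v m => hpure v (m : res M)) t.
Fact iota_bilin : @bilin k (ksp V) (ksp M) (tensor (ksp V) (ksp (res M : lmodType H))) (fun v m => hpure v (m : res M)).
Proof.
split=> [m|v] c x y.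
  exact: ((@pure_bilin k (ksp V) (ksp (res M : lmodType H))).1 m c x y).
have := (@pure_bilin k (ksp V) (ksp (res M : lmodType H))).2 v c x y.
by rewrite restr_scaleE.
Qed.
Lemma iota_funD x y : iota_fun (x + y) = iota_fun x + iota_fun y.
Proof. exact: (tliftD iota_bilin). Qed.
Lemma iota_fun_pure (v : V) (m : M) : iota_fun (hpure v m) = hpure v (m : res M).
Proof. exact: (tlift_pure iota_bilin). Qed.
Lemma iota_funK : cancel iota_fun iotaV.
Proof.
apply: (@hten_additive_eq _ _ _ V M _ (iotaV \o iota_fun) id) => [x y|x y|v m] //=.
  by rewrite iota_funD raddfD.
by rewrite iota_fun_pure iotaV_pure.
Qed.
Lemma iotaV_funK : cancel iotaV iota_fun.
Proof.
apply: (@hten_additive_eq _ _ _ V (res M) _ (iota_fun \o iotaV) id) => [x y|x y|v m] //=.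
  by rewrite raddfD iota_funD.
by rewrite iotaV_pure iota_fun_pure.
Qed.
Fact iota_linear : linear iota_fun.
Proof.
by move=> a x y; apply: (can_inj iotaV_funK); rewrite linearP !iota_funK.
Qed.
Definition iota : {linear res (hten V M) -> hten V (res M)} := locked (mklin iota_linear).
Lemma iotaE t : iota t = iota_fun t. Proof. by rewrite /iota -lock. Qed.
Lemma iota_pure (v : V) (m : M) : iota (hpure v m) = hpure v (m : res M).
Proof. by rewrite iotaE iota_fun_pure. Qed.
Lemma iotaK : cancel iota iotaV. Proof. by move=> t; rewrite iotaE iota_funK. Qed.
Lemma iotaVK : cancel iotaV iota. Proof. by move=> t; rewrite iotaE iotaV_funK. Qed.
End Iota.

Lemma iota_nat V (M N : lmodType AB) (f : {linear M -> N}) t :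
  iota V N (hmap V f t) = hmap V (@restr_map _ _ (smash_incl B) M N f : {linear res M -> res N}) (iota V M t).
Proof.
apply: (@hten_additive_eq _ _ _ V M _ (fun t => iota V N (hmap V f t))
  (fun t => hmap V (@restr_map _ _ (smash_incl B) M N f : {linear res M -> res N}) (iota V M t))) => [x y|x y|v m].
- by rewrite [hmap V f _]raddfD (raddfD (iota V N)).
- by rewrite (raddfD (iota V M)) raddfD.
- by rewrite hmap_pure !iota_pure hmap_pure.
Qed.

Variable L : lintegral H.

Lemma res_exact (M N Q : lmodType AB) (i : {linear M -> N}) (p : {linear N -> Q}) :
    (forall n, exists m, p m = n) -> (forall y, p y = 0 -> exists x, y = i x) ->
    forall t : res N, @restr_map _ _ (smash_incl B) _ _ p t = 0 -> exists s, t = @restr_map _ _ (smash_incl B) _ _ i s.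
Proof. by move=> _ e t /e. Qed.

Lemma iota_lamid (X : lmodType AB) t : iota H^o X (lamid L (M := X) t) = lamid L (t : res X).
Proof. exact: iota_pure. Qed.

Lemma res_split (Q : lmodType AB) :
    exists r : {linear hten H^o (res (hten H^o Q) : lmodType H) -> res (hten H^o Q)},
      forall t, r (lamid L t) = t.
Proof.
have [r rE] := free_split (A := hopf_comod H) L (res Q).
exists (iotaV H^o Q \o r \o hmap H^o (iota H^o Q)) => t.
apply: etrans (congr1 (fun e => iotaV H^o Q (r e)) (@hmap_lamid _ _ _ L _ _ (iota H^o Q) t)) _.
by rewrite rE; exact: iotaK.
Qed.

Definition res_functor : module_functor L AB (hopf_comod H) :=
  @ModuleFunctor k H L AB (hopf_comod H) (fun M => res M)
    (fun M N f => @restr_map _ _ (smash_incl B) M N f)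
    (fun M f e => e) (fun M N Q g f h e => e) (fun M N f g h e => e)
    (fun M N p s => s) res_exact
    (fun X => iota H^o X) iota_lamid (fun X Y f => iota_nat (V := H^o) f) res_split.
End Restriction.

(** * Grothendieck groups *)

Section GrothendieckGroups.

#[local] Instance keq_equiv (C : pretri) : Equivalence (@keq C).
Proof. split; [exact: keq_refl|exact: keq_sym|exact: keq_trans]. Qed.
#[local] Instance kadd_proper (C : pretri) :
  Proper (@keq C ==> @keq C ==> @keq C) (@kadd C).
Proof. by move=> x x' e y y' e'; exact: keq_add. Qed.
#[local] Instance kopp_proper (C : pretri) : Proper (@keq C ==> @keq C) (@kopp C).
Proof. by move=> x x' e; exact: keq_opp. Qed.
#[local] Hint Extern 0 (keq _ _) => reflexivity : core.

Section Group.
Variable C : pretri.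
Implicit Types x y z : kterm C.

Lemma kadd0r x : keq (kadd x kzero) x.
Proof. by rewrite keq_addC keq_add0. Qed.
Lemma kaddNr x : keq (kadd x (kopp x)) kzero.
Proof. by rewrite keq_addC keq_addN. Qed.
Lemma kadd_cancel x y z : keq (kadd x y) (kadd x z) -> keq y z.
Proof.
move=> e; rewrite -(keq_add0 y) -(keq_addN x) -keq_addA e.
by rewrite keq_addA keq_addN keq_add0.
Qed.
Lemma kaddACA x y z (t : kterm C) : keq (kadd (kadd x y) (kadd z t)) (kadd (kadd x z) (kadd y t)).
Proof.
rewrite -keq_addA [kadd y _]keq_addA [kadd y z]keq_addC -[kadd (kadd z y) t]keq_addA.
by rewrite keq_addA.
Qed.
Lemma koppD x y : keq (kopp (kadd x y)) (kadd (kopp x) (kopp y)).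
Proof. by apply: (kadd_cancel (x := kadd x y)); rewrite kaddNr kaddACA !kaddNr keq_add0. Qed.
Lemma kopp0 : keq (kopp kzero : kterm C) kzero.
Proof. by rewrite -[kopp kzero]keq_add0 kaddNr. Qed.

Lemma keq_zero_object (Ct : quasi_triangulated C) (Z : C) : is_zero Z -> keq (kgen Z : kterm C) kzero.
Proof.
move=> Z0; have d := keq_dist (qt_id Ct Z (zero_object Z0)).
by apply: (kadd_cancel (x := kgen Z)); rewrite -d kadd0r.
Qed.

(** The cone of an isomorphism is zero. *)
Lemma keq_iso (Ct : quasi_triangulated C) (X Y : C) (f : Hom X Y) : is_iso f ->
  keq (kgen X : kterm C) (kgen Y).
Proof.
move=> jf; have [Z [v [w d]]] := qt_cone Ct f.
by rewrite (keq_dist d) (keq_zero_object _ (iso_cone_zero d jf)) kadd0r.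
Qed.
End Group.

(** Relations in a Grothendieck group depend on the existence of some triangle
    on three objects, not on its maps. *)
Definition preserves_triangles (C D : pretri) (f : C -> D) : Prop :=
  forall (X Y Z : C) (u : Hom X Y) (v : Hom Y Z) (w : Hom Z (shift C X)), dist u v w ->
  exists (u' : Hom (f X) (f Y)) (v' : Hom (f Y) (f Z)) (w' : Hom (f Z) (shift D (f X))), dist u' v' w'.

Lemma exact_preserves (C D : pretri) (F : prefunctor C D) : exact_functor F -> preserves_triangles (fob F).
Proof.
move=> [_ [th [_ _ thd]]] X Y Z u v w /thd d.
by exists (fmap F u), (fmap F v), (th X \oc fmap F w).
Qed.

Lemma kright_keq (C D : pretri) (f : C -> D) : preserves_triangles f ->
  forall x y : kterm C, keq x y -> keq (kright f x : kterm D) (kright f y).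
Proof.
move=> pf x y; elim=> //=.
- by move=> *; symmetry.
- by move=> ? ? ? _ -> _ ->.
- by move=> ? ? ? ? _ -> _ ->.
- by move=> ? ? _ ->.
- by move=> *; exact: keq_addA.
- by move=> *; exact: keq_addC.
- by move=> *; exact: keq_add0.
- by move=> *; exact: keq_addN.
- by move=> X Y Z u v w /pf[u' [v' [w' d]]]; exact: keq_dist d.
Qed.

Section Biadditive.
Variables (C D E : pretri) (f : C -> D -> E).
Hypothesis fr : forall X, preserves_triangles (f X).
Hypothesis fl : forall Y, preserves_triangles (f^~ Y).
Notation kb := (kbil f).

Lemma kbil0r (x : kterm C) : keq (kb x kzero : kterm E) kzero.
Proof.
elim: x => //= [x IH y IH'|x IH]; first by rewrite IH IH' keq_add0.
by rewrite IH kopp0.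
Qed.
Lemma kbilDr (x : kterm C) (y y' : kterm D) : keq (kb x (kadd y y') : kterm E) (kadd (kb x y) (kb x y')).
Proof.
elim: x => //= [|x IH x' IH'|x IH]; first by rewrite keq_add0.
  by rewrite IH IH' kaddACA.
by rewrite IH koppD.
Qed.
Lemma kbilNr (x : kterm C) (y : kterm D) : keq (kb x (kopp y) : kterm E) (kopp (kb x y)).
Proof.
elim: x => //= [|x IH x' IH'|x IH]; first by rewrite kopp0.
  by rewrite IH IH' koppD.
by rewrite IH.
Qed.
Lemma kbil_genr (x : kterm C) (Y : D) : kb x (kgen Y) = kright (f^~ Y) x.
Proof. by elim: x => //= [x -> y ->|x ->]. Qed.

(** A relation in the right variable is moved through the generators on the
    left, and conversely. *)
Lemma kbil_keq (x x' : kterm C) (y y' : kterm D) : keq x x' -> keq y y' ->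
  keq (kb x y : kterm E) (kb x' y').
Proof.
move=> ex ey; transitivity (kb x y').
  elim: {x' ex} x => //= [X|x IH z IH'|x IH]; first exact: kright_keq ey.
    by rewrite IH IH'.
  by rewrite IH.
elim: {y ey} y' => [Y||y IH y' IH'|y IH].
- by rewrite !kbil_genr; exact: kright_keq ex.
- by rewrite !kbil0r.
- by rewrite !kbilDr IH IH'.
- by rewrite !kbilNr IH.
Qed.
End Biadditive.

Lemma kbil_assoc (C D E F G K : pretri) (f : C -> E -> F) (g : D -> G -> E) (h : C -> D -> K) (l : K -> G -> F) :
  (forall X Y Z, keq (kgen (f X (g Y Z)) : kterm F) (kgen (l (h X Y) Z))) ->
  forall x y z, keq (kbil f x (kbil g y z) : kterm F) (kbil l (kbil h x y) z).
Proof.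
move=> a x y z; elim: x => //= [X|x IH x' IH'|x IH]; last by rewrite IH.
  elim: y => //= [Y|y IH y' IH'|y IH]; last by rewrite IH.
    elim: z => //= [z IH z' IH'|z IH]; last by rewrite IH.
    by rewrite IH IH'.
  by rewrite IH IH'.
by rewrite IH IH'.
Qed.

Lemma kbil_unitl (C D : pretri) (f : C -> D -> D) (I : C) :
  (forall Y, keq (kgen (f I Y) : kterm D) (kgen Y)) ->
  forall y, keq (kbil f (kgen I) y : kterm D) y.
Proof. by move=> u y /=; elim: y => //= [y IH y' IH'|y IH]; rewrite ?IH ?IH'. Qed.

Lemma kbil_unitr (C D : pretri) (f : C -> D -> C) (I : D) :
  (forall Y, keq (kgen (f Y I) : kterm C) (kgen Y)) ->
  forall y, keq (kbil f y (kgen I) : kterm C) y.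
Proof. by move=> u y; elim: y => //= [y IH y' IH'|y IH]; rewrite ?IH ?IH'. Qed.
End GrothendieckGroups.

Section RightUnit.
Variables (k : fieldType) (H : fdHopf k) (V : lmodType H).

Fact hunitr_bilin : @bilin k (ksp V) (ksp (trivmod H)) (ksp V) (fun v c => (c : k) *: (v : ksp V)).
Proof.
split=> [c|v]; first by hlin.
by move=> a x y; rewrite trivZ scalerDl scalerA.
Qed.

Fact hunitr_balanced (a : H) (v : V) (c : trivmod H) :
  tlift (W := ksp V) (fun h b : uvs H => (((b : H) *: c : trivmod H) : k) *: ((h : H) *: v : ksp V)) (Delta H a)
  = a *: ((c : k) *: (v : ksp V) : V).
Proof.
rewrite -[RHS](@counitrE _ _ _ (fun e : uvs H => (e : H) *: ((c : k) *: (v : ksp V) : V) : ksp V)); last by hlin.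
apply: tlift_eq => x y; rewrite trivA -scalerA; congr (_ *: _).
exact: (esym (linfZ (@act_linr _ _ V x) _ _)).
Qed.

Definition hunitr : {linear hten V (trivmod H) -> V} :=
  locked (mklin (@htlift_linear k H (hopf_comod H) V (trivmod H) V _ hunitr_bilin hunitr_balanced)).
Lemma hunitr_pure v c : hunitr (hpure v c) = ((c : k) *: (v : ksp V) : V).
Proof. by rewrite /hunitr -lock /= htlift_pure //; exact: hunitr_bilin. Qed.

Fact hunitrV_linear : linear (fun v : V => hpure v (tone H) : hten V (trivmod H)).
Proof.
move=> a x y; rewrite (bilinDl (@hpure_bilin _ _ (hopf_comod H) V (trivmod H))); congr (_ + _).
rewrite hpureE -[coact _ a]/(Delta H a).
rewrite -[LHS](@counitrE _ _ _ (fun e : uvs H => hpure ((e : H) *: x) (tone H) : ksp (hten V (trivmod H)))); last by hlin.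
apply: tlift_eq => h b; rewrite -hpureZr; congr hpure.
by rewrite trivZ trivA.
Qed.
Definition hunitrV : {linear V -> hten V (trivmod H)} := locked (mklin hunitrV_linear).
Lemma hunitrVE v : hunitrV v = hpure v (tone H). Proof. by rewrite /hunitrV -lock. Qed.

Lemma hunitrVK : cancel hunitrV hunitr.
Proof. by move=> v; rewrite hunitrVE hunitr_pure; exact: (scale1r (v : ksp V)). Qed.
Lemma hunitrK : cancel hunitr hunitrV.
Proof.
apply: (@hten_linear_eq _ _ (hopf_comod H) _ _ _ (hunitrV \o hunitr) idfun) => v c.
rewrite /= hunitr_pure hunitrVE hpureZl -hpureZr; congr hpure.
by rewrite trivZ [LHS]mulr1.
Qed.
End RightUnit.

(** * The derived category of a smash product *)

Section TensorAction.
Variables (k : fieldType) (H : fdHopf k) (L : lintegral H) (A : comodAlg H) (P : modclass A).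
Notation KH := (stab (fdmod H) L).

Lemma tens_right_preserves (M : pmod P) :
  @preserves_triangles KH (stab P L) (fun V => tens_obj V M).
Proof.
have e := @stab_functor_exact _ _ L _ _ (tensor_right_functor L M) (fdmod H) P
  (fun V (PV : fdmod H V) => mc_findim PV (pmodP M)).
exact: (exact_preserves e).
Qed.

Lemma tens_left_preserves (V : pmod (fdmod H)) :
  @preserves_triangles (stab P L) (stab P L) (fun M => tens_obj V M).
Proof.
have e := @stab_functor_exact _ _ L _ _ (tensor_functor L A V) P P
  (fun M (PM : P M) => mc_findim (pmodP V) PM).
exact: (exact_preserves e).
Qed.

Lemma tens_assoc_iso (V W : pmod (fdmod H)) (M : pmod P) :
  @is_iso (stabcat P) (tens_obj V (tens_obj W M)) (tens_obj (tens_obj V W) M) (hassocV V W M).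
Proof.
exact: (@bij_iso _ _ _ L P (tens_obj V (tens_obj W M)) (tens_obj (tens_obj V W) M)
  (hassocV V W M) (hassoc V W M) (@hassocVK _ _ _ V W M) (@hassocK _ _ _ V W M)).
Qed.

Lemma tens_unit_iso (M : pmod P) : @is_iso (stabcat P) (tens_obj (triv_obj H) M) M (hunit M).
Proof.
exact: (@bij_iso _ _ _ L P (tens_obj (triv_obj H) M) M (hunit M) (hunitV M) (@hunitK _ _ _ M) (@hunitVK _ _ _ M)).
Qed.
End TensorAction.

Section Main.
Variables (k : fieldType) (H : fdHopf k) (L : lintegral H) (B : modAlg H) (P : modclass (smash_comod B)).
Notation AB := (smash_comod B).

Lemma res_stab_exact : exact_functor (@stab_functor k H L AB (hopf_comod H) (res_functor B L) P
  (allmod (hopf_comod H)) (fun _ _ => I)).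
Proof. exact: stab_functor_exact. Qed.

Lemma quasi_iso_verdier : verdier_class (@quasi_iso k H B P L).
Proof. exact: (inverted_verdier (stab_quasi_triangulated L P) (stab_quasi_triangulated L _) res_stab_exact). Qed.

(** Restriction to H commutes with V (x) - up to the isomorphism [iota], and
    V (x) - preserves isomorphisms of the stable category of H. *)
Lemma tensor_quasi_iso (V : lmodType H) (PV : forall M : lmodType AB, P M -> P (hten V M)) :
  @wmap_functor (stab P L) (@quasi_iso k H B P L) (htenF PV).
Proof.
move=> X Y f qf.
pose AM := allmod (hopf_comod H).
have Ca := stab_additive L AM.
have Va := @htenF_additive k H (hopf_comod H) L AM V (fun _ _ => I).
pose iX := iota V X : @Hom (stabcat AM) (resH (htenF PV X)) (htenF (P := AM) (fun _ _ => I) (resH X)).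
pose iY := iota V Y : @Hom (stabcat AM) (resH (htenF PV Y)) (htenF (P := AM) (fun _ _ => I) (resH Y)).
have jX : is_iso iX.
  exact: (@bij_iso k H (hopf_comod H) L AM (resH (htenF PV X)) (htenF (P := AM) (fun _ _ => I) (resH X))
    (iota V X) (iotaV V X) (@iotaK _ _ _ V X) (@iotaVK _ _ _ V X)).
have jY : is_iso iY.
  exact: (@bij_iso k H (hopf_comod H) L AM (resH (htenF PV Y)) (htenF (P := AM) (fun _ _ => I) (resH Y))
    (iota V Y) (iotaV V Y) (@iotaK _ _ _ V Y) (@iotaVK _ _ _ V Y)).
have jf := fmap_iso (F := htenF (P := AM) (V := V) (fun _ _ => I)) qf.
apply: (iso_compl jY).
apply: (iso_eq (f := fmap (htenF (P := AM) (V := V) (fun _ _ => I)) (resH_map f : @Hom (stabcat AM) _ _) \oc iX)).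
  by apply: (stab_eq1 L) => t; symmetry; exact: iota_nat.
exact: (iso_comp (jf Ca Va) jX).
Qed.
End Main.

Section Final.
Variables (k : fieldType) (H : fdHopf k) (L : lintegral H) (B : modAlg H) (P : modclass (smash_comod B)).
Variable O : fractions (@quasi_iso k H B P L).
Let Wc := quasi_iso_verdier L P.
Let Ct := stab_quasi_triangulated L P.
Notation D := (DBH O).
Notation KH := (stab (fdmod H) L).

Lemma derived_triangulated : triangulated D.
Proof. exact: (frac_triangulated Wc _ O (stab_triangulated L P)). Qed.

(** Exactness is inherited by fractions because V (x) - is exact before
    localization and preserves quasi-isomorphisms. *)
Lemma derived_tensor_exact (V : lmodType H) (PV : forall M : lmodType (smash_comod B), P M -> P (hten V M)) :
  exists phi : forall X Y : stab P L,
              roof (@quasi_iso k H B P L) X Y ->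
              roof (@quasi_iso k H B P L) (htenF PV X) (htenF PV Y),
            @roof_induced (stab P L) (@quasi_iso k H B P L) (htenF PV) phi /\
            exact_functor (frac_functor (@quasi_iso_id k H B P L) O phi :
              prefunctor (DBH O) (DBH O)).
Proof.
have e : exact_functor (htenF PV : prefunctor (stab P L) (stab P L)).
  exact: (@stab_functor_exact _ _ L _ _ (tensor_functor L (smash_comod B) V) P P PV).
exists (roof_image (tensor_quasi_iso PV)).
have ind := (@roof_image_induced _ Ct _ Wc _ (tensor_quasi_iso PV)).
split; first exact: ind.
exact: (frac_exact Wc _ O ind e).
Qed.

Lemma tens_preserves_derived_right (M : pmod P) :
  @preserves_triangles KH D (fun V => tens_obj V M).
Proof.
move=> X Y Z u v w /(@tens_right_preserves k H L _ P M)[u' [v' [w' d]]].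
by exists (roof_of (@quasi_iso_id k H B P L) u'), (roof_of (@quasi_iso_id k H B P L) v'),
  (roof_of (@quasi_iso_id k H B P L) w'); exact: frac_dist_Q.
Qed.

Lemma tens_preserves_derived_left (V : pmod (fdmod H)) :
  @preserves_triangles D D (fun M => tens_obj V M).
Proof.
have [phi [_ e]] := derived_tensor_exact (fun M PM => mc_findim (pmodP V) PM).
exact: (exact_preserves e).
Qed.

Lemma keq_derived_iso (X Y : pmod P) (f : {linear X -> Y}) :
  @is_iso (stabcat P) X Y f -> keq (kgen X : kterm D) (kgen Y).
Proof.
move=> jf; apply: (keq_iso (triangulated_quasi derived_triangulated) (f := roof_of (@quasi_iso_id k H B P L) f)).
by apply: (Q_iso Wc); exact: (vc_iso Wc).
Qed.

(** The tensor product of finite-dimensional modules is exact in each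
    variable, associative and unital up to isomorphism. *)
Lemma stable_ring : setoid_ring (@keq KH) kzero (@kadd _) (@kopp _)
          (kgen (triv_obj H)) (kbil (@tens_obj k H _ (fdmod H))).
Proof.
have lp V := @tens_left_preserves k H L (hopf_comod H) (fdmod H) V.
have rp M := @tens_right_preserves k H L (hopf_comod H) (fdmod H) M.
have Kt := stab_quasi_triangulated L (fdmod H).
split; try by [exact: keq_refl|exact: keq_sym|exact: keq_trans|exact: keq_add|exact: keq_opp
  |exact: keq_addA|exact: keq_addC|exact: keq_add0|exact: keq_addN].
- by move=> x x' y y'; exact: (kbil_keq (C := KH) (D := KH) (E := KH) lp rp).
- move=> x y z; apply: (@kbil_assoc KH KH KH KH KH KH) => V W M.
  exact: (keq_iso Kt (tens_assoc_iso L V W M)).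
- move=> x; apply: (@kbil_unitl KH KH) => M.
  exact: (keq_iso Kt (tens_unit_iso L M)).
- move=> x; apply: (@kbil_unitr KH KH) => M.
  have jM : @is_iso (stabcat (fdmod H)) (tens_obj M (triv_obj H)) M (hunitr M).
    exact: (@bij_iso _ _ _ L (fdmod H) (tens_obj M (triv_obj H)) M (hunitr M) (hunitrV M) (@hunitrK _ _ M) (@hunitrVK _ _ M)).
  exact: (keq_iso Kt jM).
- by move=> x y z; exact: keq_refl.
- by move=> x y z; exact: (@kbilDr KH KH KH).
Qed.

(** Exactness in the left variable is that of - (x) M from the stable
    category of H to that of A, followed by localization; in the right
    variable it is that of V (x) - on fractions. *)
Lemma derived_module : setoid_module (@keq KH) (@kadd _)
          (kgen (triv_obj H)) (kbil (@tens_obj k H _ (fdmod H)))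
          (@keq D) kzero (@kadd _) (@kopp _)
          (kbil (@tens_obj k H _ P)).
Proof.
split; try by [exact: keq_refl|exact: keq_sym|exact: keq_trans|exact: keq_add|exact: keq_opp
  |exact: keq_addA|exact: keq_addC|exact: keq_add0|exact: keq_addN].
- move=> x x' y y'.
  exact: (kbil_keq (C := KH) (D := D) (E := D) tens_preserves_derived_left tens_preserves_derived_right).
- move=> x y z; apply: (@kbil_assoc KH KH D D D KH) => V W M.
  exact: (keq_derived_iso (tens_assoc_iso L V W M)).
- move=> x; apply: (@kbil_unitl KH D) => M.
  exact: (keq_derived_iso (tens_unit_iso L M)).
- by move=> x y z; exact: keq_refl.
- by move=> x y z; exact: (@kbilDr KH D D).
Qed.
End Final.

Theorem corollary2 (k : fieldType) (H : fdHopf k) (L : lintegral H)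
    (B : modAlg H) (P : modclass (smash_comod B)) :
  inhabited (fractions (@quasi_iso k H B P L)) /\
  forall O : fractions (@quasi_iso k H B P L),
    [/\ triangulated (DBH O),
        forall (V : lmodType H)
            (PV : forall M : lmodType (smash_comod B), P M -> P (hten V M)),
          exists phi : forall X Y : stab P L,
              roof (@quasi_iso k H B P L) X Y ->
              roof (@quasi_iso k H B P L) (htenF PV X) (htenF PV Y),
            @roof_induced (stab P L) (@quasi_iso k H B P L) (htenF PV) phi /\
            exact_functor (frac_functor (@quasi_iso_id k H B P L) O phi :
              prefunctor (DBH O) (DBH O)),
        setoid_ring (@keq (stab (fdmod H) L)) kzero (@kadd _) (@kopp _)
          (kgen (triv_obj H)) (kbil (@tens_obj k H _ (fdmod H)))
      & setoid_module (@keq (stab (fdmod H) L)) (@kadd _)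
          (kgen (triv_obj H)) (kbil (@tens_obj k H _ (fdmod H)))
          (@keq (DBH O)) kzero (@kadd _) (@kopp _)
          (kbil (@tens_obj k H _ P))].
Proof.
have Wc := quasi_iso_verdier L P; have Ct := stab_quasi_triangulated L P.
split; first exact: (fractions_inhabited Wc).
move=> O; split.
- exact: derived_triangulated.
- exact: derived_tensor_exact.
- exact: stable_ring.
- exact: derived_module.
Qed.
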